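(* Let $H_i$ ($i\in\mathbb{N}$) and $H$ be functions $[0,T]\times\mathbb{R}^n\times\mathbb{R}^n\to\mathbb{R}$ satisfying (H1)–(H4) and (HLC) with the same integrable functions $c(\cdot)$ and $k_R(\cdot)$ ($R>0$). Let $g_i$, $g:\mathbb{R}^n\to\mathbb{R}\cup\{+\infty\}$ be proper, lower semicontinuous, with $g_i$ epi-converging to $g$. Assume $\max\{|H_i(t,0,0)|,|H(t,0,0)|\}\le\mu(t)$ for all $t\in[0,T]$, $i\in\mathbb{N}$, for some integrable $\mu$. Let $(\mathbb{R}^{n+1},f_i,l_i)$ and $(\mathbb{R}^{n+1},f,l)$ be the Steiner representations of $H_i$ and $H$, and let $$V_i(t_0,x_0)=\inf_{(x,a)\in S_{f_i}(t_0,x_0)}\Big\{g_i(x(T))+\int_{t_0}^T l_i(t,x,a)\,dt\Big\},\quad V(t_0,x_0)=\inf_{(x,a)\in S_{f}(t_0,x_0)}\Big\{g(x(T))+\int_{t_0}^T l(t,x,a)\,dt\Big\}.$$ If $H_i(t,\cdot,\cdot)\to H(t,\cdot,\cdot)$ uniformly on compact sets for every $t\in[0,T]$, then $V_i$ epi-converge to $V$.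
   Context: Hypotheses: (H1) $H(\cdot,x,p)$ Lebesgue measurable; (H2) $H(t,\cdot,\cdot)$ continuous; (H3) $H(t,x,\cdot)$ convex; (H4) there is measurable $c\ge0$ with $|H(t,x,p)-H(t,x,q)|\le c(t)(1+|x|)|p-q|$; (HLC) for each $R>0$ there is measurable $k_R\ge0$ with $|H(t,x,p)-H(t,y,p)|\le k_R(t)(1+|p|)|x-y|$ for $x,y\in\bar B_R$, all $p$. $H^*(t,x,v)=\sup_p\{\langle v,p\rangle-H(t,x,p)\}$. Proper: never $-\infty$, not identically $+\infty$. A sequence $\varphi_i$ epi-converges to $\varphi$ if for every $z$: $\liminf_i\varphi_i(z_i)\ge\varphi(z)$ for every sequence $z_i\to z$, and $\limsup_i\varphi_i(z_i)\le\varphi(z)$ for some sequence $z_i\to z$. $S_f(t_0,x_0)$: pairs $x(\cdot)$ absolutely continuous on $[t_0,T]$, $a(\cdot)\in L^1([t_0,T],\mathbb{R}^{n+1})$, $\dot x=f(t,x,a)$ a.e., $x(t_0)=x_0$. Steiner representation of $H$: $E(t,x)=\mathrm{epi}\,H^*(t,x,\cdot)\subset\mathbb{R}^{n+1}$; $\Phi(t,x,a)=E(t,x)\cap\bar B(a,2d(a,E(t,x)))$; Steiner point $s_m(K)=m\int_{S^{m-1}}p\max_{y\in K}\langle p,y\rangle\,\mu(dp)$ ($\mu$ normalized rotation-invariant measure on the unit sphere); $(f,l)(t,x,a)=s_{n+1}(\Phi(t,x,a))$ with $f\in\mathbb{R}^n$, $l\in\mathbb{R}$. *)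

(* Defs.v *)
From HB Require Import structures.
From mathcomp Require Import all_boot all_order all_algebra.
From mathcomp Require Import all_classical all_reals all_analysis.
Set Implicit Arguments. Unset Strict Implicit. Unset Printing Implicit Defensive.
Import Order.TTheory GRing.Theory Num.Theory.
Import numFieldNormedType.Exports.
Local Open Scope classical_set_scope.
Local Open Scope ring_scope.

(** Vectors of R^n are row vectors 'rV[R]_n.  The norm |.| of the paper is the
    Euclidean norm (the library norm on 'rV is the sup norm, which induces the
    same topology, so topological notions are taken from the library). *)

Section Defs.
Context {R : realType}.

Notation lebc := (@completed_lebesgue_measure R).
Notation LebT := (caratheodory_type (@wlength R idfun)^*%mu).

Definition dotr {n} (u v : 'rV[R]_n) : R := \sum_(i < n) u 0 i * v 0 i.
Definition enorm {n} (u : 'rV[R]_n) : R := Num.sqrt (dotr u u).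

Definition Lmeasurable (D : set R) (f : R -> R) : Prop :=
  measurable_fun (D : set LebT) f.
Definition Lintegrable (D : set R) (f : R -> R) : Prop :=
  lebc.-integrable (D : set LebT) (fun t => (f t)%:E).
Definition Lintegral (D : set R) (f : R -> R) : \bar R :=
  (\int[lebc]_(t in (D : set LebT)) (f t)%:E)%E.

Definition H1 n (T : R) (H : R -> 'rV[R]_n -> 'rV[R]_n -> R) : Prop :=
  forall x p, Lmeasurable `[0, T] (fun t => H t x p).
Definition H2 n (T : R) (H : R -> 'rV[R]_n -> 'rV[R]_n -> R) : Prop :=
  forall t, t \in `[0, T] ->
    continuous (fun z : 'rV[R]_n * 'rV[R]_n => H t z.1 z.2).
Definition H3 n (T : R) (H : R -> 'rV[R]_n -> 'rV[R]_n -> R) : Prop :=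
  forall t, t \in `[0, T] -> forall x p q (lam : R), 0 <= lam <= 1 ->
    H t x (lam *: p + (1 - lam) *: q) <= lam * H t x p + (1 - lam) * H t x q.
Definition H4 n (T : R) (c : R -> R) (H : R -> 'rV[R]_n -> 'rV[R]_n -> R) : Prop :=
  forall t, t \in `[0, T] -> forall x p q,
    `|H t x p - H t x q| <= c t * (1 + enorm x) * enorm (p - q).
Definition HLC n (T : R) (k : R -> R -> R) (H : R -> 'rV[R]_n -> 'rV[R]_n -> R) : Prop :=
  forall r, 0 < r -> forall t, t \in `[0, T] -> forall x y p,
    enorm x <= r -> enorm y <= r ->
    `|H t x p - H t y p| <= k r t * (1 + enorm p) * enorm (x - y).

Definition Hconj n (H : R -> 'rV[R]_n -> 'rV[R]_n -> R) t x (v : 'rV[R]_n) : \bar R :=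
  ereal_sup [set ((dotr v p - H t x p)%:E) | p in [set: 'rV[R]_n]].

Definition epiE n (H : R -> 'rV[R]_n -> 'rV[R]_n -> R) t x : set 'rV[R]_(n + 1) :=
  [set a | (Hconj H t x (lsubmx a) <= (rsubmx a 0 0)%:E)%E].

Definition edist m (a : 'rV[R]_m) (E : set 'rV[R]_m) : R :=
  inf [set enorm (a - e) | e in E].

Definition PhiS n (H : R -> 'rV[R]_n -> 'rV[R]_n -> R) t x (a : 'rV[R]_(n + 1)) :
  set 'rV[R]_(n + 1) :=
  epiE H t x `&` [set y | enorm (y - a) <= 2 * edist a (epiE H t x)].

Definition suppf m (K : set 'rV[R]_m) (p : 'rV[R]_m) : R :=
  sup [set dotr p y | y in K].

Definition BorelRV m := g_sigma_algebraType (@open 'rV[R]_m).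
Definition sphere m : set (BorelRV m) := [set p | enorm p = 1].
Arguments sphere : clear implicits.

Definition sphere_measure m (mu : probability (BorelRV m) R) : Prop :=
  mu (~` sphere m) = 0%E /\
  forall Q : 'M[R]_m, Q *m Q^T = 1%:M ->
    forall A : set (BorelRV m), measurable A ->
      mu ((fun p : BorelRV m => (p *m Q : BorelRV m)) @^-1` A) = mu A.

Definition steiner m (mu : probability (BorelRV m) R) (K : set 'rV[R]_m) : 'rV[R]_m :=
  \row_j (m%:R * fine (\int[mu]_(p in sphere m) (p 0 j * suppf K p)%:E)%E).

Definition steinerFL n (mu : probability (BorelRV (n + 1)) R)
  (H : R -> 'rV[R]_n -> 'rV[R]_n -> R) t x (a : 'rV[R]_(n + 1)) : 'rV[R]_(n + 1) :=
  steiner mu (PhiS H t x a).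
Definition steinerF n mu (H : R -> 'rV[R]_n -> 'rV[R]_n -> R) t x a : 'rV[R]_n :=
  lsubmx (steinerFL mu H t x a).
Definition steinerL n mu (H : R -> 'rV[R]_n -> 'rV[R]_n -> R) t x a : R :=
  rsubmx (steinerFL mu H t x a) 0 0.

Definition abs_cont n (a b : R) (x : R -> 'rV[R]_n) : Prop :=
  forall eps : R, 0 < eps -> exists2 delta : R, 0 < delta &
    forall (N : nat) (u v : nat -> R),
      (forall i, (i < N)%N -> a <= u i /\ u i <= v i /\ v i <= b) ->
      (forall i j, (i < N)%N -> (j < N)%N -> i <> j -> v i <= u j \/ v j <= u i) ->
      \sum_(i < N) (v i - u i) < delta ->
      \sum_(i < N) enorm (x (v i) - x (u i)) < eps.

Definition Straj n (T : R) (f : R -> 'rV[R]_n -> 'rV[R]_(n + 1) -> 'rV[R]_n)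
  (t0 : R) (x0 : 'rV[R]_n) : set ((R -> 'rV[R]_n) * (R -> 'rV[R]_(n + 1))) :=
  [set xa : (R -> 'rV[R]_n) * (R -> 'rV[R]_(n + 1)) | [/\ abs_cont t0 T xa.1,
     (forall j, Lintegrable `[t0, T] (fun t => xa.2 t 0 j)),
     {ae lebc, forall t : LebT, t \in `[t0, T] ->
        derivable xa.1 t 1 /\ 'D_1 xa.1 t = f t (xa.1 t) (xa.2 t)}
   & xa.1 t0 = x0]].

Definition valuef n (T : R) (g : 'rV[R]_n -> \bar R)
  (f : R -> 'rV[R]_n -> 'rV[R]_(n + 1) -> 'rV[R]_n)
  (l : R -> 'rV[R]_n -> 'rV[R]_(n + 1) -> R) (t0 : R) (x0 : 'rV[R]_n) : \bar R :=
  ereal_inf [set (g (xa.1 T) + Lintegral `[t0, T] (fun t => l t (xa.1 t) (xa.2 t)))%E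
            | xa in Straj T f t0 x0].

Definition proper_fun (X : Type) (g : X -> \bar R) : Prop :=
  (forall x, g x != -oo%E) /\ (exists x, g x != +oo%E).

Definition epi_converge (X : topologicalType) (D : set X)
  (F_ : nat -> X -> \bar R) (F : X -> \bar R) : Prop :=
  forall z, D z ->
    (forall z_ : nat -> X, (forall i, D (z_ i)) -> z_ @ \oo --> z ->
       (F z <= limn_einf (fun i => F_ i (z_ i)))%E) /\
    (exists2 z_ : nat -> X, (forall i, D (z_ i)) /\ z_ @ \oo --> z &
       (limn_esup (fun i => F_ i (z_ i)) <= F z)%E).

End Defs.

(* Main.v *)
(** The Steiner point of a convex set lies in the set, and it is [a] when the set is [{a}]; since
    [Phi t x a = {a}] for [a] in [E t x], the value function is the infimum of
    [g (x T) + \int r] over the pairs of a curve [x] and an integrable [a = (x', r)] with values in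
    [E t (x t)].

    Lower limit: almost optimal curves for [H_i] are bounded by Gronwall's lemma and their velocities
    are dominated by an integrable function, so that along a subsequence they converge pointwise
    while the velocities converge weakly.  For each fixed [p] the inequality
    [<p, v_i> - H_i t x_i p <= r_i] passes to the limit in integrated form; the supremum over [p] is
    recovered from maxima over finitely many rational [p], by cutting the time interval according to
    the index that attains the maximum, and monotone convergence.

    Upper limit: a pair [(x, a)] for [H] is first projected measurably onto the epigraphs of [H_i],
    which moves [a] by a quantity tending to [0] in [L^1]; since the epigraphs are Lipschitz in [x],
    Filippov's iteration, run backward from the points of a recovery sequence of [g], then corrects
    the projected pair to an admissible pair for [H_i] close to [(x, a)]. *)

(* Measurability in time shapes the argument. The map [steinerFL] is never shown measurable in t:
   the velocity of a trajectory is measurable because it is a derivative, and the running cost is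
   replaced by the supremum of countably many integrable functions below it, compared through
   monotonicity of the integral for arbitrary functions. Selections from epigraphs are, likewise,
   limits of explicit iterations over rational p. The Steiner maps enter only through [value_le] and
   [value_lt]. Initial times move in the lower limit only; there the curves are extended by
   constants to the left, so that all of them live on [0, T]. In the upper limit the initial time
   stays fixed, and the iteration runs backward because a recovery sequence controls [g_ i] only at
   its own points, which must be the endpoints, while epi-convergence leaves the initial points
   free. *)
Require Import Defs.
From HB Require Import structures.
From mathcomp Require Import all_boot all_order all_algebra.
From mathcomp Require Import all_classical all_reals all_analysis.
From mathcomp Require Import measurable_realfun ring lra.
Import Order.TTheory GRing.Theory Num.Theory.
Import numFieldNormedType.Exports.
Local Open Scope classical_set_scope.
Local Open Scope ring_scope.
Set Implicit Arguments. Unset Strict Implicit. Unset Printing Implicit Defensive.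

(** * Euclidean norm and convex functions *)

Section Euclidean.
Context {R : realType} {n : nat}.
Implicit Types (u v w : 'rV[R]_n) (a : R).

Lemma dotrC u v : dotr u v = dotr v u.
Proof. by apply: eq_bigr => i _; rewrite mulrC. Qed.

Lemma dotrDl u v w : dotr (u + v) w = dotr u w + dotr v w.
Proof. by rewrite -big_split; apply: eq_bigr => i _; rewrite mxE mulrDl. Qed.

Lemma dotrZl a u v : dotr (a *: u) v = a * dotr u v.
Proof. by rewrite /dotr mulr_sumr; apply: eq_bigr => i _; rewrite mxE mulrA. Qed.

Lemma dotrNl u v : dotr (- u) v = - dotr u v.
Proof. by rewrite -scaleN1r dotrZl mulN1r. Qed.

Lemma dotrBl u v w : dotr (u - v) w = dotr u w - dotr v w.
Proof. by rewrite dotrDl dotrNl. Qed.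

Lemma dotrDr u v w : dotr u (v + w) = dotr u v + dotr u w.
Proof. by rewrite dotrC dotrDl !(dotrC u). Qed.

Lemma dotrZr a u v : dotr u (a *: v) = a * dotr u v.
Proof. by rewrite dotrC dotrZl dotrC. Qed.

Lemma dotrNr u v : dotr u (- v) = - dotr u v.
Proof. by rewrite dotrC dotrNl dotrC. Qed.

Lemma dotrBr u v w : dotr u (v - w) = dotr u v - dotr u w.
Proof. by rewrite dotrDr dotrNr. Qed.

Lemma dotr0 u : dotr u 0 = 0.
Proof. by rewrite -(scale0r u) dotrZr mul0r. Qed.

Lemma dot0r u : dotr 0 u = 0.
Proof. by rewrite dotrC dotr0. Qed.

Lemma dotr_sumr (I : Type) (s : seq I) (P : pred I) (F : I -> 'rV[R]_n) u :
  dotr u (\sum_(i <- s | P i) F i) = \sum_(i <- s | P i) dotr u (F i).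
Proof. exact: (big_morph _ (dotrDr u) (dotr0 u)). Qed.

Lemma dotr_deltar u j : dotr u (delta_mx 0 j) = u 0 j.
Proof.
rewrite /dotr (bigD1 j)//= mxE !eqxx mulr1 big1 ?addr0// => i ij.
by rewrite mxE eqxx/= (negbTE ij) mulr0.
Qed.

Lemma dotrr_ge0 u : 0 <= dotr u u.
Proof. by apply: sumr_ge0 => i _; rewrite -expr2 sqr_ge0. Qed.

Lemma enorm_ge0 u : 0 <= enorm u.
Proof. exact: sqrtr_ge0. Qed.

Lemma enorm_sqr u : enorm u ^+ 2 = dotr u u.
Proof. by rewrite sqr_sqrtr// dotrr_ge0. Qed.

Lemma enorm_eq0 u : enorm u = 0 -> u = 0.
Proof.
move=> u0; have /eqP := enorm_sqr u; rewrite u0 expr0n/= eq_sym psumr_eq0.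
  move=> /allP H; apply/rowP => i; have := H i (mem_index_enum _).
  by rewrite -expr2 sqrf_eq0/= mxE => /eqP.
by move=> i _; rewrite -expr2 sqr_ge0.
Qed.

Lemma enorm0 : enorm (0 : 'rV[R]_n) = 0.
Proof. by rewrite /enorm dotr0 sqrtr0. Qed.

Lemma enormZ a u : enorm (a *: u) = `|a| * enorm u.
Proof.
by rewrite /enorm dotrZl dotrZr mulrA -expr2 sqrtrM ?sqr_ge0// sqrtr_sqr.
Qed.

Lemma enormN u : enorm (- u) = enorm u.
Proof. by rewrite -scaleN1r enormZ normrN1 mul1r. Qed.

Lemma enormBC u v : enorm (u - v) = enorm (v - u).
Proof. by rewrite -opprB enormN. Qed.

Lemma dotr_le u v : dotr u v <= enorm u * enorm v.
Proof.
have [->|u0] := eqVneq u 0; first by rewrite dot0r enorm0 mul0r.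
have [->|v0] := eqVneq v 0; first by rewrite dotr0 enorm0 mulr0.
have pu : 0 < enorm u.
  by rewrite lt_neqAle enorm_ge0 andbT; apply: contra u0 => /eqP/esym/enorm_eq0 ->.
have pv : 0 < enorm v.
  by rewrite lt_neqAle enorm_ge0 andbT; apply: contra v0 => /eqP/esym/enorm_eq0 ->.
have := dotrr_ge0 (enorm v *: u - enorm u *: v).
rewrite dotrBl !dotrBr !dotrZl !dotrZr -!enorm_sqr (dotrC v u) => h.
have h2 : 0 <= enorm u * enorm v * (enorm u * enorm v - dotr u v) by nra.
by rewrite -subr_ge0 -(pmulr_rge0 _ (mulr_gt0 pu pv)).
Qed.

Lemma normr_dotr_le u v : `|dotr u v| <= enorm u * enorm v.
Proof.
by rewrite ler_norml dotr_le andbT lerNl -dotrNl (le_trans (dotr_le _ _))// enormN.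
Qed.

Lemma enormD u v : enorm (u + v) <= enorm u + enorm v.
Proof.
rewrite -(@ler_pXn2r _ 2%N)// ?nnegrE ?addr_ge0 ?enorm_ge0//.
rewrite enorm_sqr dotrDl !dotrDr -!enorm_sqr (dotrC v u).
have := dotr_le u v; nra.
Qed.

Lemma enormB u v : enorm (u - v) <= enorm u + enorm v.
Proof. by rewrite (le_trans (enormD _ _))// enormN. Qed.

Lemma enorm_triangle u v w : enorm (u - w) <= enorm (u - v) + enorm (v - w).
Proof. by rewrite (le_trans _ (enormD _ _))// addrA subrK. Qed.

Lemma enorm_le_dist u v : enorm u <= enorm v + enorm (u - v).
Proof. by rewrite (le_trans _ (enormD _ _))// addrC subrK. Qed.

Lemma coord_le_enorm u j : `|u 0 j| <= enorm u.
Proof.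
rewrite -(sqrtr_sqr (u 0 j)) ler_wsqrtr// /dotr (bigD1 j)//= expr2 lerDl.
by apply: sumr_ge0 => i _; rewrite -expr2 sqr_ge0.
Qed.

Lemma enorm_delta j : enorm (delta_mx 0 j : 'rV[R]_n) = 1.
Proof. by rewrite /enorm dotr_deltar mxE !eqxx sqrtr1. Qed.

Lemma enorm_le_sum u : enorm u <= \sum_j `|u 0 j|.
Proof.
rewrite [X in enorm X](_ : _ = \sum_j u 0 j *: (delta_mx 0 j : 'rV[R]_n)); last exact: row_sum_delta.
elim/big_ind2 : _ => [|x1 x2 y1 y2 h1 h2|j _].
- by rewrite enorm0.
- by rewrite (le_trans (enormD _ _))// lerD.
- by rewrite enormZ enorm_delta mulr1.
Qed.

Lemma coord_le_norm u j : `|u 0 j| <= `|u|.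
Proof.
rewrite [leRHS]/Num.Def.normr/= mx_normrE.
exact: (le_bigmax _ (fun ij : 'I_1 * 'I_n => `|u ij.1 ij.2|) (0, j)).
Qed.

Lemma norm_le_enorm u : `|u| <= enorm u.
Proof.
rewrite [leLHS]/Num.Def.normr/= mx_normrE; apply: bigmax_le; first exact: enorm_ge0.
by move=> [i j] _ /=; rewrite ord1 coord_le_enorm.
Qed.

Lemma enorm_le_norm u : enorm u <= n%:R * `|u|.
Proof.
rewrite (le_trans (enorm_le_sum u))//.
rewrite (le_trans (ler_sum _ (fun j _ => coord_le_norm u j)))//.
by rewrite sumr_const card_ord mulr_natl.
Qed.

Lemma enorm_le_dotr u a : 0 <= a -> (forall p, dotr u p <= a * enorm p) -> enorm u <= a.
Proof.
move=> a0 h; have := h u; rewrite -enorm_sqr => h1.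
have := enorm_ge0 u; rewrite le_eqVlt => /orP[/eqP <-//|u0].
by rewrite -(ler_pM2r u0) -expr2.
Qed.

(** Testing with p = u - v turns the one-sided inequality into |u - v|^2 <= 0; one-sided bounds are
    what support functions provide. *)
Lemma dotr_inj u v : (forall p, dotr p u <= dotr p v) -> u = v.
Proof.
move=> h; apply/subr0_eq/enorm_eq0/eqP; rewrite -sqrf_eq0 enorm_sqr eq_le dotrr_ge0 andbT.
by rewrite dotrBr subr_le0 h.
Qed.

End Euclidean.

(** * Convergence and cluster points of vectors *)

Section Convergence.
Context {R : realType} {n : nat}.
Implicit Types (T : Type).

Lemma cvg_rowP T (F : set_system T) (FF : Filter F) (f : T -> 'rV[R]_n) (l : 'rV[R]_n) :
  f @ F --> l <-> forall j, (f x 0 j) @[x --> F] --> l 0 j.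
Proof.
split=> [fl j|h].
  exact: (cvg_comp _ _ fl (@coord_continuous _ _ _ 0 j l)).
apply/cvgrPdist_le => e e0; near=> x.
rewrite [leLHS]/Num.Def.normr/= mx_normrE (bigmax_le _ (ltW e0))//= => -[i j] _.
rewrite !mxE/= ord1; move: j; near: x; apply: filter_forall => j.
by have /cvgrPdist_le/(_ e e0) := h j.
Unshelve. all: by end_near. Qed.

Lemma cvg_enormP T (F : set_system T) (FF : Filter F) (f : T -> 'rV[R]_n) (l : 'rV[R]_n) :
  f @ F --> l <-> forall e, 0 < e -> \forall x \near F, enorm (f x - l) <= e.
Proof.
split=> [/cvgrPdist_le h e e0|h].
  have e1 : 0 < e / n.+1%:R by rewrite divr_gt0// ltr0n.
  near=> x; rewrite enormBC (le_trans (enorm_le_norm _))//.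
  have : `|l - f x| <= e / n.+1%:R by near: x; exact: h.
  move=> h1; rewrite (le_trans (ler_wpM2l (ler0n _ _) h1))//.
  have : n%:R / n.+1%:R <= 1 :> R by rewrite ler_pdivrMr ?ltr0n// mul1r ler_nat.
  by move/(ler_wpM2l (ltW e0)); rewrite mulr1 mulrCA.
apply/cvgrPdist_le => e e0; near=> x.
rewrite (le_trans (norm_le_enorm _))// enormBC; near: x; exact: h.
Unshelve. all: by end_near. Qed.

Lemma near_enorm (u : 'rV[R]_n) (e : R) : 0 < e -> \forall v \near u, enorm (v - u) <= e.
Proof.
move=> e0; have /(@cvgrPdist_le _ _ _ _ (nbhs_filter u)) : v @[v --> u] --> u by exact: cvg_id.
have e1 : 0 < e / n.+1%:R by rewrite divr_gt0// ltr0n.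
move=> /(_ _ e1); apply: filter_app; near=> v => h1.
rewrite enormBC (le_trans (enorm_le_norm _))//.
rewrite (le_trans (ler_wpM2l (ler0n _ _) h1))//.
have : n%:R / n.+1%:R <= 1 :> R by rewrite ler_pdivrMr ?ltr0n// mul1r ler_nat.
by move/(ler_wpM2l (ltW e0)); rewrite mulr1 mulrCA.
Unshelve. all: by end_near. Qed.

Lemma enorm_continuous : continuous (@enorm R n).
Proof.
move=> u; apply/(@cvgrPdist_le _ _ _ _ (nbhs_filter u)) => e e0.
have := near_enorm u e0; apply: filter_app; near=> v => vu.
rewrite ler_norml; apply/andP; split.
  by have := enorm_le_dist v u; lra.
by have := enorm_le_dist u v; rewrite (enormBC u v); lra.
Unshelve. all: by end_near. Qed.

Lemma cvg_dotr T (F : set_system T) (FF : Filter F) (f : T -> 'rV[R]_n) (l u : 'rV[R]_n) :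
  f @ F --> l -> dotr u (f x) @[x --> F] --> dotr u l.
Proof.
move=> /cvg_enormP h; apply/cvgrPdist_le => e e0.
have e1 : 0 < e / (enorm u + 1) by rewrite divr_gt0// ltr_wpDl// enorm_ge0.
have := h _ e1; apply: filterS => x hx.
rewrite -dotrBr (le_trans (normr_dotr_le _ _))// enormBC.
rewrite (le_trans (ler_wpM2l (enorm_ge0 u) hx))// mulrCA ler_piMr ?(ltW e0)//.
by rewrite ler_pdivrMr ?mul1r ?lerDl// ltr_wpDl// enorm_ge0.
Qed.

(** Compactness of a cube. A cluster point is enough for [plimP], where monotone distances turn it
    into a limit. *)
Lemma bounded_cluster_seq (x : nat -> 'rV[R]_n) (M : R) : (forall k, enorm (x k) <= M) ->
  exists l, forall eps k, 0 < eps -> exists2 k', (k <= k')%N & enorm (x k' - l) <= eps.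
Proof.
move=> xM; pose A (_ : 'I_n) : set R := `[- M, M]%classic.
have cA := @rV_compact R n A (fun i => @segment_compact R (- M) M).
have [|l [_ cl]] := cA (x k @[k --> \oo]) _.
  exists 0%N => // k _ j /=; rewrite /A /= in_itv/= -ler_norml.
  by rewrite (le_trans (coord_le_enorm _ _)).
exists l => eps k eps0.
have h1 : (x k @[k --> \oo]) [set x k' | k' in [set k' | (k <= k')%N]].
  by exists k => // k' /= kk'; exists k'.
have [_ [[k' /= kk' <-] h]] := cl _ _ h1 (near_enorm l eps0).
by exists k'.
Qed.

End Convergence.

(** * The Hahn-Banach theorem for convex functions *)

Definition cvx {R : realType} {n : nat} (Q : 'rV[R]_n -> R) :=
  forall p q (lam : R), 0 <= lam <= 1 ->
    Q (lam *: p + (1 - lam) *: q) <= lam * Q p + (1 - lam) * Q q.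

Section Convex.
Context {R : realType} {n : nat}.
Implicit Types (p q w e : 'rV[R]_n) (Q D : 'rV[R]_n -> R).

Lemma cvx_mid Q p q : cvx Q -> 2 * Q (2^-1 *: (p + q)) <= Q p + Q q.
Proof.
move=> cQ; have h2 : 0 <= (2^-1 : R) <= 1 by apply/andP; split; lra.
have := cQ p q _ h2; rewrite (_ : 1 - 2^-1 = 2^-1 :> R); last by lra.
rewrite -scalerDr; lra.
Qed.

(* The one-dimensional Hahn-Banach step. *)
Lemma cvx_slope Q e : cvx Q -> 0 <= Q 0 -> exists c, forall s, c * s <= Q (s *: e).
Proof.
move=> cQ Q0.
(* 0 is the convex combination of [s *: e] and [- t *: e] with weights t / (s + t) and s / (s + t),
   so [0 <= Q 0] puts every left slope below every right slope; the supremum of the left ones is a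
   common slope. *)
have key s t : 0 < s -> 0 < t -> - Q (- t *: e) / t <= Q (s *: e) / s.
  move=> s0 t0; have st : 0 < s + t by exact: addr_gt0.
  have h01 : 0 <= t / (s + t) <= 1.
    apply/andP; split; first by rewrite divr_ge0// ltW.
    by rewrite ler_pdivrMr// mul1r lerDr ltW.
  have := cQ (s *: e) (- t *: e) _ h01.
  rewrite (_ : 1 - _ = s / (s + t)); last by field; rewrite gt_eqF.
  rewrite !scalerA -scalerDl (_ : t / (s + t) * s + s / (s + t) * - t = 0); last by field; rewrite gt_eqF.
  rewrite scale0r.
  move=> /(le_trans Q0); rewrite mulrAC (mulrAC s) -mulrDl pmulr_lge0 ?invr_gt0// => h.
  by rewrite ler_pdivrMr// mulrAC ler_pdivlMr//; lra.
pose S := [set - Q (- t *: e) / t | t in [set t | 0 < t]].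
have S0 : S !=set0 by exists (- Q (- 1 *: e) / 1); exists 1 => //=.
have Sb s : 0 < s -> ubound S (Q (s *: e) / s).
  by move=> s0 _ [t /= t0 <-]; exact: key.
have Ss : has_sup S by split=> //; exists (Q (1 *: e) / 1); exact: Sb.
exists (sup S) => s.
have [s0|s0|->] := ltgtP s 0; last by rewrite mulr0 scale0r.
- have : - Q (- (- s) *: e) / (- s) <= sup S.
    by apply: ub_le_sup; [exact: Ss.2|exists (- s) => //=; rewrite oppr_gt0].
  rewrite opprK ler_pdivrMr ?oppr_gt0//; lra.
- have : sup S <= Q (s *: e) / s by apply: ge_sup => //; exact: Sb.
  by rewrite ler_pdivlMr.
Qed.

(** Replacing Q by this infimum makes it affine along e with slope c ([dirinf_shift] for s and - s),
    while it stays convex, below Q and nonnegative at 0. *)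
Definition dirinf Q e (c : R) p := inf [set Q (p + s *: e) - c * s | s in [set: R]].

Section DirInf.
Variables (Q : 'rV[R]_n -> R) (e : 'rV[R]_n) (c : R).
Hypotheses (cQ : cvx Q) (hc : forall s, c * s <= Q (s *: e)).

Let has_inf_dir p : has_inf [set Q (p + s *: e) - c * s | s in [set: R]].
Proof.
split; first by exists (Q (p + 0 *: e) - c * 0); exists 0.
exists (- Q (- p)) => _ [s _ <-].
(* The midpoint of p + s e and - p lies on the line through e, where Q is at least c s / 2; the
   terms c s cancel. *)
have := cvx_mid (p + s *: e) (- p) cQ.
rewrite addrAC subrr add0r scalerA => h.
by have := hc (2^-1 * s); lra.
Qed.

Let dirinf_le p s : dirinf Q e c p <= Q (p + s *: e) - c * s.
Proof. by apply: ge_inf; [exact: (has_inf_dir p).2|exists s]. Qed.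

Let dirinf_adh p eps : 0 < eps -> exists s, Q (p + s *: e) - c * s < dirinf Q e c p + eps.
Proof. by move=> e0; have [_ [s _ <-] h] := inf_adherent e0 (has_inf_dir p); exists s. Qed.

Lemma dirinf_le_self p : dirinf Q e c p <= Q p.
Proof. by have := dirinf_le p 0; rewrite scale0r addr0 mulr0 subr0. Qed.

Lemma dirinf0 : 0 <= dirinf Q e c 0.
Proof.
apply: lb_le_inf; first exact: (has_inf_dir 0).1.
by move=> _ [s _ <-]; rewrite add0r subr_ge0.
Qed.

Lemma dirinf_shift p s : dirinf Q e c p + c * s <= dirinf Q e c (p + s *: e).
Proof.
apply: lb_le_inf; first exact: (has_inf_dir (p + s *: e)).1.
move=> _ [t _ <-]; have := dirinf_le p (s + t).
rewrite scalerDl addrA; lra.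
Qed.

(** Slopes fixed along earlier directions survive, so the coordinate directions can be treated one
    after the other. *)
Lemma dirinf_slope e' c' : (forall p s, Q p + c' * s <= Q (p + s *: e')) ->
  forall p s, dirinf Q e c p + c' * s <= dirinf Q e c (p + s *: e').
Proof.
move=> h p s; apply: lb_le_inf; first exact: (has_inf_dir (p + s *: e')).1.
move=> _ [t _ <-]; have := dirinf_le p t.
have := h (p + t *: e) s; rewrite addrAC; lra.
Qed.

Lemma dirinf_cvx : cvx (dirinf Q e c).
Proof.
move=> p q lam lam01; have /andP[l0 l1] := lam01.
apply/ler_addgt0Pr => eps eps0.
have [s hs] := dirinf_adh p eps0; have [t ht] := dirinf_adh q eps0.
have := dirinf_le (lam *: p + (1 - lam) *: q) (lam * s + (1 - lam) * t).
have := cQ (p + s *: e) (q + t *: e) lam01.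
have -> : lam *: p + (1 - lam) *: q + (lam * s + (1 - lam) * t) *: e =
    lam *: (p + s *: e) + (1 - lam) *: (q + t *: e).
  by apply/rowP => i; rewrite !mxE; ring.
have := ler_wpM2l l0 (ltW hs); have := ler_wpM2l (_ : 0 <= 1 - lam) (ltW ht).
rewrite subr_ge0 => /(_ l1); lra.
Qed.

End DirInf.

(** Once a slope is fixed along every coordinate direction, the reduced function Q' is at least Q' 0
    plus the linear function with these slopes. *)
Theorem cvx_hahn_banach Q : cvx Q -> 0 <= Q 0 -> exists w, forall p, dotr w p <= Q p.
Proof.
move=> cQ Q0.
have [Q' [c [_ Q'0 Q'Q hc]]] : exists (Q' : 'rV[R]_n -> R) (c : 'I_n -> R),
    [/\ cvx Q', 0 <= Q' 0, forall p, Q' p <= Q p & forall i, i \in enum 'I_n ->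
      forall p s, Q' p + c i * s <= Q' (p + s *: delta_mx 0 i)].
  elim: (enum 'I_n) => [|i r [Q' [c [cQ' Q'0 Q'Q hc]]]]; first by exists Q, (fun=> 0).
  have [ci hci] := cvx_slope (delta_mx 0 i) cQ' Q'0.
  exists (dirinf Q' (delta_mx 0 i) ci), (fun j => if j == i then ci else c j).
  split.
  - exact: dirinf_cvx.
  - exact: dirinf0.
  - by move=> p; rewrite (le_trans (dirinf_le_self cQ' hci p)).
  - move=> j; rewrite inE; have [->|ji]/= := eqVneq j i; first by move=> _; exact: dirinf_shift.
    by move=> /hc; exact: dirinf_slope.
exists (\row_j c j) => p; apply: le_trans (Q'Q p).
rewrite [in leRHS](row_sum_delta p) /dotr.
under eq_bigr do rewrite mxE.
suff : Q' 0 + \sum_i c i * p 0 i <= Q' (\sum_j p 0 j *: delta_mx 0 j).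
  by apply: le_trans; rewrite lerDr.
elim: (index_enum _) => [|i r IH]; first by rewrite !big_nil addr0.
rewrite !big_cons; have := hc i (mem_enum _ i) (\sum_(j <- r) p 0 j *: delta_mx 0 j) (p 0 i).
rewrite [in leRHS]addrC; lra.
Qed.

(** Hahn-Banach for the infimal convolution of D with delta |.|: it is below D, nonnegative at 0 by
    the third hypothesis, and its growth rate delta bounds the slope w. *)
Lemma cvx_dominated_slope D delta : cvx D -> 0 <= delta ->
  (forall y, 0 <= D y + delta * enorm y) ->
  exists2 w, enorm w <= delta & forall p, dotr w p <= D p.
Proof.
move=> cD d0 hD.
pose S p := [set D y + delta * enorm (p - y) | y in [set: 'rV[R]_n]].
have Sinf p : has_inf (S p).
  split; first by exists (D 0 + delta * enorm (p - 0)), 0.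
  exists (- delta * enorm p) => _ [y _ <-].
  have := hD y; have := enorm_le_dist y p; rewrite enormBC; nra.
pose Q p := inf (S p).
have Q_le p y : Q p <= D y + delta * enorm (p - y).
  by apply: ge_inf; [exact: (Sinf p).2|exists y].
have cQ : cvx Q.
  move=> p q lam lam01; have /andP[l0 l1] := lam01.
  apply/ler_addgt0Pr => eps eps0.
  have [_ [y _ <-] hy] := inf_adherent eps0 (Sinf p).
  have [_ [z _ <-] hz] := inf_adherent eps0 (Sinf q).
  have := Q_le (lam *: p + (1 - lam) *: q) (lam *: y + (1 - lam) *: z).
  have := cD y z _ lam01.
  have : enorm (lam *: p + (1 - lam) *: q - (lam *: y + (1 - lam) *: z)) <=
    lam * enorm (p - y) + (1 - lam) * enorm (q - z).
    rewrite opprD addrACA -!scalerBr (le_trans (enormD _ _))// !enormZ.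
    by rewrite !ger0_norm// subr_ge0.
  rewrite -/(Q p) in hy; rewrite -/(Q q) in hz.
  move=> /(ler_wpM2l d0); move: hy hz; set a := enorm (p - y); set b := enorm (q - z).
  move=> /ltW/(ler_wpM2l l0) hy /ltW/(ler_wpM2l (_ : 0 <= 1 - lam)).
  rewrite subr_ge0 => /(_ l1); lra.
have Q0 : 0 <= Q 0.
  apply: lb_le_inf; first exact: (Sinf 0).1.
  by move=> _ [y _ <-]; rewrite sub0r enormN.
have [w hw] := cvx_hahn_banach cQ Q0.
exists w => [|p]; last by apply: (le_trans (hw p)); have := Q_le p p; rewrite subrr enorm0 mulr0 addr0.
apply: enorm_le_dotr => // p.
rewrite leNgt; apply/negP => h.
have gap : 0 < dotr w p - delta * enorm p by rewrite subr_gt0.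
(* At t p the linear function exceeds delta |.| by |D 0| + 1, but the convolution exceeds it by at
   most D 0. *)
pose t := (`|D 0| + 1) / (dotr w p - delta * enorm p).
have t0 : 0 < t by rewrite divr_gt0// ltr_wpDl.
have := le_trans (hw (t *: p)) (Q_le _ 0).
rewrite subr0 enormZ dotrZr (gtr0_norm t0) => h2.
have : t * (dotr w p - delta * enorm p) = `|D 0| + 1 by rewrite divfK// gt_eqF.
have := ler_norm (D 0); lra.
Qed.

End Convex.

(** * Integrals of real-valued functions *)

Section RealIntegrable.
Context d (T : measurableType d) (R : realType) (mu : {measure set T -> \bar R}).
Implicit Types (D : set T) (f g : T -> R).

Lemma rintegrableD D f g : measurable D -> mu.-integrable D (EFin \o f) ->
  mu.-integrable D (EFin \o g) -> mu.-integrable D (EFin \o (fun x => f x + g x)).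
Proof. by move=> mD fi gi; apply: eq_integrable (integrableD mD fi gi). Qed.

Lemma rintegrableB D f g : measurable D -> mu.-integrable D (EFin \o f) ->
  mu.-integrable D (EFin \o g) -> mu.-integrable D (EFin \o (fun x => f x - g x)).
Proof. by move=> mD fi gi; apply: eq_integrable (integrableB mD fi gi). Qed.

Lemma rintegrableZ D f (r : R) : measurable D -> mu.-integrable D (EFin \o f) ->
  mu.-integrable D (EFin \o (fun x => r * f x)).
Proof. by move=> mD fi; apply: eq_integrable (integrableZl mD r fi). Qed.

Lemma rintegrable_sum D (I : eqType) (s : seq I) (f : I -> T -> R) : measurable D ->
  (forall i, i \in s -> mu.-integrable D (EFin \o f i)) ->
  mu.-integrable D (EFin \o (fun x => \sum_(i <- s) f i x)).
Proof.
move=> mD; elim: s => [|i s IH] h.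
  by under eq_fun do rewrite big_nil; exact: integrable0.
under eq_fun do rewrite big_cons; apply: rintegrableD => //.
  by apply: h; rewrite mem_head.
by apply: IH => j js; apply: h; rewrite inE js orbT.
Qed.

(* No measurability of f or g is needed: the integral of a nonnegative function
   is a supremum over simple functions. *)
Lemma le_integral_nomeas D (f g : T -> \bar R) : (forall x, D x -> (f x <= g x)%E) ->
  (\int[mu]_(x in D) f x <= \int[mu]_(x in D) g x)%E.
Proof.
move=> fg; have mono (u v : T -> \bar R) : (forall x, D x -> (0 <= u x)%E) ->
    (forall x, D x -> (u x <= v x)%E) -> (\int[mu]_(x in D) u x <= \int[mu]_(x in D) v x)%E.
  move=> u0 uv; have v0 x : D x -> (0 <= v x)%E by move=> Dx; exact: le_trans (u0 _ Dx) (uv _ Dx).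
  rewrite !ge0_integralE//; apply: le_ereal_sup => _ [h /= hu <-]; exists h => //= x.
  apply: (le_trans (hu x)); rewrite !patchE; case: ifPn => // /set_mem; exact: uv.
rewrite !(integralE _ _ f) !(integralE _ _ g); apply: leeB; apply: mono => x Dx //.
  by rewrite [@funepos]unlock ge_max le_max (fg x Dx)/= le_max lexx orbT.
by rewrite [@funeneg]unlock ge_max !le_max lexx orbT leeN2 (fg x Dx)/=.
Qed.

End RealIntegrable.

(** * Epigraphs and Steiner points *)

Section Blocks.
Context {R : realType} {n : nat}.
Implicit Types (a b : 'rV[R]_(n + 1)).

Lemma lsubmxB a b : lsubmx (a - b) = lsubmx a - lsubmx b.
Proof. by apply/rowP => i; rewrite !mxE. Qed.

Lemma rsubmxB a b : rsubmx (a - b) = rsubmx a - rsubmx b.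
Proof. by apply/rowP => i; rewrite !mxE. Qed.

End Blocks.

Section Epigraph.
Context {R : realType} {n : nat}.
Implicit Types (H : R -> 'rV[R]_n -> 'rV[R]_n -> R) (p : 'rV[R]_n) (a b : 'rV[R]_(n + 1)).

Lemma epiEP H t x a :
  epiE H t x a <-> forall p, dotr (lsubmx a) p - H t x p <= rsubmx a 0 0.
Proof.
rewrite /epiE /Hconj /=; split=> [/ereal_supP h p|h].
  by rewrite -lee_fin; apply: h; exists p.
by apply/ereal_supP => _ [p _ <-]; rewrite lee_fin.
Qed.

Lemma dotr_block a b :
  dotr a b = dotr (lsubmx a) (lsubmx b) + rsubmx a 0 0 * rsubmx b 0 0.
Proof.
rewrite /dotr big_split_ord/= big_ord1; congr (_ + _).
  by apply: eq_bigr => i _; rewrite !mxE.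
by rewrite !mxE.
Qed.

(* For a = (v, r), the constraint <v, p> - r <= H t x p of the epigraph is <a, hyp p> <= H t x p. *)
Definition hyp p : 'rV[R]_(n + 1) := row_mx p (- 1%:M).

Lemma dotr_hyp a p : dotr a (hyp p) = dotr (lsubmx a) p - rsubmx a 0 0.
Proof. by rewrite dotr_block row_mxKl row_mxKr !mxE eqxx mulrN1. Qed.

Lemma enorm_block a : enorm a <= enorm (lsubmx a) + `|rsubmx a 0 0|.
Proof.
rewrite -(@ler_pXn2r _ 2%N)// ?nnegrE ?addr_ge0 ?enorm_ge0//.
rewrite enorm_sqr dotr_block -enorm_sqr sqrrD -expr2 real_normK ?num_real//.
by rewrite lerD2r lerDl mulrn_wge0// mulr_ge0// enorm_ge0.
Qed.

(* By Hahn-Banach there is w with |w| <= delta and <w, p> <= H t x p - <v, p> + r + delta, so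
   that (v + w, r + delta) lies in the epigraph. *)
Lemma epiE_near H t x a delta : cvx (H t x) -> 0 <= delta ->
  (forall p, dotr (lsubmx a) p - rsubmx a 0 0 - H t x p <= delta * (1 + enorm p)) ->
  exists2 b, epiE H t x b & enorm (b - a) <= 2 * delta.
Proof.
move=> cH d0 h.
pose D p := H t x p - dotr (lsubmx a) p + rsubmx a 0 0 + delta.
have cD : cvx D.
  move=> p q lam lam01; have := cH p q lam lam01.
  by rewrite /D dotrDr !dotrZr; lra.
have hD p : 0 <= D p + delta * enorm p by have := h p; rewrite /D; lra.
have [w wd hw] := cvx_dominated_slope cD d0 hD.
exists (row_mx (lsubmx a + w) (rsubmx a + delta%:M)).
  apply/epiEP => p; rewrite row_mxKl row_mxKr dotrDl !mxE eqxx.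
  by have := hw p; rewrite /D !mxE mulr1n; lra.
rewrite (le_trans (enorm_block _))// lsubmxB rsubmxB row_mxKl row_mxKr.
rewrite addrAC subrr add0r !mxE eqxx mulr2n mulrDl mul1r lerD//.
by rewrite addrAC subrr add0r ger0_norm.
Qed.

(** The point 0 violates the constraint of p by at most |H t x 0| + C |p|, so [epiE_near] moves it
    into the epigraph. *)
Lemma epiE_nonempty H t x C : cvx (H t x) ->
  (forall p q, `|H t x p - H t x q| <= C * enorm (p - q)) -> epiE H t x !=set0.
Proof.
move=> cH lH.
have [] := @epiE_near H t x 0 (`|H t x 0| + `|C|) cH _ _; first exact: addr_ge0.
- move=> p; rewrite linear0 dot0r linear0 mxE.
  have := lH p 0; rewrite subr0 => h.
  have h1 : - H t x p <= `|H t x 0| + C * enorm p.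
    by have := ler_norm (- H t x 0); rewrite normrN; move: h; rewrite ler_norml; lra.
  rewrite subr0 sub0r (le_trans h1)// mulrDr mulr1.
  have := ler_wpM2r (enorm_ge0 p) (ler_norm C).
  by have := mulr_ge0 (normr_ge0 (H t x 0)) (enorm_ge0 p); have := normr_ge0 C; nra.
- by move=> b Eb _; exists b.
Qed.

End Epigraph.

Section SupportFunction.
Context {R : realType} {m : nat}.
Variables (K : set 'rV[R]_m) (M : R).
Hypotheses (K0 : K !=set0) (KM : forall y, K y -> enorm y <= M).

Let M0 : 0 <= M.
Proof. by have [y /KM] := K0; apply: le_trans; exact: enorm_ge0. Qed.

Let has_sup_suppf p : has_sup [set dotr p y | y in K].
Proof.
split; first by have [y Ky] := K0; exists (dotr p y), y.
exists (enorm p * M) => _ [y /KM Ky <-].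
by rewrite (le_trans (dotr_le _ _))// ler_wpM2l// enorm_ge0.
Qed.

Lemma le_suppf p y : K y -> dotr p y <= suppf K p.
Proof. by move=> Ky; apply: ub_le_sup; [exact: (has_sup_suppf p).2|exists y]. Qed.

Lemma suppf_le p r : (forall y, K y -> dotr p y <= r) -> suppf K p <= r.
Proof.
by move=> h; apply: ge_sup; [exact: (has_sup_suppf p).1|move=> _ [y Ky <-]; exact: h].
Qed.

Lemma suppfD p q : suppf K (p + q) <= suppf K p + suppf K q.
Proof. by apply: suppf_le => y Ky; rewrite dotrDl lerD// le_suppf. Qed.

Lemma suppfZ c p : 0 <= c -> suppf K (c *: p) <= c * suppf K p.
Proof. by move=> c0; apply: suppf_le => y Ky; rewrite dotrZl ler_wpM2l// le_suppf. Qed.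

Lemma suppf_bound p : suppf K p <= M * enorm p.
Proof.
apply: suppf_le => y /KM Ky; rewrite mulrC.
by rewrite (le_trans (dotr_le _ _))// ler_wpM2l// enorm_ge0.
Qed.

Lemma suppf_lip p q : `|suppf K p - suppf K q| <= M * enorm (p - q).
Proof.
have h u v : suppf K u - suppf K v <= M * enorm (u - v).
  have := suppfD (u - v) v; rewrite subrK.
  by have := suppf_bound (u - v); lra.
by rewrite ler_norml h andbT; have := h q p; rewrite enormBC; lra.
Qed.

Lemma suppf_continuous : continuous (suppf K).
Proof.
move=> p; apply/(@cvgrPdist_le _ _ _ _ (nbhs_filter p)) => e e0.
have e1 : 0 < e / (M + 1) by rewrite divr_gt0// ltr_wpDl.
have := near_enorm p e1; apply: filter_app; near=> q => h.
rewrite (le_trans (suppf_lip _ _))// enormBC (le_trans (ler_wpM2l M0 h))//.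
by rewrite mulrCA ler_piMr ?(ltW e0)// ler_pdivrMr ?mul1r ?lerDl// ltr_wpDl.
Unshelve. all: by end_near. Qed.

End SupportFunction.

(** * Invariant integration on the sphere *)

Section SphereIntegral.
Context {R : realType} {m : nat}.
Variable mu : probability (@BorelRV R m) R.
Local Notation S := (@sphere R m).
Hypothesis muS : sphere_measure mu.

Lemma dotr_mx (u v : 'rV[R]_m) : dotr u v = (u *m v^T) 0 0.
Proof. by rewrite mxE; apply: eq_bigr => i _; rewrite mxE. Qed.

Lemma enorm_orth (Q : 'M[R]_m) (p : 'rV[R]_m) : Q *m Q^T = 1%:M -> enorm (p *m Q) = enorm p.
Proof.
move=> QQ; congr Num.sqrt.
by rewrite dotr_mx trmx_mul mulmxA -(mulmxA p) QQ mulmx1 -dotr_mx.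
Qed.

Lemma continuous_BorelRV (f : 'rV[R]_m -> R) :
  continuous f -> measurable_fun [set: @BorelRV R m] (f : @BorelRV R m -> R).
Proof.
move=> /continuousP cf; apply: (measurability _ (RGenOpens.measurableE R)).
move=> _ [_ [a [b ->] <-]]; rewrite setTI.
by apply: sub_sigma_algebra; apply: cf; exact: interval_open.
Qed.

Lemma continuous_map_BorelRV (f : 'rV[R]_m -> 'rV[R]_m) :
  continuous f -> measurable_fun [set: @BorelRV R m] (f : @BorelRV R m -> @BorelRV R m).
Proof.
move=> /continuousP cf; apply: (@measurability _ _ (@BorelRV R m) (@BorelRV R m) _ _ (@open 'rV[R]_m) erefl).
move=> _ [A oA <-]; rewrite setTI.
by apply: sub_sigma_algebra; exact: cf.
Qed.

Lemma measurable_sphere : measurable S.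
Proof.
rewrite -[S]setTI.
have h := continuous_BorelRV (@enorm_continuous R m).
exact: (h measurableT [set 1] (measurable_set1 (1 : R))).
Qed.

Lemma mu_sphere : mu S = 1%E.
Proof.
have mS := measurable_sphere.
transitivity (mu S + mu (~` S))%E; first by rewrite (eqP (introT eqP muS.1)) adde0.
transitivity (mu (S `|` ~` S)); last by rewrite setUv; exact: probability_setT.
apply/esym; apply: measureU => //; last exact: setICr.
exact: measurableC.
Qed.

Lemma sphere_integrable (f : 'rV[R]_m -> R) (M : R) : continuous f ->
  (forall p, enorm p = 1 -> `|f p| <= M) -> mu.-integrable S (EFin \o f).
Proof.
move=> cf fM; apply: measurable_bounded_integrable.
- exact: measurable_sphere.
- by apply: le_lt_trans (ltry 1); rewrite le_eqVlt; apply/orP; left; apply/eqP; exact: mu_sphere.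
- by apply: measurable_funTS; exact: continuous_BorelRV.
- exists M; split; first exact: num_real.
  by move=> x Mx p /= /fM Mp; rewrite (le_trans Mp)// ltW.
Qed.

Lemma sphere_invariant (Q : 'M[R]_m) (f : 'rV[R]_m -> R) (M : R) :
  Q *m Q^T = 1%:M -> continuous (fun p : 'rV[R]_m => p *m Q) -> continuous f ->
  (forall p, enorm p = 1 -> `|f p| <= M) ->
  Rintegral mu S f = Rintegral mu S (fun p => f (p *m Q)).
Proof.
move=> QQ cQ cf fM.
pose phi (p : @BorelRV R m) : @BorelRV R m := p *m Q.
have mphi : measurable_fun [set: @BorelRV R m] phi by exact: continuous_map_BorelRV.
have nQ p : enorm (p *m Q) = enorm p by exact: enorm_orth.
have preS : phi @^-1` S = S by apply/seteqP; split=> p; rewrite /S/= nQ.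
congr fine.
rewrite -[in RHS]preS.
rewrite -(@integral_pushforward _ _ _ _ _ _ mphi mu S (EFin \o f)).
- apply: eq_measure_integral => A mA _.
  exact/esym/(muS.2 Q QQ A mA).
- by apply/measurable_EFinP; exact: continuous_BorelRV.
- rewrite preS; apply: (@sphere_integrable (f \o phi) M).
    by move=> p; apply: continuous_comp; [exact: cQ|exact: cf].
  by move=> p p1; apply: fM; rewrite nQ.
- exact: measurable_sphere.
Qed.

(** The Householder reflection in the hyperplane orthogonal to z, acting on row vectors from the
    right. Reflections are the only rotations used: they exchange vectors of equal norm and send u
    to - u. *)
Definition reflx (z : 'rV[R]_m) : 'M[R]_m := 1%:M - (2 / dotr z z) *: (z^T *m z).

Lemma mul_reflx z p : p *m reflx z = p - (2 * dotr p z / dotr z z) *: z.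
Proof.
rewrite mulmxBr mulmx1 -scalemxAr mulmxA; congr (_ - _).
have -> : p *m z^T = (dotr p z)%:M.
  by apply/rowP => i; rewrite ord1 !mxE eqxx; apply: eq_bigr => j _; rewrite mxE.
by rewrite mul_scalar_mx scalerA mulrAC.
Qed.

Lemma reflx_orth z : z != 0 -> reflx z *m (reflx z)^T = 1%:M.
Proof.
move=> z0; have zz : dotr z z != 0.
  by apply: contra z0 => /eqP h; apply/eqP/enorm_eq0; rewrite /enorm h sqrtr0.
have -> : (reflx z)^T = reflx z.
  by rewrite /reflx linearB/= trmx1 linearZ/= trmx_mul trmxK.
apply/row_matrixP => i; rewrite row_mul [row i (reflx z)]rowE !mul_reflx dotrBl dotrZl.
set e := delta_mx 0 i.
have -> : 2 * (dotr e z - 2 * dotr e z / dotr z z * dotr z z) / dotr z z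
  = - (2 * dotr e z / dotr z z) by field.
by rewrite row1 scaleNr opprK subrK.
Qed.

Lemma reflx_continuous z : continuous (fun p : 'rV[R]_m => p *m reflx z).
Proof.
move=> p; apply/(@cvg_enormP _ _ _ _ (nbhs_filter p)) => e e0.
pose C := 1 + `|2 / dotr z z| * enorm z * enorm z.
have C0 : 0 < C by rewrite ltr_wpDr// !mulr_ge0// enorm_ge0.
have := near_enorm p (divr_gt0 e0 C0); apply: filter_app; near=> q => h.
rewrite -mulmxBl mul_reflx (le_trans (enormB _ _))// enormZ.
rewrite mulrAC normrM.
have := normr_dotr_le (q - p) z => h2.
apply: (@le_trans _ _ (C * enorm (q - p))).
  rewrite [leRHS]mulrDl mul1r lerD2l.
  have := ler_wpM2l (normr_ge0 (2 / dotr z z)) h2.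
  move=> /(ler_wpM2r (enorm_ge0 z)); lra.
by rewrite mulrC -ler_pdivlMr.
Unshelve. all: by end_near. Qed.

Lemma dotrr_continuous u : continuous (fun p : 'rV[R]_m => dotr u p).
Proof. by move=> p; exact: (@cvg_dotr _ _ _ _ (nbhs_filter p) id p u (@cvg_id _ _)). Qed.

Lemma dotr_sphere (u p : 'rV[R]_m) : enorm p = 1 -> `|dotr u p| <= enorm u.
Proof. by move=> p1; rewrite (le_trans (normr_dotr_le _ _))// p1 mulr1. Qed.

Let sq (u : 'rV[R]_m) := Rintegral mu S (fun p : 'rV[R]_m => dotr u p ^+ 2).

Let sq_cont (u : 'rV[R]_m) : continuous (fun p : 'rV[R]_m => dotr u p ^+ 2).
Proof. move=> p; apply: (@continuous_comp _ _ _ (dotr u) (fun x => x ^+ 2) p).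
  exact: dotrr_continuous.
exact: exprn_continuous. Qed.

Let sq_bound (u p : 'rV[R]_m) : enorm p = 1 -> `|dotr u p ^+ 2| <= enorm u ^+ 2.
Proof.
move=> /(dotr_sphere u) h; rewrite normrX ler_pXn2r// nnegrE//; exact: enorm_ge0.
Qed.

(** The reflection in u - w exchanges u and w when their norms agree. *)
Let sq_eq (u w : 'rV[R]_m) : enorm u = enorm w -> sq u = sq w.
Proof.
move=> uw; have [->//|/eqP neq] := eqVneq u w.
have z0 : u - w != 0 by rewrite subr_eq0; apply/eqP.
have zz : dotr (u - w) (u - w) = 2 * dotr u (u - w).
  rewrite dotrBl (dotrBr u) (dotrBr w) -!enorm_sqr uw (dotrC w u); ring.
have zn : dotr (u - w) (u - w) != 0.
  by apply: contra z0 => /eqP h; apply/eqP/enorm_eq0; rewrite /enorm h sqrtr0.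
have hq (q : 'rV[R]_m) : dotr u (q *m reflx (u - w)) = dotr w q.
  rewrite mul_reflx (dotrBr u q) dotrZr.
  rewrite (_ : 2 * _ / _ * _ = dotr q (u - w)); last first.
    by rewrite mulrAC (mulrC 2) -(mulrA _ 2) -zz mulfK.
  by rewrite dotrBr (dotrC q u) (dotrC q w) opprB addrC subrK.
rewrite /sq (sphere_invariant (reflx_orth z0) (@reflx_continuous _) (@sq_cont u) (@sq_bound u)).
by apply: eq_Rintegral => p _; rewrite hq.
Qed.

(** The squares of the m coordinates add up to 1 on the sphere and have equal integrals by [sq_eq],
    so each integral is 1 / m; homogeneity gives the rest. *)
Lemma sphere_second_moment (u : 'rV[R]_m) :
  m%:R * Rintegral mu S (fun p : 'rV[R]_m => dotr u p ^+ 2) = enorm u ^+ 2.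
Proof.
have sqZ c w : sq (c *: w) = c ^+ 2 * sq w.
  rewrite /sq -RintegralZl//.
  - by apply: eq_Rintegral => p _; rewrite dotrZl exprMn.
  - exact: measurable_sphere.
  - exact: sphere_integrable (@sq_cont w) (@sq_bound w).
have sum1 : \sum_(j < m) sq (delta_mx 0 j) = 1.
  transitivity (Rintegral mu S (fun p => \sum_(j < m) dotr (delta_mx 0 j) p ^+ 2)).
    elim: (index_enum _) => [|j r IH].
      by under eq_Rintegral do rewrite big_nil; rewrite big_nil Rintegral_cst ?mul0r//; exact: measurable_sphere.
    rewrite big_cons IH; under [RHS]eq_Rintegral do rewrite big_cons.
    rewrite RintegralD//; [exact: measurable_sphere|exact: sphere_integrable (@sq_cont _) (@sq_bound _)|].
    apply: (@sphere_integrable _ (\sum_(i <- r) enorm (delta_mx 0 i : 'rV[R]_m) ^+ 2)).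
      elim: r {IH} => [|i r IH].
        by under eq_fun do rewrite big_nil; exact: cst_continuous.
      under eq_fun do rewrite big_cons.
      move=> p; exact: (@continuousD _ _ _ _ _ p (@sq_cont _ p) (IH p)).
    move=> p p1; rewrite (le_trans (ler_norm_sum _ _ _))// ler_sum// => i _; exact: sq_bound.
  rewrite (@eq_Rintegral _ _ _ _ _ (fun=> 1)).
    rewrite (Rintegral_cst _ measurable_sphere) mul1r.
    by rewrite (_ : (fine _) = fine 1)//; congr fine; exact: mu_sphere.
  move=> p; rewrite inE /S/= => p1.
  rewrite -[RHS](expr1n _ 2) -p1 enorm_sqr; apply: eq_bigr => j _.
  by rewrite dotrC dotr_deltar expr2.
(* For m = 0 the sphere is empty and cannot carry a probability: the empty sum in [sum1] would be
   1. *)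
case: (posnP m) => [m0|].
  move: sum1; rewrite big1 => [/eqP|[j jm] _]; first by rewrite eq_sym oner_eq0.
  by have : (j < 0)%N by rewrite -m0.
move=> m0; pose j0 := Ordinal m0.
have all_eq j : sq (delta_mx 0 j) = sq (delta_mx 0 j0) by apply: sq_eq; rewrite !enorm_delta.
have : m%:R * sq (delta_mx 0 j0) = 1.
  rewrite -[RHS]sum1 (eq_bigr (fun=> sq (delta_mx 0 j0))); last by move=> j _; exact: all_eq.
  by rewrite sumr_const card_ord mulr_natl.
have -> : Rintegral mu S (fun p : 'rV[R]_m => dotr u p ^+ 2) = sq (enorm u *: delta_mx 0 j0).
  by apply: sq_eq; rewrite enormZ enorm_delta mulr1 ger0_norm// enorm_ge0.
by rewrite sqZ mulrCA => ->; rewrite mulr1.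
Qed.

(* With p' the reflection of p that sends u to - u, the integral of <u, p> h(p) is half that of
   <u, p> (h(p) - h(p')), and sublinearity of the support function h bounds the latter integrand
   by 2 <u, p>^2 h(u) / <u, u>. *)
Lemma steiner_le_suppf (K : set 'rV[R]_m) (M : R) (u : 'rV[R]_m) : K !=set0 ->
  (forall y, K y -> enorm y <= M) -> dotr u (steiner mu K) <= suppf K u.
Proof.
move=> K0 KM; have [->|u0] := eqVneq u 0.
  rewrite dot0r; have [y Ky] := K0.
  by rewrite (le_trans _ (le_suppf K0 KM 0 Ky))// dot0r.
have M0 : 0 <= M by have [y /KM] := K0; apply: le_trans; exact: enorm_ge0.
have mS := measurable_sphere.
pose h := suppf K.
have ch : continuous h by exact: suppf_continuous K0 KM.
have hb (p : 'rV[R]_m) : enorm p = 1 -> `|h p| <= M.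
  move=> p1; rewrite ler_norml; apply/andP; split; last first.
    by rewrite (le_trans (suppf_bound K0 KM p))// p1 mulr1.
  have [y Ky] := K0; have := le_suppf K0 KM p Ky.
  have := dotr_le (- p) y; rewrite enormN p1 mul1r dotrNl.
  have := KM _ Ky; rewrite -/h; lra.
have cuh (w : 'rV[R]_m) : continuous (fun p : 'rV[R]_m => dotr w p * h p).
  by move=> p; exact: (@continuousM _ _ _ _ p (@dotrr_continuous w p) (ch p)).
have buh (w p : 'rV[R]_m) : enorm p = 1 -> `|dotr w p * h p| <= enorm w * M.
  by move=> p1; rewrite normrM ler_pM ?normr_ge0//; [exact: dotr_sphere|exact: hb].
have iuh w : mu.-integrable S (EFin \o (fun p : 'rV[R]_m => dotr w p * h p)).
  exact: sphere_integrable (@cuh w) (@buh w).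
have -> : dotr u (steiner mu K) = m%:R * Rintegral mu S (fun p : 'rV[R]_m => dotr u p * h p).
  transitivity (m%:R * \sum_(j < m) u 0 j * Rintegral mu S (fun p : 'rV[R]_m => dotr (delta_mx 0 j) p * h p)).
    rewrite mulr_sumr; apply: eq_bigr => j _; rewrite mxE mulrCA; congr (_ * (_ * _)).
    apply: eq_Rintegral => p _; by rewrite dotrC dotr_deltar.
  congr (_ * _).
  transitivity (Rintegral mu S (fun p : 'rV[R]_m => dotr (\sum_(j < m) u 0 j *: delta_mx 0 j) p * h p)); last first.
    by rewrite -row_sum_delta.
  elim: (index_enum _) => [|j r IH].
    rewrite big_nil; under eq_Rintegral do rewrite big_nil dot0r mul0r.
    by rewrite (Rintegral_cst _ mS) mul0r.
  rewrite big_cons IH -RintegralZl// -RintegralD//.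
  - apply: eq_Rintegral => p _; rewrite big_cons dotrDl dotrZl; ring.
  - have -> : (EFin \o (fun x : 'rV[R]_m => u 0 j * (dotr (delta_mx 0 j) x * h x))) =
      (EFin \o (fun x : 'rV[R]_m => dotr (u 0 j *: delta_mx 0 j) x * h x)).
      by apply/funext => x /=; rewrite dotrZl mulrA.
    exact: iuh.
have uu : 0 < dotr u u.
  rewrite lt_neqAle dotrr_ge0 andbT eq_sym.
  by apply: contra u0 => /eqP e; apply/eqP/enorm_eq0; rewrite /enorm e sqrtr0.
have uR (p : 'rV[R]_m) : dotr u (p *m reflx u) = - dotr u p.
  rewrite mul_reflx (dotrBr u p) dotrZr divfK ?gt_eqF// (dotrC p u); ring.
pose hR (p : 'rV[R]_m) := dotr u p * h (p *m reflx u).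
have ihR : mu.-integrable S (EFin \o hR).
  apply: (@sphere_integrable _ (enorm u * M)).
    move=> p; apply: (@continuousM _ _ _ _ p (@dotrr_continuous u p)).
    exact: (@continuous_comp _ _ _ (fun p : 'rV[R]_m => p *m reflx u) h p (@reflx_continuous u p) (ch _)).
  move=> p p1; rewrite normrM ler_pM ?normr_ge0//; first exact: dotr_sphere.
  by apply: hb; rewrite enorm_orth//; exact: reflx_orth.
have e1 : Rintegral mu S (fun p : 'rV[R]_m => dotr u p * h p) = - Rintegral mu S hR.
  rewrite (sphere_invariant (reflx_orth u0) (@reflx_continuous _) (@cuh u) (@buh u)).
  rewrite -mulN1r -RintegralZl//.
  by apply: eq_Rintegral => p _; rewrite uR mulN1r mulNr.
have key : 2 * Rintegral mu S (fun p : 'rV[R]_m => dotr u p * h p) <=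
    2 * h u / dotr u u * Rintegral mu S (fun p : 'rV[R]_m => dotr u p ^+ 2).
  have isq := sphere_integrable (@sq_cont u) (@sq_bound u).
  rewrite mulr_natl mulr2n {2}e1 -RintegralB// -RintegralZl//.
  apply: le_Rintegral => //.
  - exact: rintegrableB mS (iuh u) ihR.
  - exact: (rintegrableZ (2 * h u / dotr u u) mS isq).
  move=> p _; rewrite /hR -mulrBr.
  have step (q : 'rV[R]_m) c : 0 <= c -> h (q + c *: u) <= h q + c * h u.
    move=> c0; rewrite (le_trans (suppfD K0 KM _ _))// lerD2l.
    exact: (suppfZ K0 KM u c0).
  (* Sublinearity applies to nonnegative multiples only: for <u, p> >= 0 the point p is its
     reflection plus such a multiple of u, otherwise the reflection is p plus one. *)
  have [p0|p0] := leP 0 (dotr u p).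
    have c0 : 0 <= 2 * dotr u p / dotr u u by rewrite divr_ge0 ?mulr_ge0// ltW.
    have := step (p *m reflx u) _ c0.
    rewrite {1}mul_reflx (dotrC p u) subrK => h1.
    rewrite -lerBlDl in h1; have := ler_wpM2l p0 h1.
    rewrite (_ : 2 * h u / dotr u u * dotr u p ^+ 2 = dotr u p * (2 * dotr u p / dotr u u * h u))//; ring.
  have c0 : 0 <= - (2 * dotr u p / dotr u u).
    by rewrite oppr_ge0 pmulr_lle0 ?invr_gt0// pmulr_rle0// ltW.
  have := step p _ c0.
  rewrite scaleNr -{1}(dotrC p u) -mul_reflx => h1.
  rewrite -lerBlDl in h1.
  have := ler_wnM2l (ltW p0) h1.
  rewrite (_ : 2 * h u / dotr u u * dotr u p ^+ 2 = - (dotr u p * (- (2 * dotr u p / dotr u u) * h u))); last ring.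
  by rewrite -(opprB (h p)) mulrN lerNr => /le_trans; apply.
have := sphere_second_moment u; rewrite enorm_sqr -/h => e.
have : m%:R * Rintegral mu S (fun p : 'rV[R]_m => dotr u p * h p) <=
    h u / dotr u u * (m%:R * Rintegral mu S (fun p : 'rV[R]_m => dotr u p ^+ 2)).
  by have := ler_wpM2l (ler0n R m) key; lra.
by rewrite e divfK// gt_eqF.
Qed.

(** The support function of a point is linear, so [steiner_le_suppf] in all directions forces
    equality. *)
Lemma steiner_set1 (a : 'rV[R]_m) : steiner mu [set a] = a.
Proof.
apply: dotr_inj => p; have a0 : [set a] !=set0 by exists a.
rewrite (le_trans (@steiner_le_suppf _ (enorm a) p a0 _))//; first by move=> y ->.
suff -> : suppf [set a] p = dotr p a by [].
by rewrite /suppf image_set1 sup1.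
Qed.

End SphereIntegral.

Section SteinerRepresentation.
Context {R : realType} {n : nat}.
Variable mu : probability (@BorelRV R (n + 1)) R.
Hypothesis muS : sphere_measure mu.
Implicit Types (H : R -> 'rV[R]_n -> 'rV[R]_n -> R).

Lemma edist_ge0 m (a : 'rV[R]_m) E : 0 <= Defs.edist a E.
Proof.
have [->|/set0P E0] := eqVneq E set0; first by rewrite /Defs.edist image_set0 inf0.
apply: lb_le_inf; first by have [e Ee] := E0; exists (enorm (a - e)), e.
by move=> _ [e _ <-]; exact: enorm_ge0.
Qed.

Lemma steinerFL_id H t x a : epiE H t x a -> steinerFL mu H t x a = a.
Proof.
move=> Ea; rewrite -[RHS](steiner_set1 muS); congr (steiner mu _).
have d0 : Defs.edist a (epiE H t x) = 0.
  apply/eqP; rewrite eq_le edist_ge0 andbT; apply: ge_inf.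
    by exists 0 => _ [e _ <-]; exact: enorm_ge0.
  by exists a => //; rewrite subrr enorm0.
apply/seteqP; split=> [y [_ /=]|_ ->/=].
  rewrite d0 mulr0 => h; apply/subr0_eq/enorm_eq0/eqP.
  by rewrite eq_le h enorm_ge0.
by split => //=; rewrite d0 mulr0 subrr enorm0.
Qed.

(** The epigraph is the intersection of the half-spaces with normals [hyp p], and the support
    function of [PhiS] at [hyp p] is at most H t x p. What needs care is that [PhiS] is nonempty. *)
Lemma steinerFL_epiE H t x a : epiE H t x !=set0 -> epiE H t x (steinerFL mu H t x a).
Proof.
move=> E0; set d := Defs.edist a (epiE H t x).
have K0 : PhiS H t x a !=set0.
  have hi : has_inf [set enorm (a - e) | e in epiE H t x].
    split; first by have [e Ee] := E0; exists (enorm (a - e)), e.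
    by exists 0 => _ [e _ <-]; exact: enorm_ge0.
  (* At positive distance the factor 2 in [PhiS] leaves room for an almost nearest point. At
     distance 0 the ball is {a}, and a itself belongs to the epigraph because each constraint is
     closed. *)
  have := edist_ge0 a (epiE H t x); rewrite le_eqVlt => /orP[/eqP d0|d0].
    exists a; split; last by rewrite /= subrr enorm0 mulr_ge0// edist_ge0.
    apply/epiEP => p; rewrite lerBlDr -lerBlDl -dotr_hyp.
    apply/ler_addgt0Pr => eps eps0.
    have c0 : 0 < enorm (hyp p) + 1 by rewrite ltr_wpDl// enorm_ge0.
    have [_ [e /epiEP/(_ p) Ee <-] he] := inf_adherent (divr_gt0 eps0 c0) hi.
    rewrite [inf _](esym d0) add0r ltr_pdivlMr// in he.
    have := dotr_le (a - e) (hyp p); rewrite dotrBl [dotr e _]dotr_hyp.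
    have := enorm_ge0 (a - e); nra.
  have [_ [e Ee <-] he] := inf_adherent d0 hi.
  exists e; split => //=; rewrite enormBC (le_trans (ltW he))//.
  by rewrite mulr_natl mulr2n.
have KM y : PhiS H t x a y -> enorm y <= enorm a + 2 * d.
  by move=> [_ /= h]; rewrite (le_trans (enorm_le_dist y a))// lerD2l.
apply/epiEP => p; rewrite -subr_ge0.
have := steiner_le_suppf muS (hyp p) K0 KM.
rewrite dotrC dotr_hyp => /le_trans h.
have := h (H t x p); rewrite -/(steinerFL mu H t x a) => {}h.
suff : suppf (PhiS H t x a) (hyp p) <= H t x p by move=> /h; lra.
apply: (suppf_le K0 KM) => y [/epiEP/(_ p) Ey _].
by rewrite dotrC dotr_hyp; lra.
Qed.

End SteinerRepresentation.

(** * Projection onto countably many half-spaces *)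

Section ParallelProjection.
Context {R : realType} {m : nat}.
Variables (u : nat -> 'rV[R]_m) (b : nat -> R).
Hypothesis u0 : forall j, u j != 0.
Implicit Types (a e : 'rV[R]_m).

Definition halfspaces : set 'rV[R]_m := [set a | forall j, dotr a (u j) <= b j].

Definition excess j a := Num.max 0 (dotr a (u j) - b j).

(** Simultaneous relaxed projection: the displacements onto the first k half-spaces are added with
    weights 2^-(j+1), whose sum stays below 1. Each step is a finite sum, yet every half-space keeps
    a fixed weight from some step on. *)
Definition pstep k a :=
  a - \sum_(j < k) (2 ^- j.+1 * (excess j a / dotr (u j) (u j))) *: u j.

Fixpoint piter a k := if k is k'.+1 then pstep k' (piter a k') else a.

(* Every pstep decreases the distance to each point of the intersection, so the iterates converge;
   unlike the nearest point, the limit depends measurably on a and b by construction. *)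
Definition plim a : 'rV[R]_m := \row_i lim (piter a k 0 i @[k --> \oo]).

(** Cauchy-Schwarz for the weights c; for total weight at most 1 it is the convexity of the squared
    norm. *)
Lemma enorm_sum_weighted k (c : 'I_k -> R) (v : 'I_k -> 'rV[R]_m) : (forall j, 0 <= c j) ->
  enorm (\sum_j c j *: v j) ^+ 2 <= (\sum_j c j) * (\sum_j c j * enorm (v j) ^+ 2).
Proof.
elim: k c v => [|k IH] c v c0; first by rewrite !big_ord0 enorm0 mul0r expr0n.
rewrite !big_ord_recr/=; set A := \sum_(i < k) _ *: _; set C := \sum_(i < k) c _.
set S := \sum_(i < k) _ * _.
have h : enorm A ^+ 2 <= C * S by exact: IH.
have C0 : 0 <= C by exact: sumr_ge0.
have S0 : 0 <= S by apply: sumr_ge0 => i _; rewrite mulr_ge0// sqr_ge0.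
set c' := c ord_max; set v' := v ord_max; have c'0 : 0 <= c' by exact: c0.
rewrite enorm_sqr dotrDl !dotrDr -!enorm_sqr dotrZl !dotrZr (dotrC v') enormZ exprMn.
rewrite (ger0_norm c'0).
have h1 : 2 * dotr A v' <= C * enorm v' ^+ 2 + S.
  have := dotr_le A v'; have v0 := enorm_ge0 v'; have A0 := enorm_ge0 A.
  move=> /(ler_wpM2l (ler0n _ 2)) /le_trans; apply.
  rewrite -(@ler_pXn2r _ 2%N)// ?nnegrE ?addr_ge0// ?mulr_ge0// ?sqr_ge0//.
  have := ler_wpM2r (sqr_ge0 (enorm v')) h.
  have := sqr_ge0 (C * enorm v' ^+ 2 - S); nra.
have := ler_wpM2l c'0 h1; nra.
Qed.

Lemma sum_halves k : \sum_(j < k) 2 ^- j.+1 = 1 - 2 ^- k :> R.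
Proof.
elim: k => [|k IH]; first by rewrite big_ord0 expr0 invr1 subrr.
rewrite big_ord_recr/= IH exprS invfM; lra.
Qed.

Let uu j : 0 < dotr (u j) (u j).
Proof.
rewrite lt_neqAle dotrr_ge0 andbT eq_sym.
by apply: contra (u0 j) => /eqP e; apply/eqP/enorm_eq0; rewrite /enorm e sqrtr0.
Qed.

Lemma excess_ge0 j a : 0 <= excess j a.
Proof. by rewrite le_max lexx. Qed.

(** Fejer monotonicity with a gain; the gain is what later forces the excesses to 0. *)
Lemma pstep_fejer k a e : halfspaces e ->
  enorm (pstep k a - e) ^+ 2 +
    \sum_(j < k) 2 ^- j.+1 * (excess j a ^+ 2 / dotr (u j) (u j)) <= enorm (a - e) ^+ 2.
Proof.
move=> he; set S := \sum_(j < k) _.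
pose rho j := excess j a / dotr (u j) (u j).
pose d := \sum_(j < k) 2 ^- j.+1 *: (rho j *: u j).
have -> : pstep k a - e = (a - e) - d.
  rewrite /pstep addrAC; congr (_ - _); apply: eq_bigr => j _; by rewrite scalerA.
have Sd : S = \sum_(j < k) 2 ^- j.+1 * enorm (rho j *: u j) ^+ 2.
  apply: eq_bigr => j _; congr (_ * _).
  rewrite enormZ exprMn enorm_sqr real_normK ?num_real// /rho.
  by field; rewrite gt_eqF.
have c0 j : 0 <= 2 ^- j.+1 :> R by rewrite invr_ge0 exprn_ge0.
have dS : enorm d ^+ 2 <= S.
  rewrite (le_trans (enorm_sum_weighted _ _))// Sd ler_piMl//.
    by apply: sumr_ge0 => j _; rewrite mulr_ge0// sqr_ge0.
  by rewrite sum_halves gerBl.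
(* As e satisfies the constraints, <a - e, u j> is at least the excess whenever that is positive.
   Together with |d|^2 <= S this gives |a - e - d|^2 <= |a - e|^2 - 2 S + S. *)
have Sle : S <= dotr (a - e) d.
  rewrite dotr_sumr; apply: ler_sum => j _; rewrite dotrZr ler_wpM2l//.
  rewrite dotrZr dotrBl /rho [leRHS]mulrAC ler_wpM2r ?invr_ge0 ?(ltW (uu j))//.
  have ej := he j; rewrite /excess; have [h|h] := leP 0 (dotr a (u j) - b j).
    by rewrite expr2 ler_wpM2l//; lra.
  by rewrite expr0n mul0r.
rewrite enorm_sqr (dotrBl (a - e)) !(dotrBr _ (a - e)) -!enorm_sqr (dotrC d); lra.
Qed.

Let distn_ni a e : halfspaces e -> forall k, enorm (piter a k.+1 - e) <= enorm (piter a k - e).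
Proof.
move=> he k; rewrite -(@ler_pXn2r _ 2%N)// ?nnegrE ?enorm_ge0//=.
have := pstep_fejer k (piter a k) he; apply: le_trans; rewrite lerDl.
apply: sumr_ge0 => j _; rewrite mulr_ge0// ?invr_ge0 ?exprn_ge0//.
by rewrite divr_ge0 ?sqr_ge0// ltW.
Qed.

Let dist_ni a e : halfspaces e -> forall k l, (k <= l)%N ->
  enorm (piter a l - e) <= enorm (piter a k - e).
Proof.
move=> he k l /subnK <-; elim: (l - k)%N => [|i IH]; first by rewrite add0n.
by rewrite addSn (le_trans (distn_ni a he _)).
Qed.

Let excess_cvg0 a e j : halfspaces e -> excess j (piter a k) @[k --> \oo] --> 0.
Proof.
move=> he; pose s k := enorm (piter a k - e) ^+ 2.
have cs : cvgn s.
  apply: nonincreasing_is_cvgn.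
    by move=> k l kl; rewrite ler_pXn2r// ?nnegrE ?enorm_ge0//; exact: dist_ni.
  by exists 0 => _ [k _ <-]; exact: sqr_ge0.
have d0 : (s k - s k.+1) @[k --> \oo] --> 0.
  rewrite -(subrr (limn s)); apply: cvgB; first exact: cs.
  by rewrite -(cvg_shiftS s) in cs *; exact: cs.
pose C : R := 2 ^- j.+1 / dotr (u j) (u j).
have C0 : 0 < C by rewrite divr_gt0// invr_gt0 exprn_gt0.
apply/cvgrPdist_le => eps eps0.
have e1 : 0 < C * eps ^+ 2 by rewrite mulr_gt0// exprn_gt0.
have /cvgrPdist_le/(_ _ e1) := d0; apply: filter_app.
(* Half-space j takes part in step k only when j < k. *)
exists j.+1 => //= k jk; rewrite !sub0r !normrN (ger0_norm (excess_ge0 _ _)).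
rewrite ger0_norm; last first.
  by rewrite subr_ge0 ler_pXn2r// ?nnegrE ?enorm_ge0//; exact: distn_ni.
move=> h; rewrite -(@ler_pXn2r _ 2%N)// ?nnegrE ?excess_ge0 ?(ltW eps0)// -(ler_pM2l C0).
apply: le_trans h; rewrite lerBrDl; apply: le_trans (pstep_fejer k (piter a k) he).
rewrite lerD2l (bigD1 (Ordinal jk))//= -[leLHS]addr0 lerD//.
  by rewrite /C -mulrA (mulrC (_ ^-1) (_ ^+ 2)).
apply: sumr_ge0 => i _; rewrite mulr_ge0// ?invr_ge0 ?exprn_ge0//.
by rewrite divr_ge0 ?sqr_ge0// ltW.
Qed.

(** A cluster point of the iterates satisfies every constraint because the excesses vanish; the
    distances to it then decrease, so the whole sequence converges. The factor 2 comes from |plim a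
    - e| <= |a - e| and the triangle inequality. *)
Lemma plimP a : halfspaces !=set0 ->
  [/\ halfspaces (plim a), piter a k @[k --> \oo] --> plim a &
      forall e, halfspaces e -> enorm (plim a - a) <= 2 * enorm (e - a)].
Proof.
move=> [e he].
have [l [hl cl]] : exists l, halfspaces l /\ piter a k @[k --> \oo] --> l.
  have [k|l near_l] := @bounded_cluster_seq _ _ (piter a) (enorm e + enorm (a - e)).
    rewrite (le_trans (enorm_le_dist _ e))// lerD2l; exact: (dist_ni a he (leq0n k)).
  have hl : halfspaces l.
    move=> j; rewrite -subr_le0; apply/ler_addgt0Pr => eps eps0; rewrite add0r.
    pose C := enorm (u j) + 1.
    have C0 : 0 < C by rewrite ltr_wpDl// enorm_ge0.
    have e2 : 0 < eps / 2 by rewrite divr_gt0.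
    have /cvgrPdist_le/(_ _ e2)[K _ hK] := @excess_cvg0 a e j he.
    have [k Kk hk] := near_l (eps / 2 / C) K (divr_gt0 e2 C0).
    have := hK k Kk; rewrite /= sub0r normrN (ger0_norm (excess_ge0 _ _)) => h1.
    have h2 : dotr (piter a k) (u j) - b j <= eps / 2.
      by apply: le_trans h1; rewrite le_max lexx orbT.
    have := dotr_le (l - piter a k) (u j); rewrite dotrBl enormBC.
    have h3 : enorm (piter a k - l) * enorm (u j) <= eps / 2.
      rewrite (le_trans (_ : _ <= enorm (piter a k - l) * C))//.
        by rewrite ler_wpM2l ?enorm_ge0// lerDl.
      by rewrite -ler_pdivlMr.
    lra.
  exists l; split => //; apply/cvg_enormP => eps eps0.
  have [k _ hk] := near_l _ 0%N eps0.
  by exists k => // k' kk' /=; rewrite (le_trans (dist_ni _ hl kk')).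
have lE : plim a = l.
  apply/rowP => i; rewrite mxE; apply/cvg_lim => //.
  by have /cvg_rowP := cl; exact.
rewrite lE; split => // e' he'.
have h1 : enorm (l - e') <= enorm (a - e').
  apply/ler_addgt0Pr => eps eps0; have /cvg_enormP/(_ _ eps0) [k _ /(_ k (leqnn k))/= h] := cl.
  rewrite (le_trans (enorm_triangle _ (piter a k) _))// addrC lerD//; last by rewrite enormBC.
  exact: (dist_ni a he' (leq0n k)).
rewrite (le_trans (enorm_triangle _ e' _))// mulr_natl mulr2n lerD//.
by rewrite (enormBC e').
Qed.

End ParallelProjection.

(** * Integration on the line *)

Notation LebT R := (caratheodory_type (@wlength R idfun)^*%mu).
Notation leb := (@lebesgue_measure _).

(* Real valued: the value is junk when the integral is infinite. *)
Definition LI {R : realType} (D : set R) (f : R -> R) : R :=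
  Rintegral (@completed_lebesgue_measure R) (D : set (LebT R)) f.

Section CompletedLebesgue.
Context {R : realType}.
Implicit Types (f g : R -> R).
Local Notation mu := (@completed_lebesgue_measure R).
Local Notation LT := (LebT R).

Lemma borel_Lmeasurable (A : set R) : measurable (A : set (measurableTypeR R)) ->
  measurable (A : set LT).
Proof. by move=> mA; exact: sub_caratheodory. Qed.

Lemma itv_Lmeasurable (i : interval R) : measurable ([set` i] : set LT).
Proof. by apply: borel_Lmeasurable; exact: measurable_itv. Qed.

Lemma lebcE (A : set R) : mu A = lebesgue_measure (A : set (measurableTypeR R)).
Proof. by []. Qed.

Lemma Lmeasurable_id : measurable_fun [set: LT] (id : LT -> measurableTypeR R).
Proof. by move=> _ A mA; rewrite setTI; exact: borel_Lmeasurable. Qed.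

(** The identity is measurable from the completed to the Borel structure and pushes the completed
    measure to the Borel one, so this is a change of variables. *)
Lemma Lintegral_borel (D : set R) f : measurable (D : set (measurableTypeR R)) ->
  measurable_fun [set: measurableTypeR R] f ->
  mu.-integrable (D : set LT) (EFin \o f) ->
  (\int[mu]_(x in (D : set LT)) (f x)%:E = \int[leb]_(x in D) (f x)%:E)%E.
Proof.
move=> mD mf intf.
by rewrite -(@integral_pushforward _ _ _ _ _ _ Lmeasurable_id mu D (EFin \o f))//;
  exact/measurable_EFinP.
Qed.

Lemma Lintegrable_borel (D : set R) f : measurable (D : set (measurableTypeR R)) ->
  measurable_fun [set: measurableTypeR R] f ->
  mu.-integrable (D : set LT) (EFin \o f) -> leb.-integrable D (EFin \o f).
Proof.
move=> mD mf /integrableP[_ fi]; apply/integrableP; split.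
  by apply/measurable_EFinP; exact: measurable_funTS.
rewrite -(@ge0_integral_pushforward _ _ _ _ _ _ Lmeasurable_id mu D (abse \o (EFin \o f))) in fi => //.
by apply: measurableT_comp => //; apply/measurable_EFinP; exact: measurable_funTS.
by move=> y _; exact: abse_ge0.
Qed.

Lemma Lmeasurable_borelU (A : set R) : measurable (A : set LT) ->
  exists B N : set R, [/\ measurable (B : set (measurableTypeR R)),
    measurable (N : set (measurableTypeR R)), leb N = 0%E & B `<=` A /\ A `<=` B `|` N].
Proof.
rewrite /= -completed_caratheodory_measurable g_sigma_completed_algebra_genE.
move=> [B mB [N0 [N [mN N00 N0N]]] <-]; exists B, N; split => //; split.
  by move=> x; left.
by move=> x [|/N0N]; [left|right].
Qed.

Lemma negligible_borel (A : set R) : mu.-negligible (A : set LT) ->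
  exists2 N : set R, measurable (N : set (measurableTypeR R)) & leb N = 0%E /\ A `<=` N.
Proof.
move=> [B [mB B0 AB]]; have [C [N [mC mN N0 [CB BCN]]]] := Lmeasurable_borelU mB.
exists (C `|` N); first exact: measurableU.
split; last exact: subset_trans AB BCN.
apply: null_set_setU => //; apply/eqP; rewrite eq_le measure_ge0 andbT.
by rewrite -B0; apply: le_outer_measure.
Qed.

Definition rseq (k : nat) : R := ratr (odflt 0 (unpickle k : option rat)).

Lemma rseq_dense (a b : R) : a < b -> exists k, a < rseq k < b.
Proof.
move=> /rat_in_itvoo[q]; rewrite in_itv/= => h; exists (pickle q).
by rewrite /rseq pickleK.
Qed.

(** Each set {f > q}, q rational, contains a Borel set B that exhausts it up to a null set; f' is
    the supremum of the q whose set B contains the point. Off countably many null sets, belonging to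
    B is the same as q < f, and the supremum is f. [fine] handles the points where it is
    infinite. *)
Lemma borel_version f : measurable_fun [set: LT] f ->
  exists2 f' : R -> R, measurable_fun [set: measurableTypeR R] f' &
    {ae mu, forall t : LT, f t = f' t}.
Proof.
move=> mf.
have mA k : measurable (f @^-1` `]rseq k, +oo[ : set LT).
  by rewrite -[X in measurable X]setTI; apply: mf => //; exact: measurable_itv.
pose B k := sval (cid (Lmeasurable_borelU (mA k))).
pose N k := sval (cid (svalP (cid (Lmeasurable_borelU (mA k))))).
have BN k := svalP (cid (svalP (cid (Lmeasurable_borelU (mA k))))).
pose h k x : \bar R := if x \in B k then (rseq k)%:E else -oo%E.
pose F x := esups (h^~ x) 0%N.
have mh k : measurable_fun [set: measurableTypeR R] (h k).
  apply: measurable_fun_if => //; apply: (measurable_fun_bool true).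
  rewrite setTI (_ : _ @^-1` _ = B k); first by have [] := BN k.
  by apply/seteqP; split => x /=; [move/set_mem|move/mem_set].
have mF : measurable_fun [set: measurableTypeR R] F by exact: measurable_fun_esups.
exists (fine \o F); first exact: measurableT_comp.
exists (\bigcup_k N k); split.
- by apply: borel_Lmeasurable; apply: bigcupT_measurable => k; have [] := BN k.
- apply/eqP; rewrite eq_le measure_ge0 andbT lebcE.
  have mN k : measurable (N k : set (measurableTypeR R)) by have [] := BN k.
  rewrite (le_trans (measure_sigma_subadditive leb mN _ _))//; first exact: bigcupT_measurable.
  by rewrite eseries0// => k _ _; have [] := BN k.
- move=> t /= nft; apply: contrapT => H; apply: nft.
  have key k : (t \in B k) = (rseq k < f t).
    have [_ _ _ [BA ABN]] := BN k; apply/idP/idP => [/set_mem/BA|h1].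
      by rewrite /= in_itv/= andbT.
    apply/mem_set; have : (B k `|` N k) t by apply: ABN; rewrite /= in_itv/= h1.
    by move=> [//|Nt]; exfalso; apply: H; exists k.
  suff -> : F t = (f t)%:E by [].
  rewrite /F /esups /=; apply/eqP; rewrite eq_le; apply/andP; split.
    apply/ereal_supP => _ [k _ <-]; rewrite /h key.
    by case: ifPn => [/ltW|_]; rewrite ?lee_fin ?leNye.
  apply/lee_subgt0Pr => e e0.
  have [k /andP[k1 k2]] := @rseq_dense (f t - e) (f t) ltac:(lra).
  apply: le_trans (ereal_sup_ubound (_ : _ (h k t))); last by exists k.
  by rewrite /h key k2 lee_fin ltW.
Qed.

Lemma LintegrableS (a b a' b' : R) f : a <= a' -> b' <= b -> Lintegrable `[a, b] f ->
  Lintegrable `[a', b'] f.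
Proof.
move=> aa bb; apply: integrableS; [exact: itv_Lmeasurable|exact: itv_Lmeasurable|].
by move=> x /=; rewrite !in_itv/= => /andP[h1 h2]; rewrite (le_trans aa)// (le_trans h2).
Qed.

Lemma LI_set1 (a : R) f : LI [set a] f = 0.
Proof.
rewrite /LI /Rintegral; have -> : (\int[mu]_(x in ([set a] : set LT)) (f x)%:E = 0)%E.
  transitivity (\int[mu]_(x in ([set a] : set LT)) (cst (f a)%:E x))%E.
    by apply: eq_integral => x /set_mem/= ->.
  rewrite integral_cst; last by apply: borel_Lmeasurable; exact: measurable_set1.
  by rewrite (_ : _ [set a] = 0%E) ?mule0//; exact: lebesgue_measure_set1.
by [].
Qed.

Lemma LI_setU (A B : set R) f : measurable (A : set LT) -> measurable (B : set LT) ->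
  Lintegrable (A `|` B) f -> A `&` B = set0 -> LI (A `|` B) f = LI A f + LI B f.
Proof. by move=> mA mB fi AB; apply: Rintegral_setU => //; exact/disj_set2P. Qed.

Lemma LI_itv_obnd (b c : R) f : b <= c -> Lintegrable `[b, c] f -> LI `[b, c] f = LI `]b, c] f.
Proof.
move=> bc fi.
have e : `[b, c]%classic = [set b] `|` `]b, c]%classic :> set R by rewrite setU1itv.
rewrite e LI_setU ?LI_set1 ?add0r//.
- by rewrite -set_itv1; exact: itv_Lmeasurable.
- exact: itv_Lmeasurable.
- by rewrite -e.
- by apply/seteqP; split => // x [/= ->]; rewrite in_itv/= ltxx.
Qed.

Lemma LI_cat (a b c : R) f : a <= b <= c -> Lintegrable `[a, c] f ->
  LI `[a, c] f = LI `[a, b] f + LI `[b, c] f.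
Proof.
move=> /andP[ab bc] fi; rewrite (@LI_itv_obnd b c)//; last exact: LintegrableS fi.
have e : `[a, c]%classic = `[a, b]%classic `|` `]b, c]%classic :> set R.
  apply/seteqP; split => x /=; rewrite !in_itv/=.
    by move=> /andP[h1 h2]; have [xb|bx] := leP x b; [left; rewrite h1|right; rewrite h2].
  by move=> [] /andP[h1 h2]; [rewrite h1 (le_trans h2)|rewrite h2 andbT (le_trans ab)// ltW].
rewrite e LI_setU//.
- exact: itv_Lmeasurable.
- exact: itv_Lmeasurable.
- by rewrite -e.
- apply/seteqP; split => // x [/=]; rewrite !in_itv/= => /andP[_ h1] /andP[h2 _].
  by move: (lt_le_trans h2 h1); rewrite ltxx.
Qed.

Lemma LaeS (P Q : R -> Prop) : {ae mu, forall t : LT, P t} -> (forall t, P t -> Q t) ->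
  {ae mu, forall t : LT, Q t}.
Proof. by move=> hP PQ; apply: (@filterS _ _ (@ae_filter_ringOfSetsType _ LT R mu) _ _ _ hP) => t; exact: PQ. Qed.

Lemma LaeS2 (P Q S : R -> Prop) : {ae mu, forall t : LT, P t} -> {ae mu, forall t : LT, Q t} ->
  (forall t, P t -> Q t -> S t) -> {ae mu, forall t : LT, S t}.
Proof. by move=> hP hQ PQ; apply: (@filterS2 _ _ (@ae_filter_ringOfSetsType _ LT R mu) _ _ _ _ hP hQ) => t; exact: PQ. Qed.

Lemma Lae_measurable (D : set R) f g : {ae mu, forall t : LT, D t -> f t = g t} ->
  measurable_fun (D : set LT) f -> measurable_fun (D : set LT) g.
Proof.
move=> fg mf; apply/measurable_EFinP.
apply: (ae_measurable_fun completed_lebesgue_measure_is_complete (f := EFin \o f)); last exact/measurable_EFinP.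
by apply: (LaeS fg) => t h Dt /=; rewrite h.
Qed.

Lemma Lae_integral (D : set R) f g : measurable (D : set LT) ->
  {ae mu, forall t : LT, D t -> f t = g t} -> measurable_fun (D : set LT) f ->
  (\int[mu]_(t in (D : set LT)) (f t)%:E = \int[mu]_(t in (D : set LT)) (g t)%:E)%E.
Proof.
move=> mD fg mf; apply: ae_eq_integral.
- exact: mD.
- exact/measurable_EFinP.
- by apply/measurable_EFinP; exact: Lae_measurable mf.
- by apply: (LaeS fg) => t h Dt /=; rewrite h.
Qed.

Lemma Lae_integrable (D : set R) f g : measurable (D : set LT) ->
  {ae mu, forall t : LT, D t -> f t = g t} -> Lintegrable D f -> Lintegrable D g.
Proof.
move=> mD fg /integrableP[/measurable_EFinP mf fi]; apply/integrableP; split.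
  by apply/measurable_EFinP; exact: Lae_measurable mf.
apply: le_lt_trans fi; rewrite le_eqVlt; apply/orP; left; apply/eqP.
have e : {ae mu, forall t : LT, D t -> `|f t| = `|g t|}.
  by apply: (LaeS fg) => t h Dt /=; rewrite h.
have m : measurable_fun (D : set LT) (fun t => `|f t|) by exact: measurableT_comp.
exact/esym/(@Lae_integral D _ _ mD e m).
Qed.

Lemma Lae_LI (D : set R) f g : measurable (D : set LT) ->
  {ae mu, forall t : LT, D t -> f t = g t} -> Lintegrable D f -> LI D f = LI D g.
Proof. by move=> mD fg /integrableP[/measurable_EFinP mf _]; congr fine; exact: Lae_integral. Qed.

(** Differentiation of the integral is applied to a Borel version of f extended by 0, whose integral
    over ]-oo, y] agrees with that of f over [a, y] for y in [a, b]. *)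
Lemma LFTC1 (a b : R) f : Lintegrable `[a, b] f ->
  {ae mu, forall t : LT, a < t < b ->
    derivable (fun y => LI `[a, y] f) t 1 /\ 'D_1 (fun y => LI `[a, y] f) t = f t}.
Proof.
move=> fi; pose F : R -> R := f \_ `[a, b].
have mab := @itv_Lmeasurable `[a, b].
have Fi : mu.-integrable [set: LT] (EFin \o F).
  by rewrite /F -restrict_EFin; apply/(integrable_mkcond _ mab).
have mF : measurable_fun [set: LT] F by apply/measurable_EFinP; exact: measurable_int Fi.
have [g mg Fg] := borel_version mF.
have aeFg (D : set R) : {ae mu, forall t : LT, D t -> F t = g t}.
  by apply: (LaeS Fg) => t h _.
have gi : mu.-integrable [set: LT] (EFin \o g) by exact: (Lae_integrable measurableT (aeFg setT) Fi).
have gleb : leb.-integrable [set: R] (EFin \o g) by exact: Lintegrable_borel.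
have /FTC1Ny : forall y, leb.-integrable `]-oo, y] (EFin \o g).
  by move=> y; apply: integrableS gleb.
move=> /(_ (open_integrable_locally openT gleb)) [Z [mZ Z0 HZ]].
pose G (y : R) := Rintegral leb `]-oo, y] g.
have Z' : {ae mu, forall t : LT, derivable G t 1 /\ derive1 G t = g t}.
  by exists Z; split => //; exact: borel_Lmeasurable.
apply: (LaeS2 Z' Fg) => t [dt Dt] Fgt /andP[at_ tb].
have eqF y : a <= y <= b -> G y = LI `[a, y] f.
  move=> /andP[ay yb].
  transitivity (LI `]-oo, y] g).
    congr fine; apply/esym; apply: Lintegral_borel => //.
    apply: integrableS gi => //; exact: itv_Lmeasurable.
  transitivity (LI `]-oo, y] F).
    apply/esym; apply: Lae_LI => //; first exact: itv_Lmeasurable.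
    apply: integrableS Fi => //; exact: itv_Lmeasurable.
  congr fine; rewrite [RHS]integral_mkcond [LHS]integral_mkcond; apply: eq_integral => s _.
  rewrite !patchE /F; case: ifPn => [|h].
    move=> /set_mem/=; rewrite in_itv/= => sy; rewrite patchE; case: ifPn => [/set_mem/=|h].
      by rewrite in_itv/= => /andP[h1 _]; rewrite mem_set//= in_itv/= h1.
    case: ifPn => // /set_mem/=; rewrite in_itv/= => /andP[h1 h2].
    by move: h; rewrite mem_set//= in_itv/= h1 (le_trans h2).
  case: ifPn => // /set_mem/=; rewrite in_itv/= => /andP[h1 h2].
  by move: h; rewrite mem_set//= in_itv.
have Ft : F t = f t by rewrite /F patchE mem_set//= in_itv/= !ltW.
have nE : \forall y \near t, G y = LI `[a, y] f.
  near=> y; apply: eqF; apply/andP; split; apply: ltW; near: y.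
    exact: lt_nbhsr.
  exact: lt_nbhsl.
rewrite derive1E in Dt.
split; first exact: near_eq_derivable nE dt.
by rewrite -(near_eq_derive _ nE)// Dt -Fgt Ft.
Unshelve. all: by end_near. Qed.

End CompletedLebesgue.

Definition acont {R : realType} (a b : R) (G : R -> R) : Prop :=
  forall eps : R, 0 < eps -> exists2 delta : R, 0 < delta &
    forall (N : nat) (u v : nat -> R),
      (forall i, (i < N)%N -> a <= u i /\ u i <= v i /\ v i <= b) ->
      (forall i j, (i < N)%N -> (j < N)%N -> i <> j -> v i <= u j \/ v j <= u i) ->
      \sum_(i < N) (v i - u i) < delta ->
      \sum_(i < N) `|G (v i) - G (u i)| < eps.

(** * Absolutely continuous functions *)

Section AbsoluteContinuity.
Context {R : realType}.
Implicit Types (G h : R -> R) (a b : R).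
Local Notation mu := (@completed_lebesgue_measure R).
Local Notation LT := (LebT R).

(** Absolute continuity for lists, the form that suits families built by adding one interval at a
    time. *)
Lemma acont_seq a b G : acont a b G -> forall eps, 0 < eps -> exists2 delta, 0 < delta &
  forall l : seq (R * R), all (fun p => (a <= p.1) && (p.1 <= p.2) && (p.2 <= b)) l ->
    pairwise (fun x y => y.2 <= x.1) l -> \sum_(p <- l) (p.2 - p.1) < delta ->
    \sum_(p <- l) `|G p.2 - G p.1| < eps.
Proof.
move=> acG eps eps0; have [delta delta0 h] := acG eps eps0; exists delta => // l al pl sl.
pose d := (0, 0) : R * R.
have := h (size l) (fun i => (nth d l i).1) (fun i => (nth d l i).2).
rewrite !(big_nth d) !big_mkord in sl *; apply => //.
  by move=> i il; have /(all_nthP d)/(_ i il)/andP[/andP[-> ->] ->] := al.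
move=> i j il jl ij.
have [lt_ij|lt_ji|//] := ltngtP i j.
  by right; exact: (pairwiseP d pl).
by left; exact: (pairwiseP d pl).
Qed.

Lemma derive0_near G t e : derivable G t 1 -> 'D_1 G t = 0 -> 0 < e ->
  exists2 r, 0 < r & forall y, `|y - t| < r -> `|G y - G t| <= e * `|y - t|.
Proof.
move=> dG D0 e0.
have /cvgrPdist_le/(_ e e0) : h^-1 *: (G (h *: 1 + t) - G t) @[h --> 0^'] --> (0 : R).
  by rewrite -[X in _ --> X]D0; exact: dG.
move=> [r /= r0 hr]; exists r => // y yr.
have [->|yt] := eqVneq y t; first by rewrite !subrr normr0 mulr0.
have yt0 : y - t != 0 by rewrite subr_eq0.
have := hr (y - t); rewrite /= sub0r normrN => /(_ yr yt0).
rewrite sub0r normrN [_ *: 1]mulr1 subrK normrM normfV mulrC ler_pdivrMr//.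
by rewrite normr_gt0.
Qed.

(** Continuous induction on s instead of a covering theorem. The invariant bounds |G s - G a| by e
    (s - a) plus the variation over a list of disjoint intervals inside an open set U of measure
    less than delta: points of zero derivative advance with slope e, exceptional points advance
    inside U and add an interval to the list. At b, absolute continuity bounds the variation over
    the list by e. *)
Theorem acont_derive0 a b G : a <= b -> acont a b G ->
  {ae mu, forall t : LT, a < t < b -> derivable G t 1 /\ 'D_1 G t = 0} -> G b = G a.
Proof.
move=> ab acG Gae; apply/eqP; rewrite -subr_eq0 -normr_eq0 eq_le normr_ge0 andbT.
apply/ler_addgt0Pr => e' e'0; rewrite add0r.
pose e := e' / (b - a + 1).
have e0 : 0 < e by rewrite divr_gt0// ltr_wpDl// subr_ge0.
have [delta delta0 hdelta] := acont_seq acG e0.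
have [Z mZ [Z0 GZ]] := negligible_borel Gae.
(* The derivative is known in the open interval only, so the end points count as exceptional. *)
pose Z' := Z `|` [set a] `|` [set b].
have mZ' : measurable (Z' : set (measurableTypeR R)) by do 2 apply: measurableU => //.
have Z'0 : leb Z' = 0%E.
  rewrite /Z'; apply: null_set_setU => //; first exact: measurableU.
    by apply: null_set_setU => //; exact: lebesgue_measure_set1.
  exact: lebesgue_measure_set1.
have [U [oU ZU Ud]] : exists U : set R, [/\ open U, Z' `<=` U & (leb U < delta%:E)%E].
  have [|U [oU ZU Ud]] := @lebesgue_regularity_outer R Z' delta mZ' _ delta0.
    by apply: le_lt_trans (ltry 0); rewrite le_eqVlt; apply/orP; left; apply/eqP; exact: Z'0.
  exists U; split => //; apply: le_lt_trans Ud.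
  have mU : measurable (U : set (measurableTypeR R)) by exact: open_measurable.
  rewrite -[X in (leb X <= _)%E](setDUK ZU).
  have mUZ : measurable (U `\` Z' : set (measurableTypeR R)) by exact: measurableD.
  have := @measureU2 _ _ _ leb _ _ mZ' mUZ; move=> /le_trans; apply.
  by rewrite (_ : _ Z' = 0%E) ?add0e//; exact: Z'0.
have mU : measurable (U : set (measurableTypeR R)) by exact: open_measurable.
(* Only the part of U left of s is counted, so that an interval of U appended at s increases it by
   its own length. *)
pose lebU s := leb (U `&` `]a, s]).
pose inv l s := [/\ all (fun p => (a <= p.1) && (p.1 <= p.2) && (p.2 <= s)) l,
  pairwise (fun x y : R * R => y.2 <= x.1) l, ((\sum_(p <- l) (p.2 - p.1))%:E <= lebU s)%E &
  `|G s - G a| <= e * (s - a) + \sum_(p <- l) `|G p.2 - G p.1|].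
have mUa s : measurable (U `&` `]a, s] : set (measurableTypeR R)) by apply: measurableI.
have lebU_mono s s' : s <= s' -> (lebU s <= lebU s')%E.
  move=> ss; apply: le_measure; rewrite ?inE//; apply: setIS => x /=; rewrite !in_itv/=.
  by move=> /andP[-> /le_trans ->].
have step1 l s s' : a <= s -> s <= s' -> `]s, s'] `<=` U -> inv l s -> inv ((s, s') :: l) s'.
  move=> as_ ss sU [il pl ml Gl]; split.
  - rewrite /= as_ ss lexx/=; apply: sub_all il => p /andP[-> h]/=; exact: le_trans ss.
  - by rewrite /= pl andbT; apply: sub_all il => p /andP[_].
  - rewrite big_cons/= EFinD addeC.
    apply: (@le_trans _ _ (lebU s + leb `]s, s'])%E).
      by rewrite leeD// lebesgue_measure_itv/= lte_fin; case: ltP => // h; rewrite lee_fin subr_le0.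
    rewrite -measureU//; last first.
      apply/seteqP; split => // x [] [_ /=]; rewrite !in_itv/= => /andP[_ h1] /andP[h2 _].
      by move: (lt_le_trans h2 h1); rewrite ltxx.
    apply: le_measure; rewrite ?inE//; first exact: measurableU.
    move=> x [[Ux]|sx] /=; first by rewrite !in_itv/= => /andP[-> /le_trans ->].
    split; first exact: sU.
    by move: sx => /=; rewrite !in_itv/= => /andP[h ->]; rewrite (le_lt_trans as_).
  - rewrite big_cons/= (le_trans (ler_distD (G s) _ _))//.
    rewrite addrCA lerD2l (le_trans Gl)// lerD2r ler_wpM2l ?(ltW e0)// lerD2r//.
have step2 l s s' : s <= s' -> `|G s' - G s| <= e * (s' - s) -> inv l s -> inv l s'.
  move=> ss hG [il pl ml Gl]; split => //.
  - by apply: sub_all il => p /andP[-> h]/=; exact: le_trans ss.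
  - by apply: le_trans ml _; exact: lebU_mono.
  - by rewrite (le_trans (ler_distD (G s) _ _))//; lra.
pose S := [set s | a <= s <= b /\ exists l, inv l s].
have Sa : S a.
  split; first by rewrite lexx ab.
  by exists [::]; split => //; rewrite ?big_nil ?measure_ge0// !subrr normr0 mulr0 addr0.
have supS : has_sup S by split; [exists a|exists b => s [/andP[]]].
set m := sup S.
have am : a <= m by exact: (ub_le_sup supS.2 Sa).
have mb : m <= b by apply: ge_sup; [exists a|move=> s [/andP[]]].
(* Whether or not m lies in U, the invariant extends from any s just left of m to any s' just right
   of it; hence the supremum is attained and equals b. *)
have [r r0 hr] : exists2 r, 0 < r & forall s s', S s -> m - r < s -> s <= m -> m <= s' ->
    s' < m + r -> s' <= b -> S s'.
  have [Um|Um] := pselect (U m).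
    have [r /= r0 rU] := (oU m Um).
    exists r => // s s' [/andP[as_ sb] [l il]] h1 h2 h3 h4 h5.
    split; first by rewrite (le_trans am)// h5.
    exists ((s, s') :: l); apply: step1 il => //; first exact: le_trans h3.
    move=> x /=; rewrite in_itv/= => /andP[x1 x2]; apply: rU => /=.
    rewrite ltr_distlC; apply/andP; split; first by rewrite (lt_trans h1).
    exact: le_lt_trans h4.
  have [] : derivable G m 1 /\ 'D_1 G m = 0.
    apply: contrapT => H; apply: Um; apply: ZU.
    have [mz|nmz] := pselect (a < m < b).
      by left; left; apply: GZ => /= H2; apply: H; exact: H2.
    move/negP : nmz; rewrite negb_and -!leNgt => /orP[h|h].
      by left; right => /=; apply/eqP; rewrite eq_le h am.
    by right => /=; apply/eqP; rewrite eq_le mb h.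
  move=> dG D0; have [r r0 hG] := derive0_near dG D0 e0.
  exists r => // s s' [/andP[as_ sb] [l il]] h1 h2 h3 h4 h5.
  split; first by rewrite (le_trans am)// h5.
  exists l; apply: step2 il; first exact: le_trans h3.
  rewrite (le_trans (ler_distD (G m) _ _))//.
  have k1 : `|G s' - G m| <= e * (s' - m).
    have := hG s'; rewrite (@ger0_norm _ (s' - m)) ?subr_ge0// => H; apply: H; lra.
  have k2 : `|G m - G s| <= e * (m - s).
    rewrite distrC; have := hG s; rewrite (distrC s) (@ger0_norm _ (m - s)) ?subr_ge0// => H; apply: H; lra.
  lra.
have [s Ss sm] := sup_adherent r0 supS.
have sm' : s <= m by exact: (ub_le_sup supS.2 Ss).
have Sm' s' : m <= s' -> s' < m + r -> s' <= b -> S s' by move=> *; exact: (hr s).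
have meqb : m = b.
  apply/eqP; rewrite eq_le mb leNgt/=; apply/negP => ltmb.
  pose s' := Num.min b (m + r / 2).
  have ms' : m < s' by rewrite lt_min ltmb/= ltrDl divr_gt0.
  have : S s'.
    apply: Sm'; [exact: ltW| |by rewrite ge_min lexx].
    by rewrite gt_min; apply/orP; right; rewrite ltrD2l; lra.
  by move=> /(ub_le_sup supS.2); rewrite leNgt ms'.
have [_ [l [il pl ml Gl]]] : S b by apply: Sm'; rewrite ?meqb//; lra.
have lt_d : \sum_(p <- l) (p.2 - p.1) < delta.
  rewrite -lte_fin (le_lt_trans ml)// (le_lt_trans _ Ud)//.
  by apply: le_measure; rewrite ?inE//; exact: subIsetl.
have := hdelta l il pl lt_d => h.
have -> : e' = e * (b - a) + e by rewrite /e; field; rewrite gt_eqF// ltr_wpDl// subr_ge0.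
lra.
Qed.

Lemma Rintegrable_norm (D : set R) h : Lintegrable D h -> Lintegrable D (fun t => `|h t|).
Proof. by move=> hi; exact: (integrable_abse hi). Qed.

Lemma LI_normr (D : set R) h : measurable (D : set LT) -> Lintegrable D h ->
  `|LI D h| <= LI D (fun t => `|h t|).
Proof. by move=> mD hi; exact: le_normr_Rintegral. Qed.

Lemma LIB (D : set R) h1 h2 : measurable (D : set LT) -> Lintegrable D h1 ->
  Lintegrable D h2 -> LI D (fun t => h1 t - h2 t) = LI D h1 - LI D h2.
Proof. by move=> mD i1 i2; exact: RintegralB. Qed.

Lemma LID (D : set R) h1 h2 : measurable (D : set LT) -> Lintegrable D h1 ->
  Lintegrable D h2 -> LI D (fun t => h1 t + h2 t) = LI D h1 + LI D h2.
Proof. by move=> mD i1 i2; exact: RintegralD. Qed.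

Lemma LIZ (D : set R) r h : measurable (D : set LT) -> Lintegrable D h ->
  LI D (fun t => r * h t) = r * LI D h.
Proof. by move=> mD i1; exact: RintegralZl. Qed.

Lemma LI_le (D : set R) h1 h2 : measurable (D : set LT) -> Lintegrable D h1 ->
  Lintegrable D h2 -> (forall t, D t -> h1 t <= h2 t) -> LI D h1 <= LI D h2.
Proof. by move=> mD i1 i2 h; exact: le_Rintegral. Qed.

Lemma LI_ge0 (D : set R) h : (forall t, D t -> 0 <= h t) -> 0 <= LI D h.
Proof. by move=> h0; exact: Rintegral_ge0. Qed.

Lemma LI_sub a s t h : a <= s -> s <= t -> Lintegrable `[a, t] h ->
  LI `[a, t] h - LI `[a, s] h = LI `[s, t] h.
Proof. by move=> as_ st hi; rewrite (@LI_cat _ a s t) ?as_ ?st// addrC addKr. Qed.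

Lemma LI_small a b h : Lintegrable `[a, b] h -> (forall t, 0 <= h t) ->
  forall eps, 0 < eps -> exists2 delta, 0 < delta &
    forall (N : nat) (u v : nat -> R),
      (forall i, (i < N)%N -> a <= u i /\ u i <= v i /\ v i <= b) ->
      (forall i j, (i < N)%N -> (j < N)%N -> i <> j -> v i <= u j \/ v j <= u i) ->
      \sum_(i < N) (v i - u i) < delta ->
      \sum_(i < N) LI `[u i, v i] h < eps.
Proof.
move=> hi h0 eps eps0; pose F : R -> R := h \_ `[a, b].
have mi := @itv_Lmeasurable R.
have Fi : mu.-integrable [set: LT] (EFin \o F).
  by rewrite /F -restrict_EFin; apply/(integrable_mkcond _ (mi `[a, b])).
have F0 t : 0 <= F t by rewrite /F patchE; case: ifP.
have [delta [delta0 hd]] := @integral_normr_continuous _ LT R mu F Fi eps eps0.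
exists delta => // N u v uv dis sN.
(* Closed intervals of the family may share end points; the half-open ones are disjoint and have the
   same integrals. *)
pose I i : set LT := `]u i, v i]%classic.
pose D k := \big[setU/set0]_(i < k) I i.
have mI i : measurable (I i) by exact: mi.
have mD k : measurable (D k) by exact: bigsetU_measurable.
have inD k x : D k x -> exists2 i, (i < k)%N & I i x.
  by rewrite /D -bigcup_mkord => -[i]; exists i.
have muI i : (i < N)%N -> mu (I i) = (v i - u i)%:E.
  move=> iN; have [_ [uvi _]] := uv i iN.
  rewrite lebcE lebesgue_measure_itv/= lte_fin; case: ltP => // vu.
  by have -> : u i = v i by [apply/eqP; rewrite eq_le uvi vu]; rewrite subrr.
have muD k : (k <= N)%N -> (mu (D k) <= (\sum_(i < k) (v i - u i))%:E)%E.
  elim: k => [|k IH] kN; first by rewrite /D !big_ord0 lebcE measure0.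
  rewrite /D !big_ord_recr/= -/(D k) EFinD.
  have := @measureU2 _ _ _ mu _ _ (mD k) (mI k); move=> /le_trans; apply.
  apply: leeD; first exact: (IH (ltnW kN)).
  by rewrite le_eqVlt; apply/orP; left; apply/eqP; exact: (muI k kN).
have iFS (A : set LT) : measurable A -> Lintegrable A (fun t => `|F t|).
  by move=> mA; apply: (integrableS measurableT mA (@subsetT _ _)); exact: (Rintegrable_norm Fi).
have intD k : (k <= N)%N -> LI (D k) (fun t => `|F t|) = \sum_(i < k) LI `[u i, v i] h.
  elim: k => [|k IH] kN; first by rewrite /D !big_ord0 /LI Rintegral_set0.
  rewrite /D !big_ord_recr/= -/(D k) LI_setU//; last 2 first.
  - by apply: iFS; exact: measurableU.
  - apply/seteqP; split => // x [/inD[i ik]]; rewrite /I /= !in_itv/= => /andP[i1 i2] /andP[j1 j2].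
    have [h1|h1] := dis i k (ltn_trans ik kN) kN (fun e => negP (negbT (ltnn k)) (eq_ind _ (fun z => (z < k)%N) ik _ e)).
      by have := lt_le_trans j1 i2; move=> /lt_le_trans/(_ h1); rewrite ltxx.
    by have := lt_le_trans i1 j2; move=> /lt_le_trans/(_ h1); rewrite ltxx.
  rewrite (IH (ltnW kN)); congr (_ + _).
  have [h1 [h2 h3]] := uv k kN.
  rewrite LI_itv_obnd//; last exact: LintegrableS hi.
  apply: eq_Rintegral => t /set_mem; rewrite /I /= in_itv/= => /andP[t1 t2].
  have tab : t \in (`[a, b]%classic : set R).
    by rewrite mem_set//= in_itv/= (le_trans t2 h3) andbT (le_trans h1)// ltW.
  by rewrite /F patchE tab ger0_norm.
rewrite -intD//; apply: hd => //.
by apply: (le_lt_trans (muD N _)); rewrite ?lte_fin.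
Qed.

Lemma LI_acont a b h : Lintegrable `[a, b] h -> acont a b (fun t => LI `[a, t] h).
Proof.
move=> hi eps eps0.
have [delta delta0 hd] := LI_small (Rintegrable_norm hi) (fun t => normr_ge0 _) eps0.
exists delta => // N u v uv dis sN.
have := hd N u v uv dis sN; apply: le_lt_trans; apply: ler_sum => i _.
have [h1 [h2 h3]] := uv i (ltn_ord i).
rewrite LI_sub//; last exact: LintegrableS hi.
apply: LI_normr; first exact: itv_Lmeasurable.
exact: LintegrableS hi.
Qed.

Lemma acontB a b G1 G2 : acont a b G1 -> acont a b G2 -> acont a b (fun t => G1 t - G2 t).
Proof.
move=> ac1 ac2 eps eps0; have e2 : 0 < eps / 2 by rewrite divr_gt0.
have [d1 d10 h1] := ac1 _ e2; have [d2 d20 h2] := ac2 _ e2.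
exists (Num.min d1 d2) => [|N u v uv dis]; first by rewrite lt_min d10.
rewrite lt_min => /andP[s1 s2].
have := ltrD (h1 N u v uv dis s1) (h2 N u v uv dis s2); rewrite -splitr.
apply: le_lt_trans; rewrite -big_split; apply: ler_sum => i _ /=.
rewrite (_ : _ - _ = (G1 (v i) - G1 (u i)) - (G2 (v i) - G2 (u i))); last ring.
exact: ler_normB.
Qed.

Lemma acontS a b a' b' G : a <= a' -> b' <= b -> acont a b G -> acont a' b' G.
Proof.
move=> aa bb acG eps eps0; have [d d0 h] := acG _ eps0; exists d => // N u v uv.
apply: h => i iN; have [h1 [h2 h3]] := uv i iN.
by split; [exact: le_trans h1|split => //; exact: le_trans bb].
Qed.

(** The difference of G and the indefinite integral of h is absolutely continuous with zero
    derivative almost everywhere. *)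
Theorem acont_FTC a b G h : acont a b G -> Lintegrable `[a, b] h ->
  {ae mu, forall t : LT, a < t < b -> derivable G t 1 /\ 'D_1 G t = h t} ->
  forall s, a <= s <= b -> G s = G a + LI `[a, s] h.
Proof.
move=> acG hi Gae s /andP[as_ sb].
have := @acont_derive0 a s (fun t => G t - LI `[a, t] h) as_ _ _.
rewrite set_itv1 LI_set1 subr0 => H; apply/eqP; rewrite -subr_eq; apply/eqP; apply: H.
  apply: (acontS (lexx a) sb); apply: acontB => //; exact: LI_acont.
apply: (LaeS2 Gae (LFTC1 hi)) => t h1 h2 /andP[at_ ts].
have tab : a < t < b by rewrite at_ (lt_le_trans ts).
have [d1 D1] := h1 tab; have [d2 D2] := h2 tab.
split; first exact: derivableB.
by rewrite deriveB// D1 D2 subrr.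
Qed.

End AbsoluteContinuity.

Global Opaque LI.

(** Composing with the projection onto [a, b] extends a function by its end values, so that results
    about continuous functions on the whole line apply. *)
Definition clamp {R : realType} (a b t : R) : R := Num.max a (Num.min b t).

Definition ucont {R : realType} (a b : R) (G : R -> R) : Prop :=
  forall eps, 0 < eps -> exists2 delta, 0 < delta &
    forall s t, a <= s -> s <= t -> t <= b -> t - s < delta -> `|G t - G s| < eps.

Section UniformContinuity.
Context {R : realType}.
Implicit Types (a b : R) (G : R -> R).
Local Notation mu := (@completed_lebesgue_measure R).
Local Notation LT := (LebT R).

Lemma clamp_itv a b t : a <= b -> a <= clamp a b t <= b.
Proof. by move=> ab; rewrite /clamp le_max lexx/= ge_max ab ge_min lexx. Qed.

Lemma clamp_id a b t : a <= t <= b -> clamp a b t = t.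
Proof. by move=> /andP[at_ tb]; rewrite /clamp (min_r tb) (max_r at_). Qed.

Lemma clamp_lip a b s t : `|clamp a b s - clamp a b t| <= `|s - t|.
Proof.
have minP x y : x <= y -> 0 <= Num.min b y - Num.min b x <= y - x.
  by move=> xy; case: (leP b y) => ?; case: (leP b x) => ?; apply/andP; split; lra.
have maxP x y : x <= y -> 0 <= Num.max a y - Num.max a x <= y - x.
  by move=> xy; case: (leP a y) => ?; case: (leP a x) => ?; apply/andP; split; lra.
wlog st : s t / s <= t.
  by move=> H; have [/H//|/ltW/H] := leP s t; rewrite distrC (distrC t).
rewrite distrC (distrC s) (ger0_norm (_ : 0 <= t - s)) ?subr_ge0//.
have /andP[h1 h2] := minP _ _ st; rewrite subr_ge0 in h1.
have /andP[h3 h4] := maxP _ _ h1.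
by rewrite ger0_norm//; exact: le_trans h2.
Qed.

Lemma acont_ucont a b G : acont a b G -> ucont a b G.
Proof.
move=> acG e e0; have [d d0 h] := acG e e0; exists d => // s t as_ st tb tsd.
have := h 1%N (fun=> s) (fun=> t); rewrite !big_ord1; apply => //.
by move=> [|i] [|j].
Qed.

Lemma ucont_clamp a b G : a <= b -> ucont a b G -> continuous (fun t => G (clamp a b t)).
Proof.
move=> ab uG t; apply/cvgrPdist_lt => e e0.
have [d d0 h] := uG e e0.
have : \forall s \near t, `|t - s| < d by apply: nbhsx_ballx.
apply: filter_app; near=> s => ts.
have /andP[h1 h2] := clamp_itv t ab; have /andP[h3 h4] := clamp_itv s ab.
have h5 := le_lt_trans (clamp_lip a b t s) ts.
have [c|c] := leP (clamp a b s) (clamp a b t).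
  by apply: h => //; exact: le_lt_trans (ler_norm _) h5.
rewrite distrC; apply: h => //; first exact: ltW.
by rewrite distrC in h5; exact: le_lt_trans (ler_norm _) h5.
Unshelve. all: by end_near. Qed.

Lemma Lmeasurable_eq (D : set R) (f g : R -> R) : (forall t, D t -> f t = g t) ->
  measurable_fun (D : set LT) f -> measurable_fun (D : set LT) g.
Proof. by move=> fg mf; apply: eq_measurable_fun mf => t /set_mem; exact: fg. Qed.

Lemma Lmeasurable_borel_fun (f : R -> R) : measurable_fun [set: measurableTypeR R] f ->
  measurable_fun [set: LT] f.
Proof.
by move=> mf _ A mA; rewrite setTI; apply: borel_Lmeasurable; rewrite -[X in measurable X]setTI; exact: mf.
Qed.

Lemma ucont_measurable a b G : a <= b -> ucont a b G -> measurable_fun (`[a, b]%classic : set LT) G.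
Proof.
move=> ab uG; apply: (@Lmeasurable_eq _ (fun t => G (clamp a b t))).
  by move=> t /=; rewrite in_itv/= => h; rewrite clamp_id.
apply: measurable_funTS; apply: Lmeasurable_borel_fun; apply: continuous_measurable_fun.
exact: ucont_clamp.
Qed.

Lemma measurable_countable_cases (D : set R) (m : R -> int) (F : int -> R -> R) :
  (forall i, measurable ([set t | m t = i] : set LT)) ->
  (forall i, measurable_fun (D : set LT) (F i)) -> measurable_fun (D : set LT) (fun t => F (m t) t).
Proof.
move=> mm mF mD Y mY.
have -> : D `&` (fun t => F (m t) t) @^-1` Y =
    \bigcup_(i in [set: int]) ([set t | m t = i] `&` (D `&` F i @^-1` Y)).
  apply/seteqP; split => [t [Dt Yt]|t [i _ [/= <- [Dt Yt]]]]; last by split.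
  by exists (m t).
by apply: countable_bigcupT_measurable => // i; apply: measurableI => //; exact: mF.
Qed.

(** Freezing x at the grid point floor(t (N+1)) / (N+1) leaves countably many cases, each measurable
    in t; continuity of h in the vector passes to the limit in N. *)
Lemma caratheodory_measurable n a b (h : R -> 'rV[R]_n -> R) (x : R -> 'rV[R]_n) : a <= b ->
  (forall z, measurable_fun (`[a, b]%classic : set LT) (fun t => h t z)) ->
  (forall t, a <= t <= b -> continuous (h t)) ->
  (forall j, ucont a b (fun t => x t 0 j)) ->
  measurable_fun (`[a, b]%classic : set LT) (fun t => h t (x t)).
Proof.
move=> ab mh ch ux.
(* The grid point below t may lie to the left of a. *)
pose q N i := clamp a b (i%:~R / N.+1%:R) : R.
pose m N (t : R) := Num.floor (t * N.+1%:R).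
apply: (@measurable_fun_cvg _ LT R _ (fun N t => h t (x (q N (m N t))))).
  move=> N; apply: (@measurable_countable_cases _ (m N) (fun i t => h t (x (q N i)))) => // i.
  have -> : [set t | m N t = i] = `[i%:~R / N.+1%:R, (i + 1)%:~R / N.+1%:R[%classic.
    apply/seteqP; split => t /=; rewrite in_itv/= ler_pdivrMr ?ltr0n// ltr_pdivlMr ?ltr0n//.
      by move=> <-; rewrite /m floor_le_tmp// floorD1_gt.
    by move=> h1; apply/eqP; rewrite /m floor_eq.
  exact: itv_Lmeasurable.
move=> t /=; rewrite in_itv/= => tab.
apply: (@continuous_cvg _ _ _ _ _ _ (h t)); first exact: ch.
apply/cvg_rowP => j; apply/cvgrPdist_lt => e e0.
have [d d0 hd] := ux j e e0.
near=> N.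
have Nd : N.+1%:R^-1 < d by near: N; exact: (near_infty_natSinv_lt (PosNum d0)).
have hq : `|t - q N (m N t)| < d.
  rewrite -[X in `|X - _|](clamp_id tab); apply: (le_lt_trans (clamp_lip _ _ _ _)).
  apply: le_lt_trans Nd.
  have N0 : 0 < N.+1%:R :> R by rewrite ltr0n.
  have := floor_le_tmp (t * N.+1%:R); have := floorD1_gt (t * N.+1%:R); rewrite -/(m N t) intrD.
  set z := (m N t)%:~R => h1 h2.
  rewrite ger0_norm ?subr_ge0 ?ler_pdivrMr//.
  rewrite lerBlDr -[X in X + _]mul1r -mulrDl ler_pdivlMr// addrC.
  exact: ltW.
have /andP[t1 t2] := tab; have /andP[q1 q2] := clamp_itv ((m N t)%:~R / N.+1%:R) ab.
have [c|c] := leP (q N (m N t)) t.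
  by apply: hd => //; exact: le_lt_trans (ler_norm _) hq.
rewrite distrC; apply: hd => //; first exact: ltW.
by rewrite distrC in hq; exact: le_lt_trans (ler_norm _) hq.
Unshelve. all: by end_near. Qed.

Lemma ucontS a b a' b' G : a <= a' -> b' <= b -> ucont a b G -> ucont a' b' G.
Proof.
move=> aa bb uG e e0; have [d d0 h] := uG e e0; exists d => // s t as_ st tb.
by apply: h => //; [exact: le_trans as_|exact: le_trans bb].
Qed.

Lemma ucontD a b G1 G2 : ucont a b G1 -> ucont a b G2 -> ucont a b (fun t => G1 t + G2 t).
Proof.
move=> u1 u2 e e0; have e2 : 0 < e / 2 by rewrite divr_gt0.
have [d1 d10 h1] := u1 _ e2; have [d2 d20 h2] := u2 _ e2.
exists (Num.min d1 d2) => [|s t as_ st tb]; first by rewrite lt_min d10.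
rewrite lt_min => /andP[s1 s2].
have := ltrD (h1 s t as_ st tb s1) (h2 s t as_ st tb s2); rewrite -splitr.
by apply: le_lt_trans; rewrite opprD addrACA; exact: ler_normD.
Qed.

Lemma ucont_cst a b (r : R) : ucont a b (fun=> r).
Proof. by move=> e e0; exists 1 => // s t *; rewrite subrr normr0. Qed.

Lemma ucont_norm a b G : ucont a b G -> ucont a b (fun t => `|G t|).
Proof.
move=> uG e e0; have [d d0 h] := uG e e0; exists d => // s t as_ st tb ts.
exact: le_lt_trans (ler_dist_dist _ _) (h s t as_ st tb ts).
Qed.

Lemma ucont_sum a b (I : Type) (r : seq I) (F : I -> R -> R) :
  (forall i, ucont a b (F i)) -> ucont a b (fun t => \sum_(i <- r) F i t).
Proof.
move=> uF; elim: r => [|i r IH].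
  by under eq_fun do rewrite big_nil; exact: ucont_cst.
by under eq_fun do rewrite big_cons; exact: ucontD.
Qed.

Lemma LI_ucont a b h : Lintegrable `[a, b] h -> ucont a b (fun t => LI `[a, t] h).
Proof. by move=> hi; apply: acont_ucont; exact: LI_acont. Qed.

Lemma Lintegrable_measurable (D : set R) (k : R -> R) : Lintegrable D k ->
  measurable_fun (D : set LT) k.
Proof. by move=> /integrableP[/measurable_EFinP]. Qed.

Lemma Lintegrable_mul_bounded (D : set R) (k u : R -> R) (B : R) : measurable (D : set LT) ->
  Lintegrable D k -> measurable_fun (D : set LT) u -> (forall t, D t -> `|u t| <= B) ->
  Lintegrable D (fun t => k t * u t).
Proof.
move=> mD ki mu' uB.
have B0 t : D t -> 0 <= B by move=> /uB; exact: le_trans.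
apply: (le_integrable mD (g := fun t => (B * k t)%:E)); last exact: (rintegrableZ B mD ki).
  by apply/measurable_EFinP; apply: measurable_funM => //; exact: Lintegrable_measurable.
move=> t Dt /=; rewrite lee_fin !normrM mulrC ler_wpM2r//.
by rewrite (ger0_norm (B0 _ Dt)) uB.
Qed.

(** Exponential weights turn integral inequalities with kernel k into contractions of ratio 1/2: l =
    2 serves Gronwall's lemma, l = -2 Filippov's backward iteration. *)
Lemma expK_FTC a b k (l : R) : a <= b -> Lintegrable `[a, b] k -> (forall t, 0 <= k t) ->
  let phi t := expR (l * LI `[a, t] k) in
  [/\ acont a b phi, Lintegrable `[a, b] (fun t => k t * phi t) &
      forall s t, a <= s -> s <= t -> t <= b ->
        l * LI `[s, t] (fun r => k r * phi r) = phi t - phi s].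
Proof.
move=> ab ki k0; set K := fun t => LI `[a, t] k; move=> phi.
have K0 t : 0 <= K t by apply: LI_ge0.
have KM t : a <= t <= b -> K t <= K b.
  move=> /andP[at_ tb]; rewrite /K (@LI_cat _ a t b) ?at_ ?tb// lerDl.
  by apply: LI_ge0.
pose L := expR (`|l| * K b).
have phiL t : a <= t <= b -> phi t <= L.
  move=> tab; rewrite ler_expR; apply: (@le_trans _ _ (`|l| * K t)).
    by apply: ler_wpM2r; [exact: K0|exact: ler_norm].
  by rewrite ler_wpM2l// KM.
(* The exponential is Lipschitz with constant L where its values are at most L; written with
   logarithms, this follows from exp u >= 1 + u. *)
have expl (x y : R) : x <= L -> y <= L -> 0 < x -> 0 < y -> `|x - y| <= L * `|ln x - ln y|.
  move=> xL yL x0 y0; wlog xy : x y xL yL x0 y0 / x <= y.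
    by move=> H; have [/H|/ltW/H] := leP x y; [exact|rewrite distrC (distrC (ln x)); exact].
  rewrite distrC (distrC (ln x)) (@ger0_norm _ (y - x)) ?subr_ge0//.
  have lxy : ln x <= ln y by rewrite ler_ln ?posrE.
  rewrite ger0_norm ?subr_ge0//.
  have := expR_ge1Dx (ln x - ln y); rewrite expRD expRN !lnK ?posrE// => h.
  have : y * (1 + (ln x - ln y)) <= x.
    by rewrite -ler_pdivlMl// mulrC.
  move=> h1; apply: (@le_trans _ _ (y * (ln y - ln x))); first by lra.
  by rewrite ler_wpM2r// subr_ge0.
have acK : acont a b K := LI_acont ki.
have acphi : acont a b phi.
  move=> e e0; pose C := L * (`|l| + 1).
  have C0 : 0 < C by rewrite mulr_gt0 ?expR_gt0// ltr_wpDl.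
  have [d d0 h] := acK _ (divr_gt0 e0 C0); exists d => // N u v uv dis sN.
  have := h N u v uv dis sN; rewrite ltr_pdivlMr// mulr_suml; apply: le_lt_trans.
  apply: ler_sum => i _; have [h1 [h2 h3]] := uv i (ltn_ord i).
  have vi : a <= v i <= b by rewrite h3 (le_trans h1).
  have ui : a <= u i <= b by rewrite h1 (le_trans h2).
  rewrite (le_trans (expl _ _ (phiL _ vi) (phiL _ ui) (expR_gt0 _) (expR_gt0 _)))//.
  have lnphi r : ln (phi r) = l * K r by exact: expRK.
  have lnE : ln (phi (v i)) - ln (phi (u i)) = l * K (v i) - l * K (u i) by congr (_ - _).
  rewrite lnE /C.
  have L0 : 0 <= L by exact: expR_ge0.
  move: L0 (K (v i)) (K (u i)) => {h phiL expl C C0}; move: L => M M0 x y.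
  rewrite -mulrBr normrM; have : 0 <= M * `|x - y| by rewrite mulr_ge0.
  by clear; move: `|l| `|x - y| => p q; lra.
have iphi : Lintegrable `[a, b] (fun t => k t * phi t).
  apply: (@Lintegrable_mul_bounded _ _ _ L) => //; first exact: itv_Lmeasurable.
    by apply: ucont_measurable => //; exact: acont_ucont.
  move=> t /=; rewrite in_itv/= => tab.
  by rewrite (ger0_norm (expR_ge0 _)); exact: phiL.
split => // s t as_ st tb.
have mst := @itv_Lmeasurable R `[s, t].
rewrite -LIZ//; last exact: LintegrableS iphi.
have lphi : Lintegrable `[s, t] (fun r => l * (k r * phi r)).
  apply: (rintegrableZ l mst); exact: LintegrableS iphi.
rewrite (@acont_FTC _ s t phi _ _ lphi _ t).
- by rewrite addrAC subrr add0r.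
- exact: acontS acphi.
- apply: (LaeS (LFTC1 ki)) => r h /andP[sr rt].
  have [dK DK] := h (introT andP (conj (le_lt_trans as_ sr) (lt_le_trans rt tb))).
  have iK : is_derive r 1 K (k r) by apply: DeriveDef.
  have iE : is_derive r 1 phi (expR (l * K r) * (l *: k r)).
    exact: (@is_derive1_comp _ expR (fun y => l * K y)).
  have [d1 D1] := iE.
  by split => //; rewrite D1 /phi; rewrite /GRing.scale/=; ring.
- by rewrite st lexx.
Qed.

(** Starting from the crude bound B, the inequality is iterated against the weight exp (2 K), where
    K is the integral of k. As the integral of k exp (2 K) is half the increment of the weight, each
    round halves the contribution of B, and 2 A is the fixed point. *)
Lemma gronwall a b (k u : R -> R) (A B : R) : a <= b -> Lintegrable `[a, b] k -> (forall t, 0 <= k t) ->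
  measurable_fun (`[a, b]%classic : set LT) u -> 0 <= A ->
  (forall t, a <= t <= b -> 0 <= u t <= B) ->
  (forall t, a <= t <= b -> u t <= A + LI `[a, t] (fun s => k s * u s)) ->
  forall t, a <= t <= b -> u t <= 2 * A * expR (2 * LI `[a, t] k).
Proof.
move=> ab ki k0 mu' A0 uB hu t tab.
have [_ iphi phiE] := expK_FTC 2 ab ki k0.
set phi := fun t => expR (2 * LI `[a, t] k) in iphi phiE.
have phi1 s : 1 <= phi s.
  by rewrite -expR0 ler_expR mulr_ge0//; apply: LI_ge0.
have B0 : 0 <= B by have /andP[/le_trans] := uB t tab; exact.
have iku : Lintegrable `[a, b] (fun s => k s * u s).
  apply: (@Lintegrable_mul_bounded _ _ _ B) => //; first exact: itv_Lmeasurable.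
  by move=> s /=; rewrite in_itv/= => /uB/andP[us0 usB]; rewrite ger0_norm.
have key N s : a <= s <= b -> u s <= (2 * A + B / 2 ^+ N) * phi s.
  elim: N s => [|N IH] s sab.
    have /andP[_ h] := uB s sab; rewrite expr0 divr1.
    apply: (le_trans h); apply: (@le_trans _ _ (2 * A + B)).
      by rewrite lerDr mulr_ge0.
    by rewrite ler_peMr// addr_ge0// mulr_ge0.
  apply: (le_trans (hu s sab)); set C := 2 * A + B / 2 ^+ N.
  have C0 : 0 <= C by rewrite addr_ge0 ?mulr_ge0// invr_ge0 exprn_ge0.
  have /andP[as_ sb] := sab.
  have mas := @itv_Lmeasurable R `[a, s].
  have h1 : LI `[a, s] (fun s => k s * u s) <= C * LI `[a, s] (fun r => k r * phi r).
    rewrite -LIZ//; last exact: LintegrableS iphi.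
    apply: LI_le => //; [exact: LintegrableS iku|apply: (rintegrableZ C mas); exact: LintegrableS iphi|].
    move=> r /=; rewrite in_itv/= => /andP[ar rs].
    by rewrite mulrCA ler_wpM2l// IH// ar (le_trans rs).
  have h2 : 2 * LI `[a, s] (fun r => k r * phi r) = phi s - 1.
    by rewrite /phi phiE// set_itv1 LI_set1 mulr0 expR0.
  have -> : 2 * A + B / 2 ^+ N.+1 = A + C / 2.
    by rewrite /C exprS; field; rewrite expf_neq0.
  have p1 := phi1 s; move: h1 h2 p1 A0 C0; clear.
  move: (LI _ _) (LI _ _) (phi s) C => J I p C h1 h2 p1 A0 C0; nra.
apply/ler_addgt0Pr => e e0.
pose N := Num.bound (B * phi t / e).
apply: (le_trans (key N t tab)); rewrite mulrDl lerD2l mulrAC ler_pdivrMr ?exprn_gt0//.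
rewrite -ler_pdivrMl// mulrC.
have Bp0 : 0 <= B * phi t / e by rewrite divr_ge0 ?mulr_ge0 ?expR_ge0// ltW.
apply: (le_trans (ltW (archi_boundP Bp0))).
by rewrite -natrX ler_nat ltnW// ltn_expl.
Qed.

End UniformContinuity.

Section DominatedConvergence.
Context {R : realType}.
Local Notation mu := (@completed_lebesgue_measure R).
Local Notation LT := (LebT R).
Implicit Types (D A : set R) (f g : R -> R).

Lemma LI_E D f : Lintegrable D f -> measurable (D : set LT) ->
  (\int[mu]_(t in (D : set LT)) (f t)%:E = (LI D f)%:E)%E.
Proof.
Transparent LI.
move=> fi mD; rewrite /LI /Rintegral fineK//; exact: integrable_fin_num.
Qed.
Global Opaque LI.

Lemma LI0 D : LI D (fun=> 0) = 0.
Proof. Transparent LI. by rewrite /LI /Rintegral integral0. Qed.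
Global Opaque LI.

Lemma LI_indic D A f : LI D (fun t => \1_A t * f t) = LI (D `&` A) f.
Proof.
Transparent LI.
rewrite /LI /Rintegral integral_mkcondr; congr fine; apply: eq_integral => t _.
by rewrite patchE indicE; case: ifP => _; rewrite ?mul1r ?mul0r.
Qed.
Global Opaque LI.

Lemma eq_LI D f g : (forall t, D t -> f t = g t) -> LI D f = LI D g.
Proof. Transparent LI. by move=> fg; apply: eq_Rintegral => t /set_mem; exact: fg. Qed.
Global Opaque LI.

Lemma LintegralE D f : Lintegrable D f -> measurable (D : set LT) ->
  Lintegral D f = (LI D f)%:E.
Proof. exact: LI_E. Qed.

Lemma LI_dominated_ae D (f_ : nat -> R -> R) f g : measurable (D : set LT) ->
  (forall i, measurable_fun (D : set LT) (f_ i)) -> measurable_fun (D : set LT) f ->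
  {ae mu, forall t : LT, D t -> f_ i t @[i --> \oo] --> f t} ->
  Lintegrable D g -> (forall i t, D t -> `|f_ i t| <= g t) ->
  Lintegrable D f /\ LI D (f_ i) @[i --> \oo] --> LI D f.
Proof.
move=> mD mf_ mf f_f gi f_g.
have emf_ i : measurable_fun (D : set LT) (fun t : LT => (f_ i t)%:E).
  by apply/measurable_EFinP; exact: mf_.
have emf : measurable_fun (D : set LT) (fun t : LT => (f t)%:E) by exact/measurable_EFinP.
have aef : {ae mu, forall t : LT, D t -> (f_ i t)%:E @[i --> \oo] --> (f t)%:E}.
  by apply: (LaeS f_f) => t h Dt; apply: cvg_EFin (h Dt); exact: nearW.
have aeg : {ae mu, forall t : LT, forall i, D t -> (`|(f_ i t)%:E| <= (g t)%:E)%E}.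
  by apply: aeW => t i Dt; rewrite /= lee_fin; exact: f_g.
have [fi _ h] := dominated_convergence mD emf_ emf aef gi aeg.
split=> //; apply: (@fine_cvg _ _ _ _ (fun i => (\int[mu]_(t in (D : set LT)) (f_ i t)%:E)%E)).
have := @LI_E D f fi mD => E; rewrite -E; exact: h.
Qed.

Lemma LI_dominated D (f_ : nat -> R -> R) f g : measurable (D : set LT) ->
  (forall i, measurable_fun (D : set LT) (f_ i)) ->
  (forall t, D t -> f_ i t @[i --> \oo] --> f t) ->
  Lintegrable D g -> (forall i t, D t -> `|f_ i t| <= g t) ->
  Lintegrable D f /\ LI D (f_ i) @[i --> \oo] --> LI D f.
Proof.
move=> mD mf_ f_f gi f_g; apply: LI_dominated_ae gi f_g => //.
  exact: (measurable_fun_cvg mf_).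
by apply: aeW.
Qed.

Lemma LI_bound D f g : measurable (D : set LT) -> Lintegrable D f -> Lintegrable D g ->
  (forall t, D t -> `|f t| <= g t) -> `|LI D f| <= LI D g.
Proof.
move=> mD fi gi h; apply: (le_trans (LI_normr mD fi)).
by apply: LI_le => //; exact: Rintegrable_norm.
Qed.

Lemma Lintegrable_dom D f g : measurable (D : set LT) -> measurable_fun (D : set LT) f ->
  Lintegrable D g -> (forall t, D t -> `|f t| <= g t) -> Lintegrable D f.
Proof.
move=> mD mf gi h; apply: (le_integrable mD _ _ gi); first exact/measurable_EFinP.
by move=> t Dt /=; rewrite lee_fin (le_trans (h t Dt))// ler_norm.
Qed.

Lemma Lmeasurable_indic D A : measurable (A : set LT) ->
  measurable_fun (D : set LT) (\1_A : R -> R).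
Proof. by move=> mA; apply: measurable_funTS; exact: (@measurable_indic _ LT R setT A). Qed.

Lemma indic_le1 A (t : R) : `|\1_A t| <= 1 :> R.
Proof. by rewrite indicE; case: (t \in A); rewrite ?normr1 ?normr0. Qed.

Lemma Lintegrable_indicM D A f : measurable (D : set LT) -> measurable (A : set LT) ->
  Lintegrable D f -> Lintegrable D (fun t => \1_A t * f t).
Proof.
move=> mD mA fi; apply: (@Lintegrable_dom _ _ (fun t => `|f t|) mD).
- apply: measurable_funM; [exact: Lmeasurable_indic|exact: Lintegrable_measurable].
- exact: Rintegrable_norm.
- by move=> t _; rewrite normrM ler_piMl// indic_le1.
Qed.

End DominatedConvergence.

(** * Weak limits of dominated sequences *)

Section WeakLimit.
Context {R : realType}.
Local Notation mu := (@completed_lebesgue_measure R).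
Local Notation LT := (LebT R).
Variables (a b : R) (v : nat -> R -> R) (psi : R -> R).
Local Notation D := (`[a, b]%classic : set R).
Hypotheses (ab : a <= b) (vi : forall i, Lintegrable D (v i)) (psii : Lintegrable D psi).
Hypothesis v_psi : forall i t, D t -> `|v i t| <= psi t.
Hypothesis cvX : forall t, a <= t <= b -> cvgn (fun i => LI `[a, t] (v i)).

Let J A i := LI D (fun t => \1_A t * v i t).
Let mD : measurable (D : set LT) := itv_Lmeasurable _.

Let Ji A i : measurable (A : set LT) -> Lintegrable D (fun t => \1_A t * v i t).
Proof. by move=> mA; exact: Lintegrable_indicM. Qed.

Let J_dom A i : measurable (A : set LT) -> `|J A i| <= LI D (fun t => \1_A t * psi t).
Proof.
move=> mA; apply: (LI_bound mD (Ji _ mA) (Lintegrable_indicM mD mA psii)).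
by move=> t Dt; rewrite normrM (@ger0_norm _ (\1_A t))// ler_wpM2l// v_psi.
Qed.

Let cvg_approx (z : nat -> R) : (forall e, 0 < e -> exists w : nat -> R,
  cvgn w /\ forall i, `|z i - w i| <= e) -> cvgn z.
Proof.
move=> H; apply/cauchy_cvgP; apply: cauchy_exP => e e0.
have e2 : 0 < e / 2 by rewrite divr_gt0.
have [w [cw zw]] := H (e / 4) (divr_gt0 e0 (ltr0n _ 4)).
exists (limn w); have /cvgrPdist_lt/(_ _ e2) := cw.
apply: filterS => i /= hi; rewrite /ball/=.
apply: le_lt_trans (ler_distD (w i) _ _) _.
have := zw i; rewrite (distrC (z i)); lra.
Qed.

(** A bound by psi alone, hence uniform in i: it justifies every exchange of the limit in i with a
    countable union. *)
Let J_tail (F : nat -> set R) : (forall k, measurable (F k : set LT)) -> trivIset setT F ->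
  LI D (fun t => \1_(\bigcup_k F k `\` \bigcup_(k < n) F k) t * psi t) @[n --> \oo] --> 0.
Proof.
move=> mF tF.
have mT n : measurable (\bigcup_k F k `\` \bigcup_(k < n) F k : set LT).
  by apply: measurableD; [exact: bigcupT_measurable|exact: bigcup_measurable].
rewrite -[X in _ --> X](LI0 D).
apply: (@LI_dominated _ D _ (fun=> 0) psi mD _ _ psii _).2.
- move=> i; apply: measurable_funM; [exact: Lmeasurable_indic|exact: Lintegrable_measurable].
- move=> t Dt; have [[k _ Fk]|nF] := pselect ((\bigcup_k F k) t).
    apply: cvg_near_cst; exists k.+1 => // n /= kn.
    rewrite indicE memNset ?mul0r// => -[_]; apply; by exists k.
  apply: cvg_near_cst; exists 0%N => // n _.
  by rewrite indicE memNset ?mul0r// => -[].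
- move=> i t Dt; rewrite normrM.
  have p0 : 0 <= psi t by exact: le_trans (v_psi 0%N Dt).
  by rewrite (ger0_norm p0) ler_piMl// indic_le1.
Qed.

Let J_U A B i : measurable (A : set LT) -> measurable (B : set LT) -> A `&` B = set0 ->
  J (A `|` B) i = J A i + J B i.
Proof.
move=> mA mB AB; rewrite -LID; [|exact: mD|exact: Ji|exact: Ji].
apply: eq_LI => t _; rewrite -mulrDl; congr (_ * _).
rewrite !indicE in_setU; have [tA|] := boolP (t \in A); have [tB|] := boolP (t \in B) => /=; rewrite ?addr0 ?add0r//.
have h : (A `&` B) t by split; exact: set_mem.
by rewrite AB in h.
Qed.

Let J_set0 i : J set0 i = 0.
Proof. by rewrite /J -[RHS](LI0 D); apply: eq_LI => t _; rewrite indic0 mul0r. Qed.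

Let J_setT i : J setT i = LI D (v i).
Proof. by apply: eq_LI => t _; rewrite indicT mul1r. Qed.

Let J_ray t i : J `]-oo, t] i = LI `[a, clamp a b t] (v i).
Proof.
rewrite /J LI_indic; have [ta|ta] := ltP t a.
  rewrite (_ : `[a, b] `&` `]-oo, t] = set0); last first.
    apply/seteqP; split => // s [/=]; rewrite !in_itv/= => /andP[h1 _] h2.
    by have := lt_le_trans ta h1; rewrite ltNge h2.
  rewrite (_ : clamp a b t = a); last by rewrite /clamp max_l// ge_min (ltW ta) orbT.
  rewrite set_itv1 LI_set1 -(LI0 set0); exact: eq_LI.
congr LI; apply/seteqP; split => s /=; rewrite !in_itv/= /clamp.
  by move=> [/andP[h1 h2] h3]; rewrite h1/= le_max le_min h2 h3 orbT.
move=> /andP[h1]; rewrite (max_r _) ?le_min ?ab//.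
by move=> /andP[h2 h3]; rewrite h1 h2.
Qed.

Let mray t : measurable (`]-oo, t] : set LT).
Proof. exact: itv_Lmeasurable. Qed.

Let J_union (F : nat -> set R) n i : (forall k, measurable (F k : set LT)) ->
  trivIset setT F -> J (\bigcup_k F k) i =
    \sum_(k < n) J (F k) i + J (\bigcup_k F k `\` \bigcup_(k < n) F k) i.
Proof.
move=> mF tF.
have mB m : measurable (\bigcup_(k < m) F k : set LT) by exact: bigcup_measurable.
have JB m : J (\bigcup_(k < m) F k) i = \sum_(k < m) J (F k) i.
  elim: m => [|m IH]; first by rewrite bigcup_mkord !big_ord0 J_set0.
  rewrite big_ord_recr/= -IH -J_U//.
    by rewrite !bigcup_mkord big_ord_recr.
  apply/seteqP; split => // t [[k /= km Fk] Fm].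
  have /trivIsetP/(_ k m Logic.I Logic.I) := tF; rewrite neq_ltn km/= => /(_ isT) e.
  by have : (F k `&` F m) t by []; rewrite e.
rewrite -JB -J_U//.
- by rewrite setDUK//; apply: bigcup_sub => k _; exact: bigcup_sup.
- by apply: measurableD; [exact: bigcupT_measurable|].
- by rewrite setDIK.
Qed.

Let cvg_sumJ (F : nat -> set R) n : (forall k, cvgn (J (F k))) ->
  (\sum_(k < n) J (F k) i) @[i --> \oo] --> \sum_(k < n) limn (J (F k)).
Proof.
move=> cF; elim: n => [|n IH].
  by under eq_fun do rewrite big_ord0; rewrite big_ord0; exact: cvg_cst.
under eq_fun do rewrite big_ord_recr/=; rewrite big_ord_recr/=.
by apply: cvgD => //; exact: cF.
Qed.

(** Dynkin induction from half-open intervals, where convergence is [cvX]. For disjoint unions,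
    finite sums approximate uniformly in i by [J_tail], so [cvg_approx] applies. *)
Let J_cvg_borel (A : set R) : measurable (A : set (measurableTypeR R)) -> cvgn (J A).
Proof.
move=> mA; apply: (@dynkin_induction _ (measurableTypeR R) (@ocitv R) (fun A => cvgn (J A)) erefl
  (@ocitvI R) _ _ _ _ A mA).
- rewrite (_ : J setT = fun i => LI D (v i)); last by apply/funext => i; rewrite J_setT.
  by apply: cvX; rewrite ab lexx.
- move=> _ [[s t] _ <-] /=; have [st|ts] := leP s t; last first.
    rewrite set_itv_ge ?bnd_simp -?leNgt ?ltW//.
    rewrite (_ : J set0 = fun=> 0); last by apply/funext => i; rewrite J_set0.
    exact: is_cvg_cst.
  have e : `]-oo, t]%classic = `]-oo, s]%classic `|` `]s, t]%classic :> set R.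
    apply/seteqP; split => r /=; rewrite !in_itv/=; last by case=> [/le_trans|/andP[]//]; apply.
    by move=> rt; have [rs|sr] := leP r s; [left|right; rewrite rt].
  have -> : J `]s, t] = fun i => LI `[a, clamp a b t] (v i) - LI `[a, clamp a b s] (v i).
    apply/funext => i; rewrite -!J_ray e J_U.
    - by rewrite addrAC subrr add0r.
    - exact: mray.
    - exact: itv_Lmeasurable.
    - apply/seteqP; split => // r [/=]; rewrite !in_itv/= => h1 /andP[h2 _].
      by move: (lt_le_trans h2 h1); rewrite ltxx.
  by apply: is_cvgB; apply: cvX; exact: clamp_itv.
- move=> S mS cS; have mS' := borel_Lmeasurable mS.
  have -> : J (~` S) = fun i => LI D (v i) - J S i.
    apply/funext => i; rewrite -J_setT -(setUv S) J_U.
    - by rewrite addrAC subrr add0r.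
    - exact: mS'.
    - exact: measurableC.
    - exact: setICr.
  by apply: is_cvgB; [apply: cvX; rewrite ab lexx|exact: cS].
- move=> F mF tF cF; have mF' k := borel_Lmeasurable (mF k).
  apply: cvg_approx => e e0.
  have /cvgrPdist_le/(_ _ e0)[n _ /(_ n (leqnn n))/= hn] := J_tail mF' tF.
  exists (fun i => \sum_(k < n) J (F k) i); split.
    by apply/cvg_ex; exists (\sum_(k < n) limn (J (F k))); exact: cvg_sumJ.
  move=> i; rewrite (J_union n i mF' tF) addrAC subrr add0r.
  apply: le_trans (J_dom _ _) _.
    by apply: measurableD; [exact: bigcupT_measurable|exact: bigcup_measurable].
  by move: hn; rewrite sub0r normrN; apply: le_trans; exact: ler_norm.
Qed.

Let J_cvg (A : set R) : measurable (A : set LT) -> cvgn (J A).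
Proof.
move=> mA; have [B [N [mB mN N0 [BA ABN]]]] := Lmeasurable_borelU mA.
suff -> : J A = J B by exact: J_cvg_borel.
apply/funext => i; apply: Lae_LI => //; last exact: Ji.
exists N; split; [exact: borel_Lmeasurable|exact: N0|].
move=> t /= nh; apply: contrapT => Nt; apply: nh => _; congr (_ * _).
rewrite !indicE; have [tB|tB] := boolP (t \in B).
  by rewrite mem_set//; apply: BA; exact: set_mem.
by rewrite memNset// => /ABN[Bt|//]; move/negP: tB; apply; exact: mem_set.
Qed.

Let nu (A : set LT) : \bar R := (limn (J A))%:E.

Let nu0 : nu set0 = 0%E.
Proof.
rewrite /nu (_ : J set0 = fun=> 0); last by apply/funext => i; rewrite J_set0.
by rewrite lim_cst.
Qed.

Let nu_fin (A : set LT) : measurable A -> nu A \is a fin_num.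
Proof. by []. Qed.

(** The partial sums are the value on the union minus the value on the tail, and the bound of
    [J_tail] survives the limit in i. *)
Let nu_sigma : semi_sigma_additive nu.
Proof.
move=> F mF tF mU.
have mT n : measurable (\bigcup_k F k `\` \bigcup_(k < n) F k : set LT).
  by apply: measurableD => //; exact: bigcup_measurable.
have cF k : cvgn (J (F k)) by exact: J_cvg.
have -> : (fun n => (\sum_(0 <= i < n) nu (F i))%E) =
    (fun n => (limn (J (\bigcup_k F k)) - limn (J (\bigcup_k F k `\` \bigcup_(k < n) F k)))%:E).
  apply/funext => n; rewrite big_mkord sumEFin; congr (_%:E).
  apply/eqP; rewrite eq_sym subr_eq; apply/eqP; apply/cvg_lim => //.
  have -> : J (\bigcup_k F k) = (fun i => \sum_(k < n) J (F k) i + J (\bigcup_k F k `\` \bigcup_(k < n) F k) i).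
    by apply/funext => i; rewrite (J_union n i mF tF).
  by apply: cvgD; [exact: cvg_sumJ|exact: J_cvg].
apply: cvg_EFin; first exact: nearW.
rewrite -[X in _ --> X]subr0; apply: cvgB; first exact: cvg_cst.
apply/cvgrPdist_le => e e0; have /cvgrPdist_le/(_ _ e0) := J_tail mF tF.
apply: filterS => n /=; rewrite !sub0r !normrN => /(le_trans (ler_norm _)) h.
have cT := J_cvg (mT n).
have nT : `|J (\bigcup_k F k `\` \bigcup_(k < n) F k) i| @[i --> \oo] -->
    `|limn (J (\bigcup_k F k `\` \bigcup_(k < n) F k))| by exact: cvg_norm.
rewrite -(cvg_lim _ nT)//; apply: limr_le; first by apply/cvg_ex; eexists; exact: nT.
by apply: nearW => i; exact: le_trans (J_dom _ _) h.
Qed.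

HB.instance Definition _ := isCharge.Build _ LT R nu nu0 nu_fin nu_sigma.

Let nu_dom : nu `<< mu.
Proof.
apply/null_content_dominatesP => A mA A0.
rewrite /nu (_ : J A = fun=> 0) ?lim_cst//.
apply/funext => i; rewrite -(LI0 D); apply: Lae_LI => //; last exact: Ji.
exists A; split => // t /= nh; apply: contrapT => At; apply: nh => _.
by rewrite indicE memNset// mul0r.
Qed.

(** The limits of the integrals over A define a charge dominated by Lebesgue measure; its
    Radon-Nikodym density is the weak limit. *)
Lemma weak_limit : exists2 xi, Lintegrable D xi &
  forall A, measurable (A : set LT) ->
    LI D (fun t => \1_A t * v i t) @[i --> \oo] --> LI D (fun t => \1_A t * xi t).
Proof.
pose f0 := Radon_Nikodym nu mu; pose xi := fine \o f0.
have f0E : f0 = EFin \o xi.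
  by apply/funext => t; rewrite /xi /= fineK//; exact: Radon_Nikodym_fin_num.
have f0i : mu.-integrable [set: LT] (EFin \o xi) by rewrite -f0E; exact: Radon_Nikodym_integrable.
have xiD : Lintegrable D xi by exact: integrableS f0i.
exists xi => // A mA.
have mDA : measurable (D `&` A : set LT) by exact: measurableI.
have e : limn (J (D `&` A)) = LI (D `&` A) xi.
  apply: EFin_inj; rewrite -(LI_E _ mDA); last exact: integrableS f0i.
  have := Radon_Nikodym_integral nu_dom mDA; rewrite -/f0 f0E => <-.
  by [].
rewrite LI_indic -e.
have <- : J (D `&` A) = fun i => LI D (fun t => \1_A t * v i t).
  apply/funext => i; apply: eq_LI => t Dt; congr (_ * _).
  by rewrite !indicE in_setI (mem_set Dt).
exact: J_cvg.
Qed.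

End WeakLimit.

(** * The value function as a Lagrange problem *)

Section RationalVectors.
Context {R : realType} {n : nat}.

Definition qvec (k : nat) : 'rV[R]_n :=
  map_mx ratr (odflt 0 (unpickle k : option 'rV[rat]_n)).

Lemma qvec_dense (p : 'rV[R]_n) e : 0 < e -> exists k, enorm (qvec k - p) <= e.
Proof.
move=> e0; have d0 : 0 < e / n.+1%:R by rewrite divr_gt0// ltr0n.
have h j : {q : rat | `|ratr q - p 0 j| <= e / n.+1%:R}.
  have pe : p 0 j < p 0 j + e / n.+1%:R by rewrite ltrDl.
  apply: cid; have [q] := rat_in_itvoo pe.
  rewrite in_itv/= => /andP[h1 h2]; exists q; rewrite ger0_norm ?subr_ge0 ?(ltW h1)//.
  by rewrite lerBlDl ltW.
exists (pickle (\row_j sval (h j))); rewrite /qvec pickleK/=.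
rewrite (le_trans (enorm_le_sum _))//.
apply: (@le_trans _ _ (\sum_(j < n) e / n.+1%:R)).
  by apply: ler_sum => j _; rewrite !mxE; exact: (svalP (h j)).
rewrite sumr_const card_ord -(mulr_natl (e / _)) mulrCA ler_piMr ?(ltW e0)//.
by rewrite ler_pdivrMr ?ltr0n// mul1r ler_nat.
Qed.

End RationalVectors.

Section EpigraphBounds.
Context {R : realType} {n : nat}.
Variables (T : R) (c : R -> R) (H : R -> 'rV[R]_n -> 'rV[R]_n -> R).
Hypotheses (h3 : H3 T H) (h4 : H4 T c H).

Lemma epiE_nonemptyH t x : t \in `[0, T] -> epiE H t x !=set0.
Proof.
move=> tT; apply: (@epiE_nonempty _ _ _ _ _ (c t * (1 + enorm x))).
  by move=> p q lam; exact: h3.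
by move=> p q; exact: h4.
Qed.

(** H grows in p at rate at most c t (1 + |x|), so a larger velocity would break the constraint at a
    large multiple of some p. *)
Lemma epiE_velocity t x a : t \in `[0, T] -> 0 <= c t -> epiE H t x a ->
  enorm (lsubmx a) <= c t * (1 + enorm x).
Proof.
move=> tT c0 /epiEP Ea; set C := c t * (1 + enorm x).
have C0 : 0 <= C by rewrite mulr_ge0// addr_ge0// enorm_ge0.
apply: enorm_le_dotr => // p; rewrite leNgt; apply/negP => h.
have gap : 0 < dotr (lsubmx a) p - C * enorm p by rewrite subr_gt0.
pose B := `|rsubmx a 0 0| + `|H t x 0| + 1.
pose s := B / (dotr (lsubmx a) p - C * enorm p).
have B0 : 0 < B by rewrite ltr_wpDl// addr_ge0.
have s0 : 0 < s by rewrite divr_gt0.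
have := Ea (s *: p); rewrite dotrZr.
have := h4 tT x (s *: p) 0; rewrite subr0 enormZ (gtr0_norm s0) -/C => h5.
have : s * (dotr (lsubmx a) p - C * enorm p) = B by rewrite divfK// gt_eqF.
have := ler_norm (H t x (s *: p) - H t x 0); have := ler_norm (H t x 0).
have := ler_norm (rsubmx a 0 0); rewrite /B; lra.
Qed.

Lemma epiE_cost_lb t x a : epiE H t x a -> - H t x 0 <= rsubmx a 0 0.
Proof. by move=> /epiEP/(_ 0); rewrite dotr0 sub0r. Qed.

(** Both sides of the constraint are Lipschitz in p, so rational p suffice. Countably many
    constraints allow exceptional null sets to be united and projections to be measurable. *)
Lemma epiE_qvec t x a : t \in `[0, T] ->
  (forall k, dotr (lsubmx a) (qvec k) - H t x (qvec k) <= rsubmx a 0 0) -> epiE H t x a.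
Proof.
move=> tT h; apply/epiEP => p; apply/ler_addgt0Pr => e e0.
pose C := enorm (lsubmx a) + `|c t * (1 + enorm x)| + 1.
have C0 : 0 < C by rewrite ltr_wpDl// addr_ge0// enorm_ge0.
have [k hk] := @qvec_dense R n p _ (divr_gt0 e0 C0).
have := h k; have := h4 tT x (qvec k) p => h5.
have := ler_norm (H t x (qvec k) - H t x p).
have h6 := dotr_le (lsubmx a) (p - qvec k); rewrite dotrBr enormBC in h6.
have h7 := ler_wpM2r (enorm_ge0 (qvec k - p)) (ler_norm (c t * (1 + enorm x))).
have : enorm (qvec k - p) * C <= e by rewrite -ler_pdivlMr.
have := enorm_ge0 (qvec k - p); rewrite /C; nra.
Qed.

Lemma HLC0 k m0 r t x : HLC T k H -> (forall t, t \in `[0, T] -> `|H t 0 0| <= m0 t) ->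
  0 < r -> t \in `[0, T] -> enorm x <= r -> 0 <= k r t -> `|H t x 0| <= m0 t + k r t * r.
Proof.
move=> hl hm r0 tT xr k0.
have := hl r r0 t tT x 0 0 xr; rewrite enorm0 addr0 mulr1 subr0 => /(_ (ltW r0)) h.
have := ler_wpM2l k0 xr; have := hm t tT.
have := ler_distD 0 (H t x 0) 0.
have := ler_normD (H t x 0 - H t 0 0) (H t 0 0); rewrite subrK; lra.
Qed.

End EpigraphBounds.

(* The controls of the Steiner representation are replaced by the points a = (x', r) of the epigraph
   themselves; membership is required at every t, not only almost everywhere. *)
Definition admissible {R : realType} {n : nat} (H : R -> 'rV[R]_n -> 'rV[R]_n -> R)
    (t0 T : R) (x : R -> 'rV[R]_n) (a : R -> 'rV[R]_(n + 1)) : Prop :=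
  [/\ forall j, Lintegrable `[t0, T] (fun t => a t 0 j),
      forall t, t0 <= t <= T -> epiE H t (x t) (a t) &
      forall t j, t0 <= t <= T ->
        x t 0 j = x t0 0 j + LI `[t0, t] (fun s => lsubmx (a s) 0 j)].

Section AlmostEverywhere.
Context {R : realType}.
Local Notation mu := (@completed_lebesgue_measure R).
Local Notation LT := (LebT R).

Lemma Lae_forall (I : finType) (P : I -> R -> Prop) :
  (forall i, {ae mu, forall t : LT, P i t}) -> {ae mu, forall t : LT, forall i, P i t}.
Proof. by apply: filter_forall; exact: (@ae_filter_ringOfSetsType _ LT R mu). Qed.

Lemma Lae_neq (r : R) : {ae mu, forall t : LT, t != r}.
Proof.
exists [set r]; split.
- by apply: borel_Lmeasurable; exact: measurable_set1.
- exact: lebesgue_measure_set1.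
- by move=> t /= /negP; rewrite negbK => /eqP.
Qed.

Lemma derive_near_shift (f F : R -> R) (r d t : R) : (\forall y \near t, r + F y = f y) ->
  derivable F t 1 -> 'D_1 F t = d -> derivable f t 1 /\ 'D_1 f t = d.
Proof.
move=> nf dF DF; have dc : derivable (fun=> r) t 1 by exact: derivable_cst.
have d2 : derivable (fun y => r + F y) t 1 by exact: derivableD.
split; first exact: near_eq_derivable nf d2.
rewrite -(near_eq_derive _ nf)//.
by rewrite (deriveD dc dF) derive_cst add0r.
Qed.

(* The measure is complete, so an a.e. limit of measurable functions is measurable. *)
Lemma Lmeasurable_cvg_ae (D : set R) (f_ : nat -> R -> R) (f : R -> R) : measurable (D : set LT) ->
  (forall i, measurable_fun (D : set LT) (f_ i)) ->
  {ae mu, forall t : LT, D t -> f_ i t @[i --> \oo] --> f t} -> measurable_fun (D : set LT) f.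
Proof.
move=> mD mf_ [Z [mZ Z0 hZ]].
have mZC : measurable (~` Z : set LT) by exact: measurableC.
apply: (@Lae_measurable _ D (fun t => \1_(~` Z) t * f t)).
  exists Z; split => // t /= nh; apply: contrapT => nZ; apply: nh => _.
  by rewrite indicE mem_set// mul1r.
apply: (@measurable_fun_cvg _ LT R D (fun i t => \1_(~` Z) t * f_ i t)).
  by move=> i; apply: measurable_funM; [exact: Lmeasurable_indic|exact: mf_].
move=> t Dt; have [Zt|nZ] := pselect (Z t).
  rewrite indicE memNset ?mul0r; last by apply.
  by under eq_fun do rewrite mul0r; exact: cvg_cst.
rewrite indicE mem_set// mul1r; under eq_fun do rewrite mul1r.
by apply: contrapT => h; apply: nZ; apply: hZ => /= h2; apply: h; exact: h2.
Qed.

(** Almost everywhere h is the limit of the difference quotients of step 1 / (i + 1) of the clamped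
    function, which are continuous. In [value_lt] this makes the velocity measurable. *)
Lemma Lmeasurable_derive (a b : R) (G h : R -> R) : a <= b -> ucont a b G ->
  {ae mu, forall t : LT, a < t < b -> derivable G t 1 /\ 'D_1 G t = h t} ->
  measurable_fun (`[a, b]%classic : set LT) h.
Proof.
move=> ab uG Gh; pose Gc t := G (clamp a b t).
have cGc : continuous Gc by exact: ucont_clamp.
pose e (i : nat) : R := i.+1%:R^-1.
have e0 i : e i != 0 by rewrite invr_neq0// pnatr_eq0.
apply: (@Lmeasurable_cvg_ae _ (fun i t => (e i)^-1 * (Gc (e i + t) - Gc t))).
- exact: itv_Lmeasurable.
- move=> i; apply: measurable_funTS; apply: Lmeasurable_borel_fun; apply: continuous_measurable_fun.
  move=> t; apply: cvgM; first exact: cvg_cst.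
  apply: cvgB; last exact: cGc.
  apply: (@continuous_comp _ _ _ (fun t => e i + t) Gc); last exact: cGc.
  by apply: cvgD; [exact: cvg_cst|exact: cvg_id].
- apply: (LaeS2 Gh (LaeS2 (Lae_neq a) (Lae_neq b) (fun t h1 h2 => conj h1 h2))).
  move=> t H [ta tb]; rewrite /= in_itv/= => /andP[at_ tb'].
  have atb : a < t < b by rewrite !lt_neqAle at_ tb' tb eq_sym ta.
  have [dG DG] := H atb; have /andP[at1 tb1] := atb.
  have cv : r^-1 *: (G (r *: 1 + t) - G t) @[r --> 0^'] --> h t by rewrite -DG; exact: dG.
  have ce : e i @[i --> \oo] --> 0^'.
    move=> A A0; have : \forall i \near \oo, e i != 0 -> A (e i) by exact: (cvg_harmonic A0).
    by apply: filterS => i; apply; exact: e0.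
  have := cvg_comp _ _ ce cv; apply: cvg_trans; apply: near_eq_cvg.
  near=> i; rewrite /= /GRing.scale/= mulr1 /Gc !clamp_id ?at_ ?tb'//.
  have ei0 : 0 < e i by rewrite invr_gt0.
  rewrite (le_trans at_) ?lerDr ?(ltW ei0)//= -lerBrDr ltW//; near: i.
  have := cvgr_lt _ (@cvg_harmonic R); apply.
  by rewrite subr_gt0.
Unshelve. all: by end_near. Qed.

End AlmostEverywhere.

Section Value.
Context {R : realType} {n : nat}.
Local Notation mu := (@completed_lebesgue_measure R).
Local Notation LT := (LebT R).
Variable sg : probability (@BorelRV R (n + 1)) R.
Hypothesis sgS : sphere_measure sg.
Implicit Types (H : R -> 'rV[R]_n -> 'rV[R]_n -> R) (x : R -> 'rV[R]_n)
  (a : R -> 'rV[R]_(n + 1)) (g : 'rV[R]_n -> \bar R).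

Definition cost (t0 T : R) a := LI `[t0, T] (fun t => rsubmx (a t) 0 0).

Lemma admissible_vel H t0 T x a j : admissible H t0 T x a ->
  Lintegrable `[t0, T] (fun t => lsubmx (a t) 0 j).
Proof.
move=> [ai _ _]; rewrite (_ : (fun t => _) = fun t => a t 0 (lshift 1 j)); first exact: ai.
by apply/funext => t; rewrite mxE.
Qed.

Lemma admissible_cost H t0 T x a : admissible H t0 T x a ->
  Lintegrable `[t0, T] (fun t => rsubmx (a t) 0 0).
Proof.
move=> [ai _ _]; rewrite (_ : (fun t => _) = fun t => a t 0 (rshift n 0)); first exact: ai.
by apply/funext => t; rewrite mxE.
Qed.

Lemma abs_cont_coord (a b : R) x : (forall j, acont a b (fun t => x t 0 j)) -> abs_cont a b x.
Proof.
move=> acx e e0; have e1 : 0 < e / n.+1%:R by rewrite divr_gt0// ltr0n.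
have /choice[d hd] : forall j, exists d, 0 < d /\
  forall (N : nat) (u v : nat -> R),
      (forall i, (i < N)%N -> a <= u i /\ u i <= v i /\ v i <= b) ->
      (forall i j, (i < N)%N -> (j < N)%N -> i <> j -> v i <= u j \/ v j <= u i) ->
      \sum_(i < N) (v i - u i) < d ->
      \sum_(i < N) `|x (v i) 0 j - x (u i) 0 j| < e / n.+1%:R.
  by move=> j; have [d d0 h] := acx j _ e1; exists d.
exists (\big[Num.min/1]_j d j).
  by apply/bigmin_gtP; split => // j _; exact: (hd j).1.
move=> N u v uv dis /bigmin_gtP[_ sN].
apply: (@le_lt_trans _ _ (\sum_(j < n) \sum_(i < N) `|x (v i) 0 j - x (u i) 0 j|)).
  rewrite exchange_big; apply: ler_sum => i _; rewrite (le_trans (enorm_le_sum _))//.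
  by apply: ler_sum => j _; rewrite !mxE.
apply: (@le_lt_trans _ _ (\sum_(j < n) e / n.+1%:R)).
  by apply: ler_sum => j _; apply: ltW; exact: ((hd j).2 N u v uv dis (sN j isT)).
rewrite sumr_const card_ord -(mulr_natl (e / _)) mulrCA gtr_pMr//.
by rewrite ltr_pdivrMr ?ltr0n// mul1r ltr_nat.
Qed.

(** The control is [a] itself, which the Steiner map fixes; derivatives come from [LFTC1] in each
    coordinate, the two end points being a null set. *)
Lemma value_le H g t0 T x a : t0 <= T -> admissible H t0 T x a ->
  (valuef T g (steinerF sg H) (steinerL sg H) t0 (x t0) <= g (x T) + (cost t0 T a)%:E)%E.
Proof.
move=> t0T adm; have [ai Ea xE] := adm.
apply: ereal_inf_lbound; exists (x, a) => /=; last first.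
  congr (_ + _)%E; rewrite -LintegralE; [|exact: admissible_cost adm|exact: itv_Lmeasurable].
  apply: eq_integral => t /set_mem/=; rewrite in_itv/= => tt.
  by rewrite /steinerL steinerFL_id//; exact: Ea.
have vi j := admissible_vel j adm.
split => //=.
- apply: abs_cont_coord => j e e0.
  have [d d0 hd] := LI_acont (vi j) e0; exists d => // N u v uv dis sN.
  have := hd N u v uv dis sN; apply: le_lt_trans; apply: ler_sum => i _.
  have [h1 [h2 h3]] := uv i (ltn_ord i).
  rewrite (xE (v i)) ?h3 ?(le_trans h1)// (xE (u i)) ?h1 ?(le_trans h2)//.
  by rewrite opprD addrACA subrr add0r.
- have aeall := Lae_forall (fun j => LFTC1 (vi j)).
  have aeend := LaeS2 (Lae_neq t0) (Lae_neq T) (fun t h1 h2 => conj h1 h2).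
  apply: (LaeS2 aeall aeend) => t h [tt0 tT]; rewrite in_itv/= => /andP[t0t tT'].
  have tin : t0 < t < T by rewrite !lt_neqAle t0t tT' tT eq_sym tt0.
  have /andP[t0t1 tT1] := tin.
  have near_x j : \forall y \near t, x t0 0 j + LI `[t0, y] (fun s => lsubmx (a s) 0 j) = x y 0 j.
    near=> y; rewrite (xE y)//; apply/andP; split; apply: ltW; near: y.
      exact: lt_nbhsr.
    exact: lt_nbhsl.
  have dx j : derivable (fun y => x y 0 j) t 1 /\ 'D_1 (fun y => x y 0 j) t = lsubmx (a t) 0 j.
    by have [d1 D1] := h j tin; exact: derive_near_shift (near_x j) d1 D1.
  have dX : derivable x t 1.
    by apply/derivable_mxP => i j; rewrite ord1; exact: (dx j).1.
  split => //; rewrite derive_mx//; apply/rowP => j; rewrite mxE.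
  rewrite (dx j).2 /steinerF steinerFL_id//; apply: Ea.
  by rewrite t0t tT'.
Unshelve. all: by end_near. Qed.

End Value.

Fixpoint runmax {R : realType} (w : nat -> R -> R) (N : nat) (t : R) : R :=
  if N is N'.+1 then Num.max (runmax w N' t) (w N t) else w 0%N t.

Section Envelope.
Context {R : realType}.
Local Notation mu := (@completed_lebesgue_measure R).
Local Notation LT := (LebT R).
Implicit Types (D A : set R) (w : nat -> R -> R).

Lemma runmax_le w N t r : (forall k, w k t <= r) -> runmax w N t <= r.
Proof. by move=> h; elim: N => //= N IH; rewrite ge_max IH h. Qed.

Lemma runmax_ge w k N t : (k <= N)%N -> w k t <= runmax w N t.
Proof.
elim: N => [|N IH]; first by rewrite leqn0 => /eqP->.
by rewrite leq_eqVlt => /orP[/eqP->|/IH h]; rewrite /= le_max ?lexx ?h ?orbT.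
Qed.

Lemma Lintegrable_runmax a b w N : (forall k, Lintegrable `[a, b] (w k)) ->
  Lintegrable `[a, b] (runmax w N).
Proof.
move=> wi; elim: N => [|N IH] /=; first exact: wi.
rewrite (_ : (fun t => _) = fun t => 2^-1 * (runmax w N t + w N.+1 t + `|runmax w N t - w N.+1 t|)).
  apply: rintegrableZ; first exact: itv_Lmeasurable.
  apply: rintegrableD; [exact: itv_Lmeasurable|apply: rintegrableD|apply: Rintegrable_norm].
  - exact: itv_Lmeasurable.
  - exact: IH.
  - exact: wi.
  - apply: rintegrableB; [exact: itv_Lmeasurable|exact: IH|exact: wi].
by apply/funext => t; rewrite maxr_absE mulrC.
Qed.

(** Monotone convergence for the running maxima, made nonnegative by subtracting [w 0]. The bound K
    makes the supremum finite almost everywhere; elsewhere [fine] replaces it by 0, which is why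
    domination holds almost everywhere only. *)
Lemma sup_envelope a b w K : (forall k, Lintegrable `[a, b] (w k)) ->
  (forall N, LI `[a, b] (runmax w N) <= K) ->
  exists2 L, Lintegrable `[a, b] L &
    LI `[a, b] L <= K /\ {ae mu, forall t : LT, a <= t <= b -> forall k, w k t <= L t}.
Proof.
move=> wi wK; set D := `[a, b]%classic; have mD : measurable (D : set LT) := itv_Lmeasurable _.
have ri N := Lintegrable_runmax N wi.
pose g N t := (runmax w N t - w 0%N t)%:E.
have gi N : Lintegrable D (fun t => runmax w N t - w 0%N t).
  by apply: rintegrableB; [exact: mD|exact: ri|exact: wi].
have g0 N t : D t -> (0 <= g N t)%E by move=> _; rewrite lee_fin subr_ge0 runmax_ge.
have mg N : measurable_fun (D : set LT) (g N).
  exact: (measurable_int _ (gi N)).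
have ndg t : D t -> {homo g^~ t : n m / (n <= m)%N >-> (n <= m)%E}.
  move=> _; apply/nondecreasing_seqP => N; rewrite lee_fin lerB//=.
  by rewrite le_max lexx.
have cvG := @cvg_monotone_convergence _ LT R mu D mD g mg g0 ndg.
pose G (t : LT) := limn (g^~ t).
have gG N t : D t -> (g N t <= G t)%E.
  move=> Dt; apply: (lime_ge (ereal_nondecreasing_is_cvgn (ndg t Dt))).
  by exists N => // m /= Nm; exact: ndg.
have G0 t : D t -> (0 <= G t)%E by move=> Dt; exact: (le_trans (g0 0%N t Dt) (gG _ _ Dt)).
have mG : measurable_fun (D : set LT) G.
  by apply: emeasurable_fun_cvg mg _ => t Dt; exact: ereal_nondecreasing_is_cvgn (ndg t Dt).
have IG : (\int[mu]_(t in (D : set LT)) G t <= (K - LI D (w 0%N))%:E)%E.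
  rewrite -(cvg_lim _ cvG)//; apply: lime_le; first by apply/cvg_ex; eexists; exact: cvG.
  near=> N; rewrite (LI_E (gi N) mD) lee_fin (LIB mD (ri N) (wi 0%N)).
  by rewrite lerB.
have iG : mu.-integrable (D : set LT) G.
  apply/integrableP; split; first exact: mG.
  apply: le_lt_trans (ltry (K - LI D (w 0%N))); apply: le_trans IG.
  by apply: le_integral_nomeas => t Dt; rewrite gee0_abs; [exact: lexx|exact: G0].
have Gf := integrable_ae mD iG.
have ifG : Lintegrable D (fun t => fine (G t)).
  apply/integrableP; split.
    by apply/measurable_EFinP; exact: measurableT_comp.
  have /integrableP[_] := iG; apply: le_lt_trans; apply: le_integral_nomeas => t Dt.
  by case: (G t) => [r||] /=; rewrite ?normr0 ?leey ?lexx.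
exists (fun t => fine (G t) + w 0%N t); first exact: (rintegrableD mD ifG (wi 0%N)).
split.
  rewrite (LID mD ifG (wi 0%N)) -lerBrDr -lee_fin -(LI_E ifG mD).
  apply: le_trans IG; apply: le_integral_nomeas => t Dt.
  by have := G0 t Dt; case: (G t) => //= _; exact: leey.
apply: (LaeS Gf) => t h tab k; have Dt : D t by rewrite /D /= in_itv.
have := gG k t Dt; rewrite -lerBlDr -lee_fin fineK; last exact: h.
by apply: le_trans; rewrite lee_fin lerB// runmax_ge.
Unshelve. all: by end_near. Qed.

End Envelope.

Section Value.
Context {R : realType} {n : nat}.
Local Notation mu := (@completed_lebesgue_measure R).
Local Notation LT := (LebT R).
Implicit Types (H : R -> 'rV[R]_n -> 'rV[R]_n -> R) (x v : R -> 'rV[R]_n)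
  (a : R -> 'rV[R]_(n + 1)) (g : 'rV[R]_n -> \bar R).

(** Where membership fails, a null set of times, the pair (v, r) is replaced by any point of the
    nonempty epigraph; no integral changes. *)
Lemma admissible_ae H t0 T x v (r : R -> R) : t0 <= T ->
  (forall t, t0 <= t <= T -> epiE H t (x t) !=set0) ->
  (forall j, Lintegrable `[t0, T] (fun t => v t 0 j)) -> Lintegrable `[t0, T] r ->
  {ae mu, forall t : LT, t0 <= t <= T -> epiE H t (x t) (row_mx (v t) (const_mx (r t)))} ->
  (forall t j, t0 <= t <= T -> x t 0 j = x t0 0 j + LI `[t0, t] (fun s => v s 0 j)) ->
  exists2 a, admissible H t0 T x a & cost t0 T a = LI `[t0, T] r.
Proof.
move=> t0T E0 vi ri aeE xE; have mD : measurable (`[t0, T]%classic : set LT) := itv_Lmeasurable _.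
pose a1 t : 'rV[R]_(n + 1) := row_mx (v t) (const_mx (r t)).
have /choice[a ha] : forall t, exists e, (epiE H t (x t) (a1 t) -> a1 t = e) /\
    (t0 <= t <= T -> epiE H t (x t) e).
  move=> t; have [h|h] := pselect (epiE H t (x t) (a1 t)); first by exists (a1 t).
  have [tt|tt] := pselect (t0 <= t <= T); last by exists 0.
  by have [e Ee] := E0 t tt; exists e.
have aE : {ae mu, forall t : LT, t0 <= t <= T -> a1 t = a t}.
  by apply: (LaeS aeE) => t h tt; apply: (ha t).1; exact: h.
have aEj j : {ae mu, forall t : LT, `[t0, T]%classic t -> a1 t 0 j = a t 0 j}.
  by apply: (LaeS aE) => t h; rewrite /= in_itv/= => tt; rewrite h.
have rE : {ae mu, forall t : LT, `[t0, T]%classic t -> r t = rsubmx (a t) 0 0}.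
  apply: (LaeS aE) => t h; rewrite /= in_itv/= => tt.
  by rewrite -h// row_mxKr mxE.
have vE j : {ae mu, forall t : LT, t0 <= t <= T -> v t 0 j = lsubmx (a t) 0 j}.
  by apply: (LaeS aE) => t h tt; rewrite -h// row_mxKl.
exists a; last by rewrite /cost (Lae_LI mD rE ri).
split.
- move=> j; apply: (Lae_integrable mD (aEj j)).
  rewrite -(splitK j); case: (fintype.split j) => s /=.
    rewrite (_ : (fun t => _) = fun t => v t 0 s); first exact: vi.
    by apply/funext => t; rewrite row_mxEl.
  rewrite (_ : (fun t => _) = r); first exact: ri.
  by apply/funext => t; rewrite row_mxEr mxE.
- by move=> t tt; exact: (ha t).2.
- move=> t j tt; rewrite xE//; congr (_ + _); apply: Lae_LI; first exact: itv_Lmeasurable.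
    apply: (LaeS (vE j)) => s h; rewrite /= in_itv/= => /andP[s1 s2]; apply: h.
    by rewrite s1 (le_trans s2)//; case/andP: tt.
  have /andP[tt1 tt2] := tt.
  exact: (LintegrableS _ tt2 (vi j)).
Qed.

Lemma ucont_bounded (a b : R) (G : R -> R) : a <= b -> ucont a b G ->
  exists M, forall t, a <= t <= b -> G t <= M.
Proof.
move=> ab uG; have cG := ucont_clamp ab uG.
have [c _ hc] := EVT_max ab (continuous_subspaceT cG).
exists (G (clamp a b c)) => t tt; have := hc t; rewrite in_itv/= (clamp_id tt).
exact.
Qed.

Lemma ucont_enorm_bounded (a b : R) x : a <= b -> (forall j, ucont a b (fun t => x t 0 j)) ->
  exists2 M, 0 < M & forall t, a <= t <= b -> enorm (x t) <= M.
Proof.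
move=> ab ux; have uS : ucont a b (fun t => \sum_j `|x t 0 j|).
  by apply: ucont_sum => j; apply: ucont_norm; exact: ux.
have [M hM] := ucont_bounded ab uS; exists (`|M| + 1); first by rewrite ltr_wpDl.
move=> t tt; rewrite (le_trans (enorm_le_sum _))// (le_trans (hM t tt))//.
by rewrite (le_trans (ler_norm _))// lerDl.
Qed.

Lemma Lintegrable_dotr (D : set R) (f : R -> 'rV[R]_n) p : measurable (D : set LT) ->
  (forall j, Lintegrable D (fun t => f t 0 j)) -> Lintegrable D (fun t => dotr (f t) p).
Proof.
move=> mD fi; rewrite /dotr; apply: rintegrable_sum; first exact: mD.
move=> j _; rewrite (_ : EFin \o _ = EFin \o (fun t => p 0 j * f t 0 j)); last first.
  by apply/funext => t /=; rewrite mulrC.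
by apply: rintegrableZ; [exact: mD|exact: fi].
Qed.

Section NearOptimal.
Variables (T t0 : R) (c : R -> R) (k : R -> R -> R) (m0 : R -> R)
  (H : R -> 'rV[R]_n -> 'rV[R]_n -> R).
Hypotheses (ci : Lintegrable `[0, T] c) (c0 : forall t, t \in `[0, T] -> 0 <= c t).
Hypothesis ki : forall r : R, 0 < r ->
     Lintegrable `[0, T] (k r) /\ (forall t, t \in `[0, T] -> 0 <= k r t).
Hypotheses (h1 : H1 T H) (h2 : H2 T H) (h3 : H3 T H) (h4 : H4 T c H) (hl : HLC T k H).
Hypothesis m0i : Lintegrable `[0, T] m0.
Hypothesis hm : forall t, t \in `[0, T] -> `|H t 0 0| <= m0 t.
Hypotheses (t00 : 0 <= t0) (t0T : t0 <= T).

Lemma in0T t : t0 <= t <= T -> t \in `[0, T].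
Proof. by move=> /andP[h ?]; rewrite in_itv/=; apply/andP; split => //; exact: le_trans h. Qed.

Lemma H_continuous1 t (p : 'rV[R]_n) : t \in `[0, T] -> continuous ((H t)^~ p).
Proof.
move=> tT x; have xp : (y, p) @[y --> x] --> (x, p) by exact: (cvg_pair (@cvg_id _ (nbhs x)) (cvg_cst p)).
by have := cvg_comp _ _ xp (@h2 t tT (x, p)).
Qed.

Lemma H_traj_measurable x p : (forall j, ucont t0 T (fun t => x t 0 j)) ->
  measurable_fun (`[t0, T]%classic : set LT) (fun t => H t (x t) p).
Proof.
move=> ux; apply: (@caratheodory_measurable _ _ _ _ (fun t y => H t y p)); [exact: t0T| |  |exact: ux].
  move=> z; apply: measurable_funS (h1 z p); first exact: itv_Lmeasurable.
  by move=> t; rewrite /= in_itv/= => /in0T.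
by move=> t /in0T; exact: H_continuous1.
Qed.

Lemma H_traj_bound r t (x p : 'rV[R]_n) : 0 < r -> t \in `[0, T] -> enorm x <= r ->
  `|H t x p| <= m0 t + k r t * r + c t * (1 + r) * enorm p.
Proof.
move=> r0 tT xr; have hx0 := HLC0 hl hm r0 tT xr ((ki r0).2 t tT).
have := ler_normD (H t x p - H t x 0) (H t x 0); rewrite subrK.
have := h4 tT x p 0; rewrite subr0 => h5.
have h6 : c t * (1 + enorm x) * enorm p <= c t * (1 + r) * enorm p.
  by apply: ler_wpM2r; [exact: enorm_ge0|apply: ler_wpM2l; [exact: c0|rewrite lerD2l]].
lra.
Qed.

Lemma H_bound_integrable r q : 0 < r ->
  Lintegrable `[t0, T] (fun t => m0 t + k r t * r + c t * (1 + r) * q).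
Proof.
move=> r0; apply: (LintegrableS t00 (lexx T)).
have mD : measurable (`[0, T]%classic : set LT) := itv_Lmeasurable _.
apply: rintegrableD; [exact: mD|apply: rintegrableD|].
- exact: mD.
- exact: m0i.
- rewrite (_ : EFin \o _ = EFin \o (fun t => r * k r t)); last first.
    by apply/funext => t /=; rewrite mulrC.
  by apply: rintegrableZ; [exact: mD|exact: (ki r0).1].
- rewrite (_ : EFin \o _ = EFin \o (fun t => ((1 + r) * q) * c t)); last first.
    by apply/funext => t /=; rewrite -mulrA mulrC.
  by apply: rintegrableZ; [exact: mD|exact: ci].
Qed.

Lemma H_traj_integrable x p : (forall j, ucont t0 T (fun t => x t 0 j)) ->
  Lintegrable `[t0, T] (fun t => H t (x t) p).
Proof.
move=> ux; have [M M0 hM] := ucont_enorm_bounded t0T ux.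
apply: (Lintegrable_dom (itv_Lmeasurable _) (H_traj_measurable p ux) (H_bound_integrable (enorm p) M0)).
by move=> t; rewrite /= in_itv/= => tt; apply: H_traj_bound => //; [exact: in0T|exact: hM].
Qed.

Variable sg : probability (@BorelRV R (n + 1)) R.
Hypothesis sgS : sphere_measure sg.

(** Converse of [value_le]. The Steiner cost l may fail to be measurable, so it is replaced by the
    envelope L of the functions <F, p> - H t x p over rational p: all of them are at most l, so L
    costs no more, and (F, L) lies in the epigraph almost everywhere. *)
Lemma value_lt g (x0 : 'rV[R]_n) (alpha : R) : (forall y, g y != -oo%E) ->
  (valuef T g (steinerF sg H) (steinerL sg H) t0 x0 < alpha%:E)%E ->
  exists x a, [/\ admissible H t0 T x a, x t0 = x0 & (g (x T) + (cost t0 T a)%:E < alpha%:E)%E].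
Proof.
move=> gN /ereal_inf_lt[_ [[x a'] /= [acx _ ae_x x0E] <-]] lt_al.
have mD : measurable (`[t0, T]%classic : set LT) := itv_Lmeasurable _.
set l := (fun t => steinerL sg H t (x t) (a' t)) in lt_al.
pose F t := steinerF sg H t (x t) (a' t).
have hE t : t0 <= t <= T -> epiE H t (x t) (steinerFL sg H t (x t) (a' t)).
  by move=> tt; apply: (steinerFL_epiE sgS); apply: (epiE_nonemptyH h3 h4); exact: in0T.
have acj j : acont t0 T (fun t => x t 0 j).
  move=> e e0; have [d d0 hd] := acx e e0; exists d => // N u v uv dis sN.
  apply: le_lt_trans (hd N u v uv dis sN); apply: ler_sum => i _.
  by have := coord_le_enorm (x (v i) - x (u i)) j; rewrite !mxE.
have ucj j : ucont t0 T (fun t => x t 0 j) by exact: acont_ucont.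
have [M M0 hM] := ucont_enorm_bounded t0T ucj.
have derx j : {ae mu, forall t : LT, t0 < t < T ->
    derivable (fun t => x t 0 j) t 1 /\ 'D_1 (fun t => x t 0 j) t = F t 0 j}.
  apply: (LaeS ae_x) => t ht /andP[tt1 tt2]; have [|dx Dx] := ht.
    by rewrite in_itv/= !ltW.
  split; first exact: (derivable_mxP _ _ _).1 dx 0 j.
  by rewrite /F -Dx derive_mx// mxE.
have Fb t : t0 <= t <= T -> enorm (F t) <= c t * (1 + M).
  move=> tt; have tT := in0T tt.
  apply: (le_trans (epiE_velocity h4 tT (c0 tT) (hE t tt))).
  by apply: ler_wpM2l; [exact: c0|rewrite lerD2l hM].
have cMi : Lintegrable `[t0, T] (fun t => c t * (1 + M)).
  rewrite (_ : (fun t => _) = fun t => (1 + M) * c t); last by apply/funext => t; rewrite mulrC.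
  by apply: rintegrableZ; [exact: mD|exact: (LintegrableS t00 (lexx T))].
have Fi j : Lintegrable `[t0, T] (fun t => F t 0 j).
  apply: (Lintegrable_dom mD (Lmeasurable_derive t0T (ucj j) (derx j)) cMi).
  move=> t; rewrite /= in_itv/= => tt; apply: le_trans (Fb t tt).
  exact: coord_le_enorm.
have xE t j : t0 <= t <= T -> x t 0 j = x t0 0 j + LI `[t0, t] (fun s => F s 0 j).
  by move=> tt; exact: (acont_FTC (acj j) (Fi j) (derx j) tt).
pose w i t := dotr (F t) (qvec i) - H t (x t) (qvec i).
have wi i : Lintegrable `[t0, T] (w i).
  by apply: rintegrableB; [exact: mD|exact: Lintegrable_dotr|exact: H_traj_integrable].
have wl i t : t0 <= t <= T -> w i t <= l t.
  by move=> tt; have /epiEP := hE t tt; exact.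
(* The integrable function [w 0] below l excludes -oo; the strict bound by alpha then excludes
   +oo. *)
have lN : (Lintegral `[t0, T] l != -oo)%E.
  have le1 : ((LI `[t0, T] (w 0%N))%:E <= Lintegral `[t0, T] l)%E.
    rewrite -(LI_E (wi 0%N) mD); apply: le_integral_nomeas => t.
    by rewrite /= in_itv/= lee_fin; exact: wl.
  by rewrite gt_eqF// (lt_le_trans _ le1)// ltNyr.
have lf : Lintegral `[t0, T] l \is a fin_num.
  rewrite fin_numE lN/=; apply/eqP => lo; move: lt_al; rewrite lo.
  by have := gN (x T); case: (g (x T)) => [r||] //=.
have [N|L Li [LK Lge]] := @sup_envelope R t0 T w (fine (Lintegral `[t0, T] l)) wi.
  rewrite -lee_fin (fineK lf) -(LI_E (Lintegrable_runmax N wi) mD).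
  apply: le_integral_nomeas => t; rewrite /= in_itv/= lee_fin => tt.
  by apply: runmax_le => i; exact: wl.
have [||a adm ca] := @admissible_ae H t0 T x F L t0T _ Fi Li _ xE.
- by move=> t tt; exists (steinerFL sg H t (x t) (a' t)); exact: hE.
- apply: (LaeS Lge) => t h tt; apply: (epiE_qvec h4); first exact: in0T.
  by move=> i; rewrite row_mxKl row_mxKr mxE; exact: h.
exists x, a; split => //; apply: le_lt_trans lt_al; apply: leeD2l.
by rewrite ca -(fineK lf) lee_fin.
Qed.

End NearOptimal.
End Value.

(** * Lower limit *)

Section Subsequences.
Context {R : realType}.
Implicit Types (phi : nat -> nat).

Lemma strict_geq phi : (forall m, (phi m < phi m.+1)%N) -> forall m, (m <= phi m)%N.
Proof. by move=> h; elim=> // m IH; exact: leq_ltn_trans IH (h m). Qed.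

Lemma strict_mono phi : (forall m, (phi m < phi m.+1)%N) -> {mono phi : m n / (m <= n)%N}.
Proof. by move=> h; exact: (increasing_seqP phi).1. Qed.

Lemma strict_cvg phi : (forall m, (phi m < phi m.+1)%N) -> phi @ \oo --> \oo.
Proof.
move=> h A [N _ NA]; exists N => // m /= Nm; apply: NA => /=.
exact: leq_trans Nm (strict_geq h m).
Qed.

(** Diagonal argument over the nested extractions [S k]. *)
Lemma diagonal_subseq (u : nat -> nat -> R) : (forall k, exists M, forall i, `|u k i| <= M) ->
  exists2 phi, (forall m, (phi m < phi m.+1)%N) & forall k, cvgn (u k \o phi).
Proof.
move=> ub.
have /choice[E hE] : forall ks : nat * (nat -> nat), exists f : nat -> nat,
    (forall m, (f m < f m.+1)%N) /\ cvgn (u ks.1 \o ks.2 \o f).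
  move=> [k s]; have [M hM] := ub k.
  have [|f /increasing_seqP fi cf] := @bolzano_weierstrass R (u k \o s).
    exists `|M|; split => // y My i _; apply: (le_trans (hM _)); apply: ltW.
    exact: le_lt_trans (ler_norm M) My.
  by exists f; split => // m; exact: fi.
pose S := fix S k := if k is k'.+1 then S k' \o E (k, S k') else E (0%N, id).
have Sstrict k : forall m, (S k m < S k m.+1)%N.
  elim: k => [|k IH] m /=; first exact: (hE _).1.
  by rewrite (leqW_mono (strict_mono IH)); exact: (hE _).1.
have Sc k : cvgn (u k \o S k) by case: k => [|k];
    [exact: (hE (0%N, id)).2|exact: (hE (k.+1, S k)).2].
exists (fun k => S k k).
  move=> m /=; rewrite (leqW_mono (strict_mono (Sstrict m))).
  exact: (strict_geq (hE _).1).
(* From index k on, the diagonal takes values of [S k] at positions at least as late as its own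
   index. *)
have Ssub k d m : exists2 h, (m <= h)%N & S (k + d)%N m = S k h.
  elim: d m => [|d IH] m; first by exists m; rewrite // addn0.
  have [h mh] := IH (E ((k + d).+1, S (k + d)%N) m); exists h; last by rewrite addnS.
  exact: leq_trans (strict_geq (hE _).1 m) mh.
move=> k; apply/cvg_ex; exists (limn (u k \o S k)); apply/cvgrPdist_lt => e e0.
have /cvgrPdist_lt/(_ _ e0)[N _ hN] := Sc k.
exists (maxn N k) => // m /=; rewrite geq_max => /andP[Nm km].
have [h mh] := Ssub k (m - k)%N m; rewrite subnKC// => ->.
by apply: hN => /=; exact: leq_trans Nm mh.
Qed.

End Subsequences.

Section Compactness.
Context {R : realType} {n : nat}.
Local Notation mu := (@completed_lebesgue_measure R).
Local Notation LT := (LebT R).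
Implicit Types (v : nat -> R -> 'rV[R]_n).

Lemma Lintegrable_extend (D A : set R) (f : R -> R) : measurable (D : set LT) ->
  measurable (A : set LT) -> A `<=` D -> Lintegrable A f ->
  Lintegrable D (fun t => \1_A t * f t).
Proof.
move=> mD mA AD /(integrable_mkcond _ mA) fi; apply/(integrable_mkcond _ mD).
apply: eq_integrable fi; first exact: measurableT.
move=> t _; rewrite !patchE indicE; have [tA|tA] := pselect (A t).
  by rewrite (mem_set tA) (mem_set (AD _ tA)) mul1r.
by rewrite (memNset tA) mul0r; case: ifP.
Qed.

(** The indefinite integrals of all functions dominated by psi share the modulus of continuity of
    the integral of psi. *)
Lemma LI_modulus (a b s t : R) (f psi : R -> R) : Lintegrable `[a, b] f ->
  Lintegrable `[a, b] psi -> (forall r, a <= r <= b -> `|f r| <= psi r) ->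
  a <= s <= b -> a <= t <= b ->
  `|LI `[a, t] f - LI `[a, s] f| <= `|LI `[a, t] psi - LI `[a, s] psi|.
Proof.
move=> fi pi fp; have gen x y : a <= x -> x <= y -> y <= b ->
    `|LI `[a, y] f - LI `[a, x] f| <= `|LI `[a, y] psi - LI `[a, x] psi|.
  move=> ax xy yb; rewrite (LI_sub ax xy (LintegrableS (lexx a) yb fi)).
  rewrite (LI_sub ax xy (LintegrableS (lexx a) yb pi)); apply: le_trans (ler_norm _).
  apply: LI_bound; [exact: itv_Lmeasurable|exact: (LintegrableS ax yb)|exact: (LintegrableS ax yb)|].
  move=> r; rewrite /= in_itv/= => /andP[xr ry]; apply: fp.
  by rewrite (le_trans ax xr) (le_trans ry yb).
move=> /andP[as_ sb] /andP[at_ tb]; have [st|/ltW ts] := leP s t; first exact: gen.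
by rewrite distrC [leRHS]distrC; exact: gen.
Qed.

(** Equicontinuity carries convergence from the clamped rational times to all times. *)
Lemma LI_cvg_dense (a b : R) (w : nat -> R -> R) (psi : R -> R) : a <= b ->
  (forall i, Lintegrable `[a, b] (w i)) -> Lintegrable `[a, b] psi ->
  (forall i t, a <= t <= b -> `|w i t| <= psi t) ->
  (forall q, cvgn (fun i => LI `[a, clamp a b (rseq q)] (w i))) ->
  forall t, a <= t <= b -> cvgn (fun i => LI `[a, t] (w i)).
Proof.
move=> ab wi pi wp cv t /andP[at_ tb]; apply/cauchy_cvgP; apply: cauchy_exP => e e0.
have e4 : 0 < e / 4 by rewrite divr_gt0.
have e2 : 0 < e / 2 by rewrite divr_gt0.
have [d d0 hd] := LI_ucont pi e4.
have td : t - d < t + d by rewrite ltrBlDr -addrA ltrDl addr_gt0.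
have [q /andP[q1 q2]] := rseq_dense td.
set s := clamp a b (rseq q).
have /andP[as_ sb] := clamp_itv (rseq q) ab : a <= s <= b.
have st : `|s - t| < d.
  rewrite -(clamp_id (_ : a <= t <= b)) ?at_//; apply: le_lt_trans (clamp_lip _ _ _ _) _.
  by rewrite ltr_distl q1 q2.
have close i : `|LI `[a, t] (w i) - LI `[a, s] (w i)| <= e / 4.
  have sab : a <= s <= b by rewrite as_ sb.
  have tab : a <= t <= b by rewrite at_ tb.
  apply: le_trans (LI_modulus (wi i) pi (wp i) sab tab) _; apply: ltW.
  have [ts|/ltW st'] := leP t s.
    by rewrite distrC; apply: hd => //; apply: le_lt_trans (ler_norm _) st.
  by rewrite distrC in st; apply: hd => //; apply: le_lt_trans (ler_norm _) st.
exists (limn (fun i => LI `[a, s] (w i))); have /cvgrPdist_lt/(_ _ e2) := cv q.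
apply: filterS => i /= hi; rewrite /ball/=.
apply: le_lt_trans (ler_distD (LI `[a, s] (w i)) _ _) _.
have h2 := close i; rewrite distrC in h2; apply: le_lt_trans (lerD (ltW hi) h2) _.
by move: e0; clear; lra.
Qed.

(** It is enough that the indefinite integrals converge at rational times: [LI_cvg_dense] gives all
    times, and [weak_limit] the densities. *)
Lemma weak_compactness (a b : R) v (psi : R -> R) : a <= b ->
  (forall i j, Lintegrable `[a, b] (fun t => v i t 0 j)) -> Lintegrable `[a, b] psi ->
  (forall i t j, a <= t <= b -> `|v i t 0 j| <= psi t) ->
  exists phi, (forall m, (phi m < phi m.+1)%N) /\
  exists2 xi : R -> 'rV[R]_n, (forall j, Lintegrable `[a, b] (fun t => xi t 0 j)) &
    forall A j, measurable (A : set LT) ->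
      LI `[a, b] (fun t => \1_A t * v (phi i) t 0 j) @[i --> \oo] -->
      LI `[a, b] (fun t => \1_A t * xi t 0 j).
Proof.
move=> ab vi pi vp.
(* One index codes a coordinate and a rational time, so a single diagonal extraction handles all of
   them. *)
pose u (m i : nat) : R := if (unpickle m : option ('I_n * nat)) is Some (j, q)
  then LI `[a, clamp a b (rseq q)] (fun t => v i t 0 j) else 0.
have [|phi phiS cphi] := @diagonal_subseq R u.
  move=> m; exists `|LI `[a, b] psi| => i; rewrite /u; case: (unpickle m) => [[j q]|]; last by rewrite normr0.
  have /andP[as_ sb] := clamp_itv (rseq q) ab.
  have LIp r t : a <= r -> r <= t -> t <= b -> `|LI `[r, t] (fun t => v i t 0 j)| <= LI `[r, t] psi.
    move=> ar rt tb; apply: LI_bound; [exact: itv_Lmeasurable| | |].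
    - exact: (LintegrableS ar tb (vi i j)).
    - exact: (LintegrableS ar tb pi).
    - move=> y; rewrite /= in_itv/= => /andP[ry yt]; apply: vp.
      by rewrite (le_trans ar ry) (le_trans yt tb).
  have h := LIp _ _ as_ sb (lexx b); apply: (le_trans (LIp _ _ (lexx a) as_ sb)).
  apply: le_trans (ler_norm _); rewrite (@LI_cat R a (clamp a b (rseq q)) b psi) ?as_ ?sb//.
  by rewrite lerDl; exact: le_trans (normr_ge0 _) h.
exists phi; split => //.
have /choice[xi hxi] : forall j, exists xi : R -> R, Lintegrable `[a, b] xi /\
  forall A, measurable (A : set LT) ->
      LI `[a, b] (fun t => \1_A t * v (phi i) t 0 j) @[i --> \oo] -->
      LI `[a, b] (fun t => \1_A t * xi t).
  move=> j; have [| |||xi xii hxi] := @weak_limit R a b (fun i t => v (phi i) t 0 j) psi ab.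
  - by move=> i; exact: vi.
  - exact: pi.
  - by move=> i t; rewrite /= in_itv/=; exact: vp.
  - apply: (LI_cvg_dense ab _ pi).
    + by move=> i; exact: vi.
    + by move=> i t; exact: vp.
    + by move=> q; have := cphi (pickle (j, q)); rewrite /u/= /comp pickleK.
  - by exists xi.
exists (fun t => \row_j xi j t) => [j|A j mA].
  rewrite (_ : (fun t => _) = xi j); first exact: (hxi j).1.
  by apply/funext => t; rewrite mxE.
rewrite (_ : (fun t => \1_A t * (\row_j xi j t) 0 j) = fun t => \1_A t * xi j t).
  exact: (hxi j).2.
by apply/funext => t; rewrite mxE.
Qed.

(** Gronwall's lemma for 1 + \sum_j |x_j|, which dominates 1 + |x| and so absorbs the affine growth.
    The factor n in the kernel comes from summing the coordinates, and |c| makes the kernel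
    nonnegative at every t. *)
Lemma growth_bound (a b : R) (x w : R -> 'rV[R]_n) (c : R -> R) : a <= b ->
  Lintegrable `[a, b] c -> (forall j, Lintegrable `[a, b] (fun t => w t 0 j)) ->
  (forall t j, a <= t <= b -> x t 0 j = x a 0 j + LI `[a, t] (fun s => w s 0 j)) ->
  (forall t j, a <= t <= b -> `|w t 0 j| <= c t * (1 + enorm (x t))) ->
  forall t, a <= t <= b -> enorm (x t) <=
    2 * (1 + n%:R * enorm (x a)) * expR (2 * LI `[a, b] (fun t => n%:R * `|c t|)).
Proof.
move=> ab ci wi xE wc; have mD t : measurable (`[a, t]%classic : set LT) := itv_Lmeasurable _.
pose u t := 1 + \sum_j `|x t 0 j|; pose k t := n%:R * `|c t|.
have ki : Lintegrable `[a, b] k.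
  by apply: rintegrableZ; [exact: mD|apply: Rintegrable_norm].
have k0 t : 0 <= k t by rewrite mulr_ge0.
have xu t : 1 + enorm (x t) <= u t by rewrite lerD2l enorm_le_sum.
have ux j : ucont a b (fun t => x t 0 j).
  have uj := ucontD (ucont_cst a b (x a 0 j)) (LI_ucont (wi j)).
  move=> e e0; have [d d0 hd] := uj e e0; exists d => // s t as_ st tb std.
  have := hd s t as_ st tb std; rewrite -!xE//.
    by rewrite as_ (le_trans st).
  by rewrite (le_trans as_).
have uu : ucont a b u.
  by apply: ucontD; [exact: ucont_cst|apply: ucont_sum => j; exact: ucont_norm].
have [B hB] := ucont_bounded ab uu.
have u0 t : 0 <= u t by rewrite addr_ge0// sumr_ge0.
have A0 : 0 <= 1 + n%:R * enorm (x a) by rewrite addr_ge0// mulr_ge0// enorm_ge0.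
have kui : Lintegrable `[a, b] (fun t => k t * u t).
  apply: (@Lintegrable_mul_bounded _ _ _ _ B); [exact: mD|exact: ki|exact: ucont_measurable|].
  by move=> t; rewrite /= in_itv/= => tt; rewrite ger0_norm// hB.
have := @gronwall R a b k u (1 + n%:R * enorm (x a)) B ab ki k0 (ucont_measurable ab uu) A0.
have uB t : a <= t <= b -> 0 <= u t <= B by move=> tt; rewrite u0 hB.
move=> /(_ uB) G t tt; apply: (le_trans (y := u t)).
  by apply: le_trans (xu t); rewrite lerDr.
apply: le_trans (G _ t tt) _.
  move=> {tt}t /andP[at_ tb].
  apply: (@le_trans _ _ (1 + \sum_(j < n) (enorm (x a) + LI `[a, t] (fun s => `|w s 0 j|)))).
    rewrite lerD2l; apply: ler_sum => j _; rewrite xE ?at_//.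
    apply: le_trans (ler_normD _ _) _; apply: lerD; first exact: coord_le_enorm.
    by apply: LI_normr; [exact: mD|exact: (LintegrableS (lexx a) tb (wi j))].
  rewrite big_split/= sumr_const card_ord -[enorm _ *+ n]mulr_natl addrA lerD2l.
  have kt := LintegrableS (lexx a) tb kui.
  apply: (@le_trans _ _ (\sum_(j < n) LI `[a, t] (fun s => `|c s| * u s))).
    apply: ler_sum => j _; apply: LI_le; [exact: mD| | |].
    - by apply: Rintegrable_norm; exact: (LintegrableS (lexx a) tb (wi j)).
    - apply: (LintegrableS (lexx a) tb).
      apply: (@Lintegrable_mul_bounded _ _ _ _ B); [exact: mD| | |].
      + by apply: Rintegrable_norm.
      + exact: ucont_measurable.
      + by move=> r; rewrite /= in_itv/= => rr; rewrite ger0_norm// hB.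
    - move=> s; rewrite /= in_itv/= => /andP[as_ st].
      apply: (le_trans (wc s j _)); first by rewrite as_ (le_trans st).
      apply: le_trans (ler_wpM2l (normr_ge0 _) (xu s)).
      by apply: ler_wpM2r; [rewrite addr_ge0// enorm_ge0|exact: ler_norm].
  rewrite sumr_const card_ord -mulr_natl -LIZ; first last.
  - apply: (LintegrableS (lexx a) tb).
    apply: (@Lintegrable_mul_bounded _ _ _ _ B); [exact: mD| | |].
    + by apply: Rintegrable_norm.
    + exact: ucont_measurable.
    + by move=> r; rewrite /= in_itv/= => rr; rewrite ger0_norm// hB.
  - exact: mD.
  by rewrite (_ : (fun s => _) = fun s => k s * u s)//; apply/funext => s; rewrite mulrA.
have /andP[at_ tb] := tt; apply: ler_wpM2l; first by rewrite mulr_ge0.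
rewrite ler_expR ler_wpM2l// (@LI_cat R a t b k)// lerDl.
by apply: LI_ge0 => s _; exact: k0.
Qed.

End Compactness.

Section IntegralSequences.
Context {R : realType}.
Local Notation mu := (@completed_lebesgue_measure R).
Local Notation LT := (LebT R).

Lemma ucont_cvg (a b : R) (G : R -> R) (s_ : nat -> R) (s : R) : a <= b -> ucont a b G ->
  (forall i, a <= s_ i <= b) -> a <= s <= b -> s_ @ \oo --> s -> G (s_ i) @[i --> \oo] --> G s.
Proof.
move=> ab uG s_ab sab cs; rewrite -(clamp_id sab).
rewrite (_ : (fun i => G (s_ i)) = fun i => G (clamp a b (s_ i))); last first.
  by apply/funext => i; rewrite clamp_id.
have cG : {for s, continuous (fun t => G (clamp a b t))} by exact: ucont_clamp.
refine (cvg_comp s_ (fun t => G (clamp a b t)) cs cG).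
Qed.

Lemma LI_sum (D : set R) (I : eqType) (s : seq I) (f : I -> R -> R) : measurable (D : set LT) ->
  (forall j, Lintegrable D (f j)) ->
  LI D (fun t => \sum_(j <- s) f j t) = \sum_(j <- s) LI D (f j).
Proof.
move=> mD fi; elim: s => [|j s IH].
  by rewrite big_nil -[RHS](LI0 D); congr LI; apply/funext => t; rewrite big_nil.
rewrite big_cons -IH -LID//; last by apply: rintegrable_sum => // i _; exact: fi.
by congr LI; apply/funext => t; rewrite big_cons.
Qed.

(** Induction on N for all measurable A at once: A is cut into the part where [w N.+1] is the new
    maximum, which uses its own weak convergence, and the rest, which uses the induction
    hypothesis. *)
Lemma runmax_limit (a b : R) (w : nat -> R -> R) (w_ : nat -> nat -> R -> R) (l_ : nat -> R -> R) :
  (forall k, Lintegrable `[a, b] (w k)) -> (forall k i, Lintegrable `[a, b] (w_ k i)) ->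
  (forall i, Lintegrable `[a, b] (l_ i)) ->
  (forall k i t, a <= t <= b -> w_ k i t <= l_ i t) ->
  (forall k A, measurable (A : set LT) ->
    LI `[a, b] (fun t => \1_A t * w_ k i t) @[i --> \oo] --> LI `[a, b] (fun t => \1_A t * w k t)) ->
  forall N A, measurable (A : set LT) -> forall e, 0 < e -> \forall i \near \oo,
    LI `[a, b] (fun t => \1_A t * runmax w N t) <= LI `[a, b] (fun t => \1_A t * l_ i t) + e.
Proof.
move=> wi w_i li wl cw; set D := `[a, b]%classic.
have mD : measurable (D : set LT) := itv_Lmeasurable _.
have Ii A f : measurable (A : set LT) -> Lintegrable D f -> Lintegrable D (fun t => \1_A t * f t).
  by move=> mA fi; exact: Lintegrable_indicM.
have base k A : measurable (A : set LT) -> forall e, 0 < e -> \forall i \near \oo,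
    LI D (fun t => \1_A t * w k t) <= LI D (fun t => \1_A t * l_ i t) + e.
  move=> mA e e0; have /cvgrPdist_le/(_ _ e0) := cw k A mA.
  apply: filterS => i /= hi; rewrite -lerBlDr.
  apply: (@le_trans _ _ (LI D (fun t => \1_A t * w_ k i t))).
    by rewrite lerBlDr -lerBlDl; exact: le_trans (ler_norm _) hi.
  apply: LI_le; [exact: mD|exact: Ii|exact: Ii|] => t.
  rewrite /D/= in_itv/= => tt; apply: ler_wpM2l; last exact: wl.
  by rewrite indicE; case: (_ \in _).
elim=> [|N IH] A mA e e0; first exact: base.
(* The set where [w N.+1] strictly exceeds the running maximum; each of the two pieces receives half
   of e. *)
pose S := D `&` (fun t => runmax w N t - w N.+1 t) @^-1` `]-oo, 0[%classic.
have mS : measurable (S : set LT).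
  have rwi : Lintegrable D (fun t => runmax w N t - w N.+1 t).
    by apply: rintegrableB; [exact: mD|exact: Lintegrable_runmax|exact: wi].
  exact: (Lintegrable_measurable rwi mD (measurable_itv _)).
have e2 : 0 < e / 2 by rewrite divr_gt0.
have mAS : measurable (A `&` S : set LT) by exact: measurableI.
have mAC : measurable (A `\` S : set LT) by exact: measurableD.
have rN := Lintegrable_runmax N wi.
have E1 : LI D (fun t => \1_A t * runmax w N.+1 t) =
    LI D (fun t => \1_(A `&` S) t * w N.+1 t) + LI D (fun t => \1_(A `\` S) t * runmax w N t).
  rewrite -LID; [|exact: mD|exact: Ii|exact: Ii]; apply: eq_LI => t Dt /=.
  rewrite !indicE; have [At|nAt] := pselect (A t); last first.
    by rewrite (memNset nAt) !memNset; [rewrite !mul0r addr0|case|case].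
  rewrite (mem_set At) mul1r; have [St|nSt] := pselect (S t).
    rewrite (_ : t \in A `&` S)/=; last by apply: mem_set.
    rewrite (_ : (t \in A `\` S) = false)/=; last by apply: memNset; case.
    rewrite mul1r mul0r addr0; apply: max_r; have [_] := St.
    by rewrite /= in_itv/= subr_lt0 => /ltW.
  rewrite (_ : (t \in A `&` S) = false)/=; last by apply: memNset; case.
  rewrite (_ : t \in A `\` S)/=; last by apply: mem_set.
  rewrite mul0r mul1r add0r; apply: max_l; rewrite leNgt; apply/negP => h.
  by apply: nSt; split => //; rewrite /= in_itv/= subr_lt0.
have E2 i : LI D (fun t => \1_A t * l_ i t) =
    LI D (fun t => \1_(A `&` S) t * l_ i t) + LI D (fun t => \1_(A `\` S) t * l_ i t).
  rewrite -LID; [|exact: mD|exact: Ii|exact: Ii]; apply: eq_LI => t Dt /=.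
  rewrite -mulrDl; congr (_ * _); rewrite !indicE.
  have [At|nAt] := pselect (A t); last first.
    by rewrite (memNset nAt) !memNset; [rewrite addr0|case|case].
  rewrite (mem_set At); have [St|nSt] := pselect (S t).
    rewrite (_ : t \in A `&` S)/=; last by apply: mem_set.
    by rewrite (_ : (t \in A `\` S) = false)/= ?addr0//; apply: memNset; case.
  rewrite (_ : (t \in A `&` S) = false)/=; last by apply: memNset; case.
  by rewrite (_ : t \in A `\` S)/= ?add0r//; apply: mem_set.
have h1 := base N.+1 _ mAS _ e2; have h2 := IH _ mAC _ e2.
near=> i; have g1 : LI D (fun t => \1_(A `&` S) t * w N.+1 t) <=
    LI D (fun t => \1_(A `&` S) t * l_ i t) + e / 2 by near: i.
have g2 : LI D (fun t => \1_(A `\` S) t * runmax w N t) <=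
    LI D (fun t => \1_(A `\` S) t * l_ i t) + e / 2 by near: i.
by rewrite E1 E2; move: (lerD g1 g2); clear; lra.
Unshelve. all: by end_near. Qed.

End IntegralSequences.

(** The Lipschitz constant in x is the same for all i, on the ball of radius |y| + 1, which
    eventually contains every [y_ i]. *)
Lemma H_joint_cvg {R : realType} {n : nat} (T : R) (k : R -> R -> R)
    (H_ : nat -> R -> 'rV[R]_n -> 'rV[R]_n -> R) (y_ : nat -> 'rV[R]_n) y p t (h : R) :
  (forall r : R, 0 < r ->
     Lintegrable `[0, T] (k r) /\ (forall t, t \in `[0, T] -> 0 <= k r t)) ->
  (forall i, HLC T k (H_ i)) -> t \in `[0, T] -> y_ @ \oo --> y ->
  H_ i t y p @[i --> \oo] --> h -> H_ i t (y_ i) p @[i --> \oo] --> h.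
Proof.
move=> ki hl tT cy ch; pose r := enorm y + 1.
have r0 : 0 < r by rewrite ltr_wpDl// enorm_ge0.
pose C := k r t * (1 + enorm p) + 1.
have C0 : 0 < C by rewrite ltr_wpDl// mulr_ge0 ?(ki r r0).2// addr_ge0// enorm_ge0.
apply/cvgrPdist_le => e e0; have e2 : 0 < e / 2 by rewrite divr_gt0.
have /cvgrPdist_le/(_ _ e2) h1 := ch.
have near_y d : 0 < d -> \forall i \near \oo, enorm (y_ i - y) <= d.
  exact: ((cvg_enormP (@eventually_filter) _ _).1 cy).
have g1 := near_y _ (divr_gt0 e2 C0); have g2 := near_y _ (@ltr01 R).
near=> i; have i1 : `|h - H_ i t y p| <= e / 2 by near: i.
have i2 : enorm (y_ i - y) <= e / 2 / C by near: i.
have i3 : enorm (y_ i - y) <= 1 by near: i.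
have yr : enorm y <= r by rewrite lerDl.
have yir : enorm (y_ i) <= r.
  by rewrite (le_trans (enorm_le_dist _ y))// lerD2l.
have := hl i r r0 t tT y (y_ i) p yr yir; rewrite enormBC.
have i4 : enorm (y_ i - y) * C <= e / 2 by rewrite -ler_pdivlMr.
have i5 := ler_distD (H_ i t y p) h (H_ i t (y_ i) p).
have := enorm_ge0 (y_ i - y); move: i1 i4 i5; rewrite /C; clear; nra.
Unshelve. all: by end_near. Qed.

Section LowerLimit.
Context {R : realType} {n : nat}.
Local Notation mu := (@completed_lebesgue_measure R).
Local Notation LT := (LebT R).
Variables (T : R) (c : R -> R) (k : R -> R -> R) (m0 : R -> R)
  (H_ : nat -> R -> 'rV[R]_n -> 'rV[R]_n -> R) (H : R -> 'rV[R]_n -> 'rV[R]_n -> R).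
Hypotheses (ci : Lintegrable `[0, T] c) (c0 : forall t, t \in `[0, T] -> 0 <= c t).
Hypothesis ki : forall r : R, 0 < r ->
     Lintegrable `[0, T] (k r) /\ (forall t, t \in `[0, T] -> 0 <= k r t).
Hypothesis m0i : Lintegrable `[0, T] m0.
Hypotheses (hH_ : forall i, [/\ H1 T (H_ i), H2 T (H_ i), H3 T (H_ i), H4 T c (H_ i)
               & HLC T k (H_ i)]) (hm_ : forall i t, t \in `[0, T] -> `|H_ i t 0 0| <= m0 t).
Hypotheses (hH : [/\ H1 T H, H2 T H, H3 T H, H4 T c H & HLC T k H])
  (hm : forall t, t \in `[0, T] -> `|H t 0 0| <= m0 t).
Hypothesis cH : forall t x p, t \in `[0, T] -> H_ i t x p @[i --> \oo] --> H t x p.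

Variables (t_ : nat -> R) (t0 : R) (x_ : nat -> R -> 'rV[R]_n) (a_ : nat -> R -> 'rV[R]_(n + 1))
  (z : 'rV[R]_n).
Hypotheses (t_T : forall i, 0 <= t_ i <= T) (t0T : 0 <= t0 <= T) (ct : t_ @ \oo --> t0).
Hypotheses (adm_ : forall i, admissible (H_ i) (t_ i) T (x_ i) (a_ i))
  (cz : x_ i (t_ i) @[i --> \oo] --> z).

(** The curves start at different times [t_ i]. Velocities are extended by 0 before the start, so
    that [X i] rests at the initial point until [t_ i] and all curves share the interval [0, T]. *)
Let A i : set R := `[t_ i, T]%classic.
Let v i t : 'rV[R]_n := \1_(A i) t *: lsubmx (a_ i t).
Let X i t : 'rV[R]_n := \row_j (x_ i (t_ i) 0 j + LI `[0, t] (fun s => v i s 0 j)).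
Let T0 : 0 <= T. Proof. by case/andP: t0T => /le_trans; apply. Qed.
Let mD (a b : R) : measurable (`[a, b]%classic : set LT) := itv_Lmeasurable _.
Let t_0 i : 0 <= t_ i. Proof. by case/andP: (t_T i). Qed.
Let t_1 i : t_ i <= T. Proof. by case/andP: (t_T i). Qed.
Let A_sub i : A i `<=` `[0, T]%classic.
Proof. by move=> t; rewrite /A /= !in_itv/= => /andP[h ->]; rewrite (le_trans (t_0 i)). Qed.

Let Xi i : (forall j, Lintegrable `[0, T] (fun t => v i t 0 j)).
Proof.
move=> j; rewrite (_ : (fun t => _) = fun t => \1_(A i) t * lsubmx (a_ i t) 0 j).
  by apply: Lintegrable_extend; [exact: mD|exact: mD|exact: A_sub|exact: admissible_vel (adm_ i)].
by apply/funext => t; rewrite /v !mxE.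
Qed.

Let v_LI i t j : 0 <= t <= T ->
  LI `[0, t] (fun s => v i s 0 j) = if t_ i <= t then LI `[t_ i, t] (fun s => lsubmx (a_ i s) 0 j) else 0.
Proof.
move=> /andP[t0' tT]; rewrite (_ : (fun s => _) = fun s => \1_(A i) s * lsubmx (a_ i s) 0 j); last first.
  by apply/funext => s; rewrite /v !mxE.
rewrite LI_indic; case: ifP => [tit|/negbT]; last rewrite -ltNge => tti.
  congr LI; apply/seteqP; split => s; rewrite /A /= !in_itv/=.
    by move=> [/andP[_ ->] /andP[-> _]].
  by move=> /andP[h1 h2]; rewrite h1 h2 (le_trans (t_0 i) h1) (le_trans h2 tT).
rewrite (_ : _ `&` _ = set0); last first.
  apply/seteqP; split => s //; rewrite /A /= !in_itv/= => -[/andP[_ st] /andP[ts _]].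
  by move: (le_lt_trans st tti); rewrite ltNge ts.
by rewrite -(LI_set1 0 (fun=> 0)) LI0; apply: etrans (LI0 set0); apply: eq_LI.
Qed.

Let XE i t : t_ i <= t <= T -> X i t = x_ i t.
Proof.
move=> /andP[h1 h2]; apply/rowP => j; rewrite mxE v_LI ?h2 ?andbT; last exact: le_trans h1.
by rewrite h1; have [_ _ xE] := adm_ i; rewrite (xE t j)// h1 h2.
Qed.

Let X0 i : X i 0 = x_ i (t_ i).
Proof. by apply/rowP => j; rewrite mxE set_itv1 LI_set1 addr0. Qed.

Let X_form i t j : 0 <= t <= T -> X i t 0 j = X i 0 0 j + LI `[0, t] (fun s => v i s 0 j).
Proof. by move=> _; rewrite X0 mxE. Qed.

Let tin t : 0 <= t <= T -> t \in `[0, T]. Proof. by rewrite in_itv. Qed.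

Let v_enorm i t : 0 <= t <= T -> enorm (v i t) <= c t * (1 + enorm (X i t)).
Proof.
move=> tT; rewrite /v indicE; have [tA|tA] := pselect (A i t).
  have := tA; rewrite /A /= in_itv/= => tt; rewrite (mem_set tA) scale1r XE//.
  have [_ _ _ h4 _] := hH_ i; apply: (epiE_velocity h4 (tin tT) (c0 (tin tT))).
  by have [_ + _] := adm_ i; apply.
rewrite (memNset tA) scale0r enorm0 mulr_ge0 ?addr_ge0 ?enorm_ge0//; exact: c0 (tin tT).
Qed.

Let X_bounded : exists2 r, 0 < r & forall i t, 0 <= t <= T -> enorm (X i t) <= r.
Proof.
have cn : cvgn (fun i => enorm (x_ i (t_ i))).
  by apply/cvg_ex; exists (enorm z); apply: (cvg_comp _ _ cz); exact: enorm_continuous.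
have [M [_ /(_ (M + 1))]] := cvg_seq_bounded cn; rewrite ltrDl => /(_ ltr01) hM.
set E := expR (2 * LI `[0, T] (fun t => n%:R * `|c t|)).
have M0 : 0 <= M + 1 by apply: (le_trans (normr_ge0 _)); exact: (hM 0%N).
exists (2 * (1 + n%:R * (M + 1)) * E).
  by rewrite mulr_gt0 ?expR_gt0// mulr_gt0// ltr_wpDr// mulr_ge0.
move=> i t tt; apply: le_trans (growth_bound T0 ci (Xi i) (@X_form i) _ tt) _.
  by move=> s j ss; apply: le_trans (v_enorm i ss); exact: coord_le_enorm.
apply: ler_wpM2r; first exact: expR_ge0.
apply: ler_wpM2l => //; rewrite lerD2l; apply: ler_wpM2l => //; rewrite X0.
have /= hMi := hM i Logic.I; exact: le_trans (ler_norm _) hMi.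
Qed.

Let uX i j : ucont 0 T (fun t => X i t 0 j).
Proof.
rewrite (_ : (fun t => _) = fun t => x_ i (t_ i) 0 j + LI `[0, t] (fun s => v i s 0 j)).
  by apply: ucontD; [exact: ucont_cst|exact: LI_ucont].
by apply/funext => t; rewrite mxE.
Qed.

(** Subsequence and limit curve are fixed before the cost level K, because K will depend on how g (x
    T) is approached; the lower bound C on costs serves to exclude g (x T) = +oo. *)
Lemma lower_limit : exists phi, (forall m, (phi m < phi m.+1)%N) /\
  exists x, [/\ x t0 = z, x_ (phi i) T @[i --> \oo] --> x T,
    exists C, forall a, admissible H t0 T x a -> C <= cost t0 T a &
    forall K, (\forall i \near \oo, cost (t_ (phi i)) T (a_ (phi i)) <= K) ->
      exists2 a, admissible H t0 T x a & cost t0 T a <= K].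
Proof.
have [r r0 Xr] := X_bounded; pose psi t := c t * (1 + r).
have psii : Lintegrable `[0, T] psi.
  rewrite (_ : psi = fun t => (1 + r) * c t); last by apply/funext => t; rewrite /psi mulrC.
  by apply: rintegrableZ; [exact: mD|exact: ci].
have v_psi i t j : 0 <= t <= T -> `|v i t 0 j| <= psi t.
  move=> tT; apply: le_trans (coord_le_enorm _ _) _; apply: le_trans (v_enorm i tT) _.
  by apply: ler_wpM2l; [exact: c0 (tin tT)|rewrite lerD2l Xr].
have [phi [phiS [xi xii cxi]]] := weak_compactness T0 Xi psii v_psi.
exists phi; split => //.
pose x t : 'rV[R]_n := \row_j (z 0 j + LI `[0, t] (fun s => xi s 0 j)).
have cphi := strict_cvg phiS.
have cXLI t j : 0 <= t <= T ->
    LI `[0, t] (fun s => v (phi i) s 0 j) @[i --> \oo] --> LI `[0, t] (fun s => xi s 0 j).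
  move=> /andP[t0' tT]; have := cxi `[0, t]%classic j (mD 0 t).
  have E f : LI `[0, T] (fun s => \1_`[0, t]%classic s * f s) = LI `[0, t] f.
    rewrite LI_indic; congr LI; apply/seteqP; split => s; first by case.
    move=> h; split => //; move: h; rewrite /= !in_itv/= => /andP[-> h].
    by rewrite (le_trans h tT).
  by rewrite E; under eq_fun do rewrite E.
have cX t : 0 <= t <= T -> X (phi i) t @[i --> \oo] --> x t.
  move=> tT; apply/cvg_rowP => j; rewrite mxE.
  rewrite (_ : (fun i => _) = fun i => x_ (phi i) (t_ (phi i)) 0 j +
      LI `[0, t] (fun s => v (phi i) s 0 j)); last by apply/funext => i; rewrite mxE.
  apply: cvgD; last exact: cXLI.
  have cj := (cvg_rowP (@eventually_filter) _ _).1 cz j; refine (cvg_comp phi (fun i => x_ i (t_ i) 0 j) cphi cj).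
(* The extended velocities have zero integral up to [t_ i], and from there to t0 the integral of psi
   is small. *)
have xt0 : x t0 = z.
  apply/rowP => j; rewrite mxE -[RHS]addr0; congr (_ + _).
  apply: (cvg_unique _ (cXLI t0 j t0T)) => //; apply/cvgrPdist_le => e e0.
  have cpsi := ucont_cvg T0 (LI_ucont psii) t_T t0T ct.
  have := cvg_comp _ _ cphi cpsi => /cvgrPdist_le/(_ _ e0); apply: filterS => i /= hi.
  rewrite sub0r normrN; apply: le_trans hi.
  have := LI_modulus (Xi (phi i) j) psii (fun s h => v_psi _ s j h) (t_T (phi i)) t0T.
  rewrite (@v_LI _ (t_ (phi i)) j (t_T _)) lexx set_itv1 LI_set1 subr0.
  by [].
have ux j : ucont 0 T (fun t => x t 0 j).
  rewrite (_ : (fun t => _) = fun t => z 0 j + LI `[0, t] (fun s => xi s 0 j)).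
    by apply: ucontD; [exact: ucont_cst|exact: LI_ucont].
  by apply/funext => t; rewrite mxE.
have [t00 t1] : 0 <= t0 /\ t0 <= T by case/andP: t0T.
have ux0 j : ucont t0 T (fun t => x t 0 j) by exact: ucontS (ux j).
have [h1 h2 h3 h4 hl] := hH.
have hHi q := H_traj_integrable ci c0 ki h1 h2 h4 hl m0i hm t00 t1 q ux0.
exists x; split => //.
- have := cX T; rewrite T0 lexx => /(_ isT); rewrite (_ : (fun i => _) = fun i => x_ (phi i) T)//.
  by apply/funext => i; rewrite XE// t_1 lexx.
- exists (LI `[t0, T] (fun t => - H t (x t) 0)) => a adm.
  have [_ Ea _] := adm; apply: LI_le; [exact: mD| |exact: admissible_cost adm|].
    rewrite (_ : (fun t => _) = fun t => -1 * H t (x t) 0); last by apply/funext => t; rewrite mulN1r.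
    by apply: rintegrableZ; [exact: mD|exact: hHi].
  by move=> t; rewrite /= in_itv/= => tt; exact: epiE_cost_lb (Ea t tt).
move=> K hK.
have xi0 j : Lintegrable `[t0, T] (fun t => xi t 0 j) by exact: (LintegrableS t00 (lexx T)).
pose w q t := dotr (xi t) (qvec q) - H t (x t) (qvec q).
have dotri f p := @Lintegrable_dotr R n _ f p (mD t0 T).
have wi q : Lintegrable `[t0, T] (w q).
  by apply: rintegrableB; [exact: mD|exact: dotri|exact: hHi].
(* Bounds for all finite maxima give the envelope L over all rational p, which is the cost of the
   limit pair. *)
suff wK N : LI `[t0, T] (runmax w N) <= K.
  have [L Li [LK Lge]] := sup_envelope wi wK.
  have [|||a adm ca] := @admissible_ae R n H t0 T x xi L t1 _ xi0 Li.
  - by move=> t tt; apply: (epiE_nonemptyH h3 h4); exact: (in0T t00 tt).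
  - apply: (LaeS Lge) => t h tt; apply: (epiE_qvec h4); first exact: (in0T t00 tt).
    by move=> q; rewrite row_mxKl row_mxKr mxE; exact: h.
  - move=> t j /andP[h0t htT]; rewrite !mxE -addrA; congr (_ + _).
    apply/eqP; rewrite addrC -subr_eq; apply/eqP.
    exact: (LI_sub t00 h0t (LintegrableS (lexx 0) htT (xii j))).
  - by exists a; rewrite // ca.
have in01 t : t0 <= t <= T -> 0 <= t <= T.
  by move=> /andP[h ->]; rewrite (le_trans t00 h).
have uX0 i j : ucont t0 T (fun t => X i t 0 j) by exact: ucontS (uX i j).
pose l i t := \1_(A i) t * rsubmx (a_ i t) 0 0.
pose w_ q i t := dotr (v i t) (qvec q) - \1_(A i) t * H_ i t (X i t) (qvec q).
have mA i : measurable (A i : set LT) by exact: mD.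
have li i : Lintegrable `[t0, T] (l i).
  apply: (LintegrableS t00 (lexx T)); apply: Lintegrable_extend.
  - exact: mD.
  - exact: mA.
  - exact: A_sub.
  - exact: admissible_cost (adm_ i).
have H_i i p : Lintegrable `[t0, T] (fun t => H_ i t (X i t) p).
  have [g1 g2 g3 g4 gl] := hH_ i.
  exact: (H_traj_integrable ci c0 ki g1 g2 g4 gl m0i (hm_ i) t00 t1 p (uX0 i)).
have vi0 i j : Lintegrable `[t0, T] (fun t => v i t 0 j).
  exact: (LintegrableS t00 (lexx T)).
have w_i q i : Lintegrable `[t0, T] (w_ q i).
  apply: rintegrableB; [exact: mD|exact: dotri|].
  by apply: Lintegrable_indicM; [exact: mD|exact: mA|exact: H_i].
have w_l q i t : t0 <= t <= T -> w_ q i t <= l i t.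
  move=> tt; rewrite /w_ /l /v indicE; have [tA|tA] := pselect (A i t); last first.
    by rewrite (memNset tA) scale0r dot0r !mul0r subr0.
  have := tA; rewrite /A /= in_itv/= => tti; rewrite (mem_set tA) scale1r !mul1r XE//.
  by have [_ /(_ t tti) /epiEP/(_ (qvec q)) + _] := adm_ i.
(* The part linear in the velocity converges weakly, coordinate by coordinate; the Hamiltonian part
   converges by domination along the pointwise convergent curves. *)
have cw q B : measurable (B : set LT) ->
    LI `[t0, T] (fun t => \1_B t * w_ q (phi i) t) @[i --> \oo] -->
    LI `[t0, T] (fun t => \1_B t * w q t).
  move=> mB.
  have Ed (h : R -> R) (u : R -> 'rV[R]_n) :
      (forall j, Lintegrable `[t0, T] (fun t => u t 0 j)) -> Lintegrable `[t0, T] h ->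
      LI `[t0, T] (fun t => \1_B t * (dotr (u t) (qvec q) - h t)) =
      \sum_(j < n) qvec q 0 j * LI `[0, T] (fun t => \1_(`[t0, T]%classic `&` B) t * u t 0 j) -
      LI `[t0, T] (fun t => \1_B t * h t).
    move=> ui hi; transitivity (LI `[t0, T] (fun t =>
        \sum_(j < n) qvec q 0 j * (\1_B t * u t 0 j) - \1_B t * h t)).
      apply: eq_LI => t _; rewrite mulrBr /dotr mulr_sumr; congr (_ - _).
      by apply: eq_bigr => j _; rewrite mulrA mulrC.
    have Bu j : Lintegrable `[t0, T] (fun t => \1_B t * u t 0 j).
      by apply: Lintegrable_indicM; [exact: mD|exact: mB|exact: ui].
    have qBu j : Lintegrable `[t0, T] (fun t => qvec q 0 j * (\1_B t * u t 0 j)).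
      by apply: rintegrableZ; [exact: mD|exact: Bu].
    rewrite LIB; [|exact: mD|by apply: rintegrable_sum; [exact: mD|move=> j _; exact: qBu]|].
      congr (_ - _); rewrite LI_sum; [|exact: mD|exact: qBu].
      apply: eq_bigr => j _; rewrite LIZ; [|exact: mD|exact: Bu].
      congr (_ * _); rewrite !LI_indic setIA; congr (LI (_ `&` _)).
      by apply/seteqP; split => t; [move=> h1'; split => //; move: h1'; rewrite /= !in_itv/=; exact: in01|case].
    by apply: Lintegrable_indicM; [exact: mD|exact: mB|exact: hi].
  rewrite /w /w_ (Ed _ _ xi0 (hHi _)).
  have AH i : Lintegrable `[t0, T] (fun t => \1_(A i) t * H_ i t (X i t) (qvec q)).
    by apply: Lintegrable_indicM; [exact: mD|exact: mA|exact: H_i].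
  rewrite (funext (fun i => Ed _ _ (vi0 (phi i)) (AH (phi i)))).
  apply: cvgB.
    pose J (u : R -> 'rV[R]_n) : 'rV[R]_n :=
      \row_j LI `[0, T] (fun t => \1_(`[t0, T]%classic `&` B) t * u t 0 j).
    have JE (u : R -> 'rV[R]_n) : \sum_(j < n) qvec q 0 j * LI `[0, T] (fun t => \1_(`[t0, T]%classic `&` B) t * u t 0 j) =
        dotr (qvec q) (J u) by rewrite /dotr; apply: eq_bigr => j _; rewrite /J [in RHS]mxE.
    rewrite JE; under eq_fun do rewrite JE.
    apply: cvg_dotr.
    apply/(cvg_rowP (@eventually_filter)) => j; rewrite mxE; under eq_fun do rewrite mxE.
    by apply: cxi; exact: measurableI.
  have [||||_ h0] := @LI_dominated_ae R `[t0, T]%classic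
    (fun i t => \1_B t * (\1_(A (phi i)) t * H_ (phi i) t (X (phi i) t) (qvec q)))
    (fun t => \1_B t * H t (x t) (qvec q)) _ (mD t0 T) _ _ _
    (H_bound_integrable ci ki m0i t00 (enorm (qvec q : 'rV[R]_n)) r0).
  - move=> i; apply: Lintegrable_measurable.
    by apply: Lintegrable_indicM; [exact: mD|exact: mB|exact: AH].
  - apply: Lintegrable_measurable.
    by apply: Lintegrable_indicM; [exact: mD|exact: mB|exact: hHi].
  (* At t = t0 the indicators of [A (phi i)] may oscillate; after t0 they are eventually 1. *)
  - apply: (LaeS (Lae_neq t0)) => t tt0; rewrite /= in_itv/= => tt.
    apply: cvgM; first exact: cvg_cst.
    have ttT := in01 t tt.
    have hlphi i : HLC T k (H_ (phi i)) by have [] := hH_ (phi i).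
    have cHphi : H_ (phi i) t (x t) (qvec q) @[i --> \oo] --> H t (x t) (qvec q).
      exact: (cvg_comp _ _ cphi (@cH t (x t) (qvec q) (tin ttT))).
    have cHx := @H_joint_cvg R n T k (fun i => H_ (phi i)) _ _ _ _ _ ki hlphi (tin ttT) (cX t ttT) cHphi.
    apply: cvg_trans cHx; apply: near_eq_cvg.
    have : \forall i \near \oo, t_ (phi i) < t.
      apply: (cvgr_lt _ (cvg_comp _ _ cphi ct)).
      by rewrite lt_neqAle eq_sym tt0; case/andP: tt.
    apply: filterS => i ti; rewrite indicE mem_set ?mul1r//.
    by rewrite /A /= in_itv/= (ltW ti); case/andP: tt.
  - move=> i t; rewrite /= in_itv/= => tt; rewrite !normrM.
    have [g1 g2 g3 g4 gl] := hH_ (phi i).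
    apply: le_trans (H_traj_bound c0 ki g4 gl (hm_ (phi i)) (qvec q) r0 (tin (in01 t tt)) (Xr (phi i) t (in01 t tt))).
    rewrite -[leRHS]mul1r; apply: ler_pM => //; first exact: indic_le1.
    by rewrite -[leRHS]mul1r; apply: ler_wpM2r => //; exact: indic_le1.
  - exact: h0.
apply/ler_addgt0Pr => e e0; have e2 : 0 < e / 2 by rewrite divr_gt0.
have wl' q i t : t0 <= t <= T -> w_ q (phi i) t <= l (phi i) t by exact: w_l.
have := @runmax_limit R t0 T w (fun q i => w_ q (phi i)) (fun i => l (phi i)) wi
  (fun q i => w_i q (phi i)) (fun i => li (phi i)) wl' cw N setT (measurableT) _ e2.
rewrite (_ : (fun t => _) = runmax w N); last by apply/funext => t; rewrite indicT mul1r.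
move=> h.
(* This bounds |H_i t x 0| on the ball of radius r, hence all costs from below by - psi0. *)
pose psi0 t := m0 t + k r t * r.
have psi0i : Lintegrable `[0, T] psi0.
  apply: rintegrableD; [exact: mD|exact: m0i|].
  rewrite (_ : EFin \o _ = EFin \o (fun t => r * k r t)); last first.
    by apply/funext => t /=; rewrite mulrC.
  by apply: rintegrableZ; [exact: mD|exact: (ki r0).1].
have cpsi := ucont_cvg T0 (LI_ucont psi0i) t_T t0T ct.
have cpsi' : LI `[0, t_ (phi i)] psi0 @[i --> \oo] --> LI `[0, t0] psi0.
  exact: (cvg_comp _ _ cphi cpsi).
have /cvgrPdist_le/(_ _ e2) {}cpsi := cpsi'.
(* The limit cost is taken over [t0, T], the given one over [[t_ i], T]. If t_i < t0, the part
   dropped is at least the integral of - psi0 over the gap. *)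
have tail i : LI `[t0, T] (l i) <= cost (t_ i) T (a_ i) + `|LI `[0, t0] psi0 - LI `[0, t_ i] psi0|.
  have lb t : t_ i <= t <= T -> - psi0 t <= rsubmx (a_ i t) 0 0.
    move=> tt; have tT : 0 <= t <= T.
      by move: tt => /andP[h' ->]; rewrite (le_trans (t_0 i) h').
    have [g1 g2 g3 g4 gl] := hH_ i; have [_ /(_ t tt) Ea _] := adm_ i.
    apply: le_trans (epiE_cost_lb Ea); rewrite lerN2.
    apply: le_trans (ler_norm _) (HLC0 gl (hm_ i) r0 (tin tT) _ ((ki r0).2 t (tin tT))).
    by rewrite -XE//; exact: Xr.
  rewrite /l LI_indic /cost; have [t0i|/ltW it0] := leP t0 (t_ i).
    rewrite (_ : _ `&` _ = A i); first by rewrite lerDl.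
    apply/seteqP; split => t; first by case.
    by move=> h'; split => //; move: h'; rewrite /A /= !in_itv/= => /andP[h' ->]; rewrite (le_trans t0i h').
  rewrite (_ : _ `&` _ = `[t0, T]%classic); last first.
    apply/seteqP; split => t; first by case.
    by move=> h'; split => //; move: h'; rewrite /A /= !in_itv/= => /andP[h' ->]; rewrite (le_trans it0 h').
  rewrite (@LI_cat R (t_ i) t0 T); [|by rewrite it0|exact: admissible_cost (adm_ i)].
  rewrite addrAC lerDr; apply: (@le_trans _ _ (LI `[t_ i, t0] (fun t => -1 * psi0 t) +
      (LI `[0, t0] psi0 - LI `[0, t_ i] psi0))).
    rewrite (LI_sub (t_0 i) it0 (LintegrableS (lexx 0) t1 psi0i)) LIZ; last 2 first.
    - exact: mD.
    - exact: (LintegrableS (t_0 i) t1 psi0i).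
    by rewrite mulN1r addNr.
  apply: lerD; last exact: ler_norm.
  apply: LI_le; [exact: mD| | |].
  - by apply: rintegrableZ; [exact: mD|exact: (LintegrableS (t_0 i) t1 psi0i)].
  - exact: (LintegrableS (lexx _) t1 (admissible_cost (adm_ i))).
  - move=> t; rewrite /= in_itv/= mulN1r => /andP[h' h'']; apply: lb.
    by rewrite h' (le_trans h'' t1).
have fin : \forall i \near \oo, LI `[t0, T] (runmax w N) <= K + e.
  near=> i.
  have i1 : LI `[t0, T] (runmax w N) <= LI `[t0, T] (fun t => \1_setT t * l (phi i) t) + e / 2.
    by near: i.
  have i2 : cost (t_ (phi i)) T (a_ (phi i)) <= K by near: i.
  have i3 : `|LI `[0, t0] psi0 - LI `[0, t_ (phi i)] psi0| <= e / 2 by near: i.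
  apply: (le_trans i1); rewrite [e in leRHS]splitr addrA lerD2r; apply: le_trans (lerD i2 i3).
  rewrite (_ : (fun t => _) = l (phi i)); first exact: tail.
  by apply/funext => t; rewrite indicT mul1r.
by have [N0 _ /(_ N0 (leqnn _))] := fin.
Unshelve. all: by end_near. Qed.

End LowerLimit.

(** * Upper limit *)

Section Selection.
Context {R : realType} {n : nat}.
Local Notation mu := (@completed_lebesgue_measure R).
Local Notation LT := (LebT R).
Variables (T : R) (c : R -> R) (k : R -> R -> R) (G : R -> 'rV[R]_n -> 'rV[R]_n -> R).
Hypotheses (h1 : H1 T G) (h2 : H2 T G) (h3 : H3 T G) (h4 : H4 T c G) (hl : HLC T k G).
Hypothesis ki : forall r : R, 0 < r ->
     Lintegrable `[0, T] (k r) /\ (forall t, t \in `[0, T] -> 0 <= k r t).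

Definition sel t (y : 'rV[R]_n) (a : 'rV[R]_(n + 1)) : 'rV[R]_(n + 1) :=
  plim (fun j => hyp (qvec j)) (fun j => G t y (qvec j)) a.

Lemma hyp_neq0 (p : 'rV[R]_n) : hyp p != 0.
Proof.
apply/eqP => /rowP/(_ (rshift n 0)); rewrite row_mxEr !mxE eqxx => /eqP.
by rewrite oppr_eq0 oner_eq0.
Qed.

Lemma halfspaces_epiE t y : t \in `[0, T] ->
  halfspaces (fun j => hyp (qvec j)) (fun j => G t y (qvec j)) = epiE G t y.
Proof.
move=> tT; apply/seteqP; split => a; rewrite /halfspaces/= => h.
  by apply: (epiE_qvec h4 tT) => j; have := h j; rewrite dotr_hyp; lra.
by move=> j; rewrite dotr_hyp; move/epiEP/(_ (qvec j)): h; lra.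
Qed.

Lemma selP t y a : t \in `[0, T] -> epiE G t y (sel t y a) /\
  forall e, epiE G t y e -> enorm (sel t y a - a) <= 2 * enorm (e - a).
Proof.
move=> tT; have := @plimP R (n + 1) (fun j => hyp (qvec j)) (fun j => G t y (qvec j))
  (fun j => hyp_neq0 _) a.
by rewrite halfspaces_epiE// => /(_ (epiE_nonemptyH h3 h4 _ tT)) [].
Qed.

Lemma sel_measurable t0 (x : R -> 'rV[R]_n) (a : R -> 'rV[R]_(n + 1)) j : 0 <= t0 -> t0 <= T ->
  (forall j, ucont t0 T (fun t => x t 0 j)) ->
  (forall j, measurable_fun (`[t0, T]%classic : set LT) (fun t => a t 0 j)) ->
  measurable_fun (`[t0, T]%classic : set LT) (fun t => sel t (x t) (a t) 0 j).
Proof.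
move=> t00 t0T ux ma; set D := `[t0, T]%classic.
have mD : measurable (D : set LT) := itv_Lmeasurable _.
pose u i : 'rV[R]_(n + 1) := hyp (qvec i).
pose b t i := G t (x t) (qvec i).
have md (f : R -> 'rV[R]_(n + 1)) p : (forall j, measurable_fun (D : set LT) (fun t => f t 0 j)) ->
    measurable_fun (D : set LT) (fun t => dotr (f t) p).
  by move=> mf; apply: measurable_sum => i; apply: measurable_funM; [exact: mf|exact: measurable_cst].
have mp i : forall j, measurable_fun (D : set LT) (fun t => piter u (b t) (a t) i 0 j).
  elim: i => [|i IH] j' /=; first exact: ma.
  rewrite /pstep (_ : (fun t => _) = fun t => piter u (b t) (a t) i 0 j' -
      \sum_(l < i) (2 ^- l.+1 * (Num.max 0 (dotr (piter u (b t) (a t) i) (u l) - b t l) / dotr (u l) (u l))) * u l 0 j').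
    apply: measurable_funB; first exact: IH.
    apply: measurable_sum => l; apply: measurable_funM; last exact: measurable_cst.
    apply: measurable_funM; first exact: measurable_cst.
    apply: measurable_funM; last exact: measurable_cst.
    apply: measurable_maxr; first exact: measurable_cst.
    apply: measurable_funB; first exact: md.
    exact: H_traj_measurable.
  by apply/funext => t; rewrite !mxE summxE; congr (_ - _); apply: eq_bigr => l _; rewrite !mxE.
apply: (@measurable_fun_cvg _ LT R D (fun i t => piter u (b t) (a t) i 0 j)) => // t.
rewrite /D/= in_itv/= => tt; have tT := in0T t00 tt.
have := @plimP R (n + 1) u (b t) (fun j => hyp_neq0 _) (a t).
rewrite (halfspaces_epiE (x t) tT) => /(_ (epiE_nonemptyH h3 h4 _ tT)) [_ cp _].
exact: ((cvg_rowP (@eventually_filter) _ _).1 cp j).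
Qed.

(** Passing from x to y violates the constraint of p by at most k r t |y - x| (1 + |p|). [epiE_near]
    and the almost nearest selection each contribute a factor 2. *)
Lemma epiE_lip r t x y a : 0 < r -> t \in `[0, T] -> enorm x <= r -> enorm y <= r ->
  epiE G t x a -> enorm (sel t y a - a) <= 4 * k r t * enorm (y - x).
Proof.
move=> r0 tT xr yr /epiEP Ea; have k0 := (ki r0).2 t tT.
have [|||b Eb ba] := @epiE_near R n G t y a (k r t * enorm (y - x)).
- by move=> p q lam; exact: h3.
- by rewrite mulr_ge0// enorm_ge0.
- move=> p; have := hl r0 tT p yr xr; have := Ea p.
  have := ler_norm (G t x p - G t y p); rewrite distrC; lra.
have [_ /(_ b Eb)] := selP y a tT; lra.
Qed.

Lemma epiE_closed t x_ x a_ a : t \in `[0, T] -> x_ @ \oo --> x -> a_ @ \oo --> a ->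
  (forall i : nat, epiE G t (x_ i) (a_ i)) -> epiE G t x a.
Proof.
move=> tT cx ca Ea; apply/epiEP => p.
have cG : G t (x_ i) p @[i --> \oo] --> G t x p.
  exact: (@H_joint_cvg R n T k (fun=> G) x_ x p t _ ki (fun=> hl) tT cx (cvg_cst _)).
rewrite lerBlDr -lerBlDl -dotr_hyp dotrC.
have cd := @cvg_dotr R _ _ _ (@eventually_filter) _ _ (hyp p) ca.
apply: (ler_cvg_to cd cG).
by apply: nearW => i; rewrite dotrC dotr_hyp; move/epiEP/(_ p): (Ea i); lra.
Qed.

End Selection.

Section GeometricLimits.
Context {R : realType} {n : nat}.

Lemma enorm_telescope (u : nat -> 'rV[R]_n) (b : R) :
  (forall i, enorm (u i.+1 - u i) <= b * 2 ^- i) ->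
  forall i d, enorm (u (i + d)%N - u i) <= 2 * b * (2 ^- i - 2 ^- (i + d)).
Proof.
move=> h i; elim=> [|d IH]; first by rewrite addn0 !subrr mulr0 enorm0.
apply: le_trans (enorm_triangle _ (u (i + d)%N) _) _.
rewrite addrC addnS; apply: le_trans (lerD IH (h _)) _.
by rewrite exprS invfM; lra.
Qed.

Lemma enorm_geometric_cvg (u : nat -> 'rV[R]_n) (b : R) :
  (forall i, enorm (u i.+1 - u i) <= b * 2 ^- i) ->
  exists2 l : 'rV[R]_n, u @ \oo --> l & forall i, enorm (l - u i) <= 2 * b * 2 ^- i.
Proof.
move=> h; have b0 : 0 <= b by have := h 0%N; rewrite expr0 invr1 mulr1; apply: le_trans; exact: enorm_ge0.
have tail i d : enorm (u (i + d)%N - u i) <= 2 * b * 2 ^- i.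
  apply: le_trans (enorm_telescope h i d) _; apply: ler_wpM2l; first by rewrite mulr_ge0.
  by rewrite gerBl invr_ge0 exprn_ge0.
have small e : 0 < e -> exists i, 2 * b * 2 ^- i <= e.
  move=> e0; have z1 : `|2^-1 : R| < 1 by rewrite ger0_norm ?invr_ge0// invf_lt1// ltr1n.
  have /cvgrPdist_le/(_ _ e0)[N _ /(_ N (leqnn _))/= hN] := cvg_geometric (2 * b) z1.
  exists N; move: hN; rewrite sub0r normrN exprVn; apply: le_trans; exact: ler_norm.
have cj j : cvgn (fun i => u i 0 j).
  apply/cauchy_cvgP; apply: cauchy_exP => e e0.
  have [i hi] := small (e / 2) (divr_gt0 e0 (ltr0n _ 2)).
  exists (u i 0 j); exists i => // m /= im; rewrite /ball/=.
  have := coord_le_enorm (u i - u m) j; rewrite !mxE => /le_lt_trans; apply.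
  rewrite enormBC -(subnKC im); apply: le_lt_trans (tail _ _) _.
  by apply: le_lt_trans hi _; rewrite ltr_pdivrMr// mulr_natr mulr2n ltrDl.
pose l : 'rV[R]_n := \row_j limn (fun i => u i 0 j).
have cl : u @ \oo --> l.
  by apply/(cvg_rowP (@eventually_filter)) => j; rewrite mxE; exact: cj.
exists l => // i; apply/ler_addgt0Pr => e e0.
have [N _ hN] := (cvg_enormP (@eventually_filter) _ _).1 cl e e0.
apply: le_trans (enorm_triangle _ (u (i + N)%N) _) _.
rewrite addrC lerD// enormBC; apply: hN => /=; exact: leq_addl.
Qed.

End GeometricLimits.

(** Adds one increment to the partial sum of the geometric series, with q = 2^-i. *)
Lemma half_step {R : realFieldType} (p q f : R) :
  f <= p * q -> 2 * p * (1 - q) + f <= 2 * p * (1 - 2^-1 * q).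
Proof. by lra. Qed.

Lemma coord_sub {R : realType} {n : nat} (u v : 'rV[R]_n) j : u 0 j = v 0 j + (u - v) 0 j.
Proof. by rewrite !mxE addrCA subrr addr0. Qed.

(** * Filippov's iteration *)

Section Filippov.
Context {R : realType} {n : nat}.
Local Notation mu := (@completed_lebesgue_measure R).
Local Notation LT := (LebT R).
Variables (T t0 : R) (c : R -> R) (k : R -> R -> R) (G : R -> 'rV[R]_n -> 'rV[R]_n -> R).
Hypotheses (h1 : H1 T G) (h2 : H2 T G) (h3 : H3 T G) (h4 : H4 T c G) (hl : HLC T k G).
Hypothesis ki : forall r : R, 0 < r ->
     Lintegrable `[0, T] (k r) /\ (forall t, t \in `[0, T] -> 0 <= k r t).
Hypotheses (t00 : 0 <= t0) (t0T : t0 <= T).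
Variables (r : R) (x : R -> 'rV[R]_n) (a : R -> 'rV[R]_(n + 1)) (y : 'rV[R]_n) (e : R).
Hypotheses (r0 : 0 < r) (ux : forall j, ucont t0 T (fun t => x t 0 j)).
Hypothesis xr : forall t, t0 <= t <= T -> enorm (x t) + 1 <= r.
Hypothesis ai : forall j, Lintegrable `[t0, T] (fun t => a t 0 j).
Hypothesis Ea : forall t, t0 <= t <= T -> epiE G t (x t) (a t).

(** The 4 is the constant of [epiE_lip], and n comes from estimating a vector integral by its
    coordinates in [backward_dist]. *)
Definition lipw t := 4 * n%:R * `|k r t|.
Definition lipE := expR (2 * LI `[t0, T] lipw).

(* [y - \int_t^T lsub b], written with integrals from t0. *)
Definition backward (b : R -> 'rV[R]_(n + 1)) t : 'rV[R]_n :=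
  \row_j (y 0 j - LI `[t0, T] (fun s => lsubmx (b s) 0 j) + LI `[t0, t] (fun s => lsubmx (b s) 0 j)).

Hypothesis xe : forall t, t0 <= t <= T -> enorm (backward a t - x t) <= e.
Let C := e * lipE.
(** All iterates stay within distance 1 of x, hence in the ball of radius r where k r is a Lipschitz
    constant. *)
Hypothesis C1 : 2 * (e * lipE) <= 1.

(* Each step integrates the last control backward from y and projects that control onto the
   epigraphs along the new curve. *)
Fixpoint fil i : (R -> 'rV[R]_n) * (R -> 'rV[R]_(n + 1)) :=
  if i is i'.+1 then
    let: x' := backward (fil i').2 in (x', fun t => sel G t (x' t) ((fil i').2 t))
  else (x, a).

Let X i := (fil i).1.
Let A i := (fil i).2.
Let phi t := expR (- 2 * LI `[t0, t] lipw).

Let mD (p q : R) : measurable (`[p, q]%classic : set LT) := itv_Lmeasurable _.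
Let tin t : t0 <= t <= T -> t \in `[0, T]. Proof. exact: in0T. Qed.
Let wi : Lintegrable `[t0, T] lipw.
Proof.
apply: rintegrableZ; first exact: mD.
by apply: Rintegrable_norm; exact: (LintegrableS t00 (lexx T) (ki r0).1).
Qed.
Let w0 t : 0 <= lipw t. Proof. by rewrite !mulr_ge0. Qed.
Let e0 : 0 <= e. Proof. by apply: le_trans (xe (t := t0) _); rewrite ?enorm_ge0 ?lexx. Qed.
Let C0 : 0 <= C. Proof. by rewrite mulr_ge0 ?e0// expR_ge0. Qed.

Let vel_int (b : R -> 'rV[R]_(n + 1)) j : (forall j, Lintegrable `[t0, T] (fun t => b t 0 j)) ->
  Lintegrable `[t0, T] (fun t => lsubmx (b t) 0 j).
Proof.
move=> bi; rewrite (_ : (fun t => _) = fun t => b t 0 (lshift 1 j)); first exact: bi.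
by apply/funext => t; rewrite mxE.
Qed.

Lemma backward_ucont (b : R -> 'rV[R]_(n + 1)) : (forall j, Lintegrable `[t0, T] (fun t => b t 0 j)) ->
  forall j, ucont t0 T (fun t => backward b t 0 j).
Proof.
move=> bi j; rewrite (_ : (fun t => _) = fun t => y 0 j - LI `[t0, T] (fun s => lsubmx (b s) 0 j) +
    LI `[t0, t] (fun s => lsubmx (b s) 0 j)); last by apply/funext => t; rewrite mxE.
by apply: ucontD; [exact: ucont_cst|apply: LI_ucont; exact: vel_int].
Qed.

Let X_ucont i : (forall j, Lintegrable `[t0, T] (fun t => A i t 0 j)) ->
  forall j, ucont t0 T (fun t => X i.+1 t 0 j).
Proof. exact: backward_ucont. Qed.

Let AE i t : t0 <= t <= T -> epiE G t (X i t) (A i t).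
Proof. by case: i => [|i] tt; [exact: Ea|exact: (selP h3 h4 _ _ (tin tt)).1]. Qed.

Let phi_le1 t : phi t <= 1.
Proof.
rewrite -expR0 ler_expR mulNr oppr_le0 mulr_ge0//; apply: LI_ge0 => s _; exact: w0.
Qed.

Let phi_ge0 t : 0 <= phi t. Proof. exact: expR_ge0. Qed.

Let phi_int : Lintegrable `[t0, T] (fun t => lipw t * phi t) /\
  forall t, t0 <= t <= T -> 2 * LI `[t, T] (fun s => lipw s * phi s) <= phi t.
Proof.
have [_ i1 i2] := expK_FTC (- 2) t0T wi w0; split => // t /andP[t1 t2].
have := i2 t T t1 t2 (lexx T); have := phi_ge0 T; rewrite /phi mulNr; lra.
Qed.

(** [lipE] is the reciprocal of phi T, the least value of the weight, so that C phi dominates the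
    initial error e at every time. *)
Let e_phi t : t0 <= t <= T -> e <= C * phi t.
Proof.
move=> /andP[t1 t2]; rewrite /C /lipE /phi -mulrA -expRD ler_peMr ?e0//.
rewrite -[leLHS]expR0 ler_expR mulNr -mulrBr mulr_ge0//.
rewrite (@LI_cat R t0 t T lipw) ?t1 ?t2//.
rewrite addrC addKr; apply: LI_ge0 => s _; exact: w0.
Qed.

Let step i t : t0 <= t <= T -> enorm (X i t) <= r -> enorm (X i.+1 t) <= r ->
  enorm (A i.+1 t - A i t) <= 4 * k r t * enorm (X i.+1 t - X i t).
Proof. by move=> tt h h'; exact: (epiE_lip h3 h4 hl ki r0 (tin tt) h h' (AE i tt)). Qed.

Lemma backward_dist (b b' : R -> 'rV[R]_(n + 1)) (beta : R -> R) :
  (forall j, Lintegrable `[t0, T] (fun t => b t 0 j)) ->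
  (forall j, Lintegrable `[t0, T] (fun t => b' t 0 j)) -> Lintegrable `[t0, T] beta ->
  (forall t, t0 <= t <= T -> enorm (b t - b' t) <= beta t) ->
  forall t, t0 <= t <= T -> enorm (backward b t - backward b' t) <= n%:R * LI `[t, T] beta.
Proof.
move=> bi b'i betai bb t /andP[t1 t2]; apply: le_trans (enorm_le_sum _) _.
apply: (@le_trans _ _ (\sum_(j < n) LI `[t, T] beta)); last first.
  by rewrite sumr_const card_ord mulr_natl.
apply: ler_sum => j _; rewrite !mxE.
have vi := vel_int j bi; have v'i := vel_int j b'i.
have tt : t0 <= t <= T by rewrite t1 t2.
rewrite (@LI_cat R t0 t T _ tt vi) (@LI_cat R t0 t T _ tt v'i).
rewrite (_ : _ - _ = - (LI `[t, T] (fun s => lsubmx (b s) 0 j) - LI `[t, T] (fun s => lsubmx (b' s) 0 j))); last by ring.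
rewrite normrN -LIB; [|exact: mD|exact: (LintegrableS t1 (lexx T))|exact: (LintegrableS t1 (lexx T))].
apply: LI_bound; [exact: mD| |exact: (LintegrableS t1 (lexx T))|].
  apply: rintegrableB; [exact: mD|exact: (LintegrableS t1 (lexx T))|exact: (LintegrableS t1 (lexx T))].
move=> s; rewrite /= in_itv/= => /andP[s1 s2].
apply: le_trans (bb s _); last by rewrite (le_trans t1 s1).
by have := coord_le_enorm (b s - b' s) (lshift 1 j); rewrite !mxE.
Qed.

Let ball_r i t : t0 <= t <= T -> enorm (X i t - x t) <= 2 * C * (1 - 2 ^- i) -> enorm (X i t) <= r.
Proof.
move=> tt h; apply: le_trans (enorm_le_dist _ (x t)) _; apply: le_trans (xr tt).
rewrite lerD2l; apply: (le_trans h); apply: le_trans C1.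
by apply: ler_piMr; [rewrite mulr_ge0 ?C0|rewrite gerBl invr_ge0 exprn_ge0].
Qed.

Let kphi_int : Lintegrable `[t0, T] (fun t => 4 * `|k r t| * phi t).
Proof.
apply: (@Lintegrable_mul_bounded R _ (fun t => 4 * `|k r t|) phi 1).
- exact: mD.
- by apply: rintegrableZ; [exact: mD|apply: Rintegrable_norm; exact: (LintegrableS t00 (lexx T) (ki r0).1)].
- have [ac _ _] := expK_FTC (- 2) t0T wi w0.
  by apply: (ucont_measurable t0T); exact: acont_ucont.
- by move=> t _; rewrite (ger0_norm (phi_ge0 t)) phi_le1.
Qed.

Let C_phi_int i : Lintegrable `[t0, T] (fun t => 4 * `|k r t| * (C * 2 ^- i * phi t)).
Proof.
rewrite (_ : (fun t => _) = fun t => (C * 2 ^- i) * (4 * `|k r t| * phi t)).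
  by apply: rintegrableZ; [exact: mD|exact: kphi_int].
by apply/funext => s; ring.
Qed.

Let step_bound i t : t0 <= t <= T -> enorm (X i t - x t) <= 2 * C * (1 - 2 ^- i) ->
  enorm (X i.+1 t - x t) <= 2 * C * (1 - 2 ^- i.+1) ->
  enorm (X i.+1 t - X i t) <= C * 2 ^- i * phi t ->
  enorm (A i.+1 t - A i t) <= 4 * `|k r t| * (C * 2 ^- i * phi t).
Proof.
move=> tt b1 b2 d; apply: le_trans (step tt (ball_r tt b1) (ball_r tt b2)) _.
apply: ler_pM; [by rewrite mulr_ge0//; exact: (ki r0).2 (tin tt)|exact: enorm_ge0| |exact: d].
by apply: ler_wpM2l => //; exact: ler_norm.
Qed.

(** One joint induction: integrability of the control makes the next curve meaningful, closeness to
    x gives access to the Lipschitz constant, and the weighted increment bound keeps the next curve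
    close. *)
Let fil_bounds i : (forall j, Lintegrable `[t0, T] (fun t => A i t 0 j)) /\
  forall t, t0 <= t <= T -> enorm (X i t - x t) <= 2 * C * (1 - 2 ^- i) /\
    enorm (X i.+1 t - X i t) <= C * 2 ^- i * phi t.
Proof.
elim: i => [|i [IHi IH]].
  split=> [j|t tt]; first exact: ai.
  split; first by change (X 0%N t) with (x t); rewrite (subrr (x t)) enorm0 expr0 invr1 (subrr (1 : R)) mulr0 lexx.
  by rewrite expr0 invr1 mulr1; exact: le_trans (xe tt) (e_phi tt).
have nx t : t0 <= t <= T -> enorm (X i.+1 t - x t) <= 2 * C * (1 - 2 ^- i.+1).
  move=> tt; have [b1 b2] := IH t tt.
  apply: le_trans (enorm_triangle _ (X i t) _) _; rewrite addrC.
  apply: le_trans (lerD b1 b2) _.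
  rewrite exprS invfM; apply: half_step.
  by rewrite ler_piMr ?phi_le1// mulr_ge0 ?C0// invr_ge0 exprn_ge0.
have sb t : t0 <= t <= T -> enorm (A i.+1 t - A i t) <= 4 * `|k r t| * (C * 2 ^- i * phi t).
  by move=> tt; have [b1 b2] := IH t tt; exact: step_bound b1 (nx t tt) b2.
have Ai : forall j, Lintegrable `[t0, T] (fun t => A i.+1 t 0 j).
  move=> j; apply: (@Lintegrable_dom R _ _ (fun t => `|A i t 0 j| + 4 * `|k r t| * (C * 2 ^- i * phi t))).
  - exact: mD.
  - apply: (sel_measurable h1 h2 h3 h4 _ t00 t0T); first exact: X_ucont.
    by move=> j'; exact: Lintegrable_measurable (IHi j').
  - by apply: rintegrableD; [exact: mD|exact: Rintegrable_norm|exact: C_phi_int].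
  - move=> t; rewrite /= in_itv/= => tt.
    rewrite (coord_sub (A i.+1 t) (A i t)).
    apply: le_trans (ler_normD _ _) _; rewrite lerD2l.
    by apply: le_trans (coord_le_enorm _ _) (sb t tt).
split; first exact: Ai.
move=> t tt; split; first exact: nx.
(* The factor n and the 4 recombine to [lipw], and [phi_int] bounds its integral against phi by phi
   / 2: this is the ratio 1/2. *)
apply: le_trans (backward_dist Ai IHi (C_phi_int i) sb tt) _.
have [pi0 pi1] := phi_int; have := pi1 t tt; have /andP[t1 t2] := tt.
have -> : (fun t => 4 * `|k r t| * (C * 2 ^- i * phi t)) = fun t => (C * 2 ^- i) * (4 * `|k r t| * phi t).
  by apply/funext => s; ring.
have kphi := LintegrableS t1 (lexx T) kphi_int.
rewrite LIZ; [|exact: mD|exact: kphi].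
rewrite (_ : (fun s => lipw s * phi s) = fun s => n%:R * (4 * `|k r s| * phi s)); last first.
  by apply/funext => s; rewrite /lipw; ring.
rewrite LIZ; [|exact: mD|exact: kphi].
rewrite exprS invfM => h.
have Ci0 : 0 <= C * 2 ^- i by rewrite mulr_ge0 ?C0// invr_ge0 exprn_ge0.
have := ler_wpM2l Ci0 h; lra.
Qed.

(* With the weight [phi] of the form [exp (- 2 \int lipw)], the distances of successive curves
   decrease geometrically with ratio 1/2. *)
Lemma filippov : exists x' a', [/\ admissible G t0 T x' a', x' T = y,
  forall t, t0 <= t <= T -> enorm (x' t - x t) <= 2 * (e * lipE) &
  forall t, t0 <= t <= T -> enorm (a' t - a t) <= 8 * `|k r t| * (e * lipE)].
Proof.
pose beta t := 4 * `|k r t| * C.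
have beta0 t : 0 <= beta t by rewrite mulr_ge0 ?C0// mulr_ge0.
have At t : t0 <= t <= T -> forall i, enorm (A i.+1 t - A i t) <= beta t * 2 ^- i.
  move=> tt i; have [_ /(_ t tt) [b1 b2]] := fil_bounds i.
  have [_ /(_ t tt) [b3 _]] := fil_bounds i.+1.
  apply: le_trans (step_bound tt b1 b3 b2) _; rewrite /beta -[leRHS]mulrA.
  apply: ler_wpM2l; first by rewrite mulr_ge0.
  apply: ler_piMr; last exact: phi_le1.
  by apply: mulr_ge0; [exact: C0|rewrite invr_ge0 exprn_ge0].
pose a' t : 'rV[R]_(n + 1) := \row_j limn (fun i => A i t 0 j).
have cA t : t0 <= t <= T -> A i t @[i --> \oo] --> a' t /\
    forall i, enorm (a' t - A i t) <= 2 * beta t * 2 ^- i.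
  move=> tt; have [l cl hl'] := enorm_geometric_cvg (At t tt).
  suff -> : a' t = l by [].
  apply/rowP => j; rewrite mxE; apply: cvg_lim; first exact: norm_hausdorff.
  exact: ((cvg_rowP (@eventually_filter) _ _).1 cl j).
have Ai i j : Lintegrable `[t0, T] (fun t => A i t 0 j) by exact: (fil_bounds i).1.
have cAj t j : t0 <= t <= T -> A i t 0 j @[i --> \oo] --> a' t 0 j.
  by move=> tt; exact: ((cvg_rowP (@eventually_filter) _ _).1 (cA t tt).1 j).
have betai : Lintegrable `[t0, T] beta.
  rewrite (_ : beta = fun t => (4 * C) * `|k r t|); last by apply/funext => t; rewrite /beta mulrAC.
  apply: rintegrableZ; first exact: mD.
  by apply: Rintegrable_norm; exact: (LintegrableS t00 (lexx T) (ki r0).1).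
(* Both [A i t] and [A 0 t], which is [a t], are within 2 beta of the limit, so one integrable
   function dominates all controls. *)
have A_dom i j t : t0 <= t <= T -> `|A i t 0 j| <= `|a t 0 j| + 4 * beta t.
  move=> tt; have [_ hA] := cA t tt.
  have := lerD (hA i) (hA 0%N); rewrite enormBC => h.
  have h' := le_trans (enorm_triangle (A i t) (a' t) (A 0%N t)) h.
  change (a t) with (A 0%N t).
  rewrite (coord_sub (A i t) (A 0%N t)).
  apply: le_trans (ler_normD _ _) _; rewrite lerD2l.
  apply: le_trans (coord_le_enorm _ _) _; apply: (le_trans h').
  have : 2 ^- i <= 1 :> R by rewrite invf_le1 ?exprn_gt0// exprn_ege1// ler1n.
  have := beta0 t; rewrite expr0 invr1; nra.
have domi j : Lintegrable `[t0, T] (fun t => `|a t 0 j| + 4 * beta t).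
  apply: rintegrableD; [exact: mD|exact: Rintegrable_norm|].
  by apply: rintegrableZ; [exact: mD|exact: betai].
have A_lim j s t : t0 <= s -> t <= T -> Lintegrable `[s, t] (fun t => a' t 0 j) /\
    LI `[s, t] (fun t => A i t 0 j) @[i --> \oo] --> LI `[s, t] (fun t => a' t 0 j).
  move=> t0s tT; apply: (LI_dominated (mD s t) _ _ (LintegrableS t0s tT (domi j))).
  - by move=> i; apply: Lintegrable_measurable; exact: (LintegrableS t0s tT (Ai i j)).
  - move=> q; rewrite /= in_itv/= => /andP[sq qt]; apply: cAj.
    by rewrite (le_trans t0s sq) (le_trans qt tT).
  - move=> i q; rewrite /= in_itv/= => /andP[sq qt]; apply: A_dom.
    by rewrite (le_trans t0s sq) (le_trans qt tT).
have a'i j : Lintegrable `[t0, T] (fun t => a' t 0 j) by exact: (A_lim j t0 T (lexx _) (lexx _)).1.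
pose x' := backward a'.
have cX t : t0 <= t <= T -> X i t @[i --> \oo] --> x' t.
  move=> /andP[t1 t2]; rewrite -(cvg_shiftS (fun i => X i t)).
  apply/(cvg_rowP (@eventually_filter)) => j; rewrite mxE.
  have lE (f : R -> 'rV[R]_(n + 1)) : (fun s => lsubmx (f s) 0 j) = fun s => f s 0 (lshift 1 j).
    by apply/funext => s; rewrite mxE.
  rewrite (_ : (fun i => _) = fun i => y 0 j - LI `[t0, T] (fun s => A i s 0 (lshift 1 j)) +
     LI `[t0, t] (fun s => A i s 0 (lshift 1 j))); last by apply/funext => i; rewrite mxE !lE.
  rewrite !lE; apply: cvgD; last exact: (A_lim _ _ _ (lexx _) t2).2.
  by apply: cvgB; [exact: cvg_cst|exact: (A_lim _ _ _ (lexx _) (lexx _)).2].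
have Ea' t : t0 <= t <= T -> epiE G t (x' t) (a' t).
  move=> tt; apply: (epiE_closed hl ki (tin tt) (cX t tt) (cA t tt).1) => i.
  exact: AE.
exists x', a'; split.
- split => [j|t tt|t j /andP[t1 t2]]; [exact: a'i|exact: Ea'|].
  by rewrite !mxE set_itv1 LI_set1 addr0.
- by apply/rowP => j; rewrite mxE subrK.
- move=> t tt; apply/ler_addgt0Pr => d d0.
  have [N _ /(_ N (leqnn _)) hN] := (cvg_enormP (@eventually_filter) _ _).1 (cX t tt) d d0.
  apply: le_trans (enorm_triangle _ (X N t) _) _; rewrite addrC; apply: lerD; last by rewrite enormBC.
  have [_ /(_ t tt) [b1 _]] := fil_bounds N; apply: (le_trans b1).
  change (2 * (e * lipE)) with (2 * C).
  by apply: ler_piMr; [rewrite mulr_ge0 ?C0|rewrite gerBl invr_ge0 exprn_ge0].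
- move=> t tt; have [_ /(_ 0%N)] := cA t tt; rewrite expr0 invr1 mulr1.
  have -> : 2 * beta t = 8 * `|k r t| * (e * lipE) by rewrite /beta /C; ring.
  exact.
Qed.


End Filippov.

Lemma admissible_ucont {R : realType} {n : nat} (H : R -> 'rV[R]_n -> 'rV[R]_n -> R) t0 T x a :
  t0 <= T -> admissible H t0 T x a -> forall j, ucont t0 T (fun t => x t 0 j).
Proof.
move=> t0T adm j; have [_ _ xE] := adm.
have uj := ucontD (ucont_cst t0 T (x t0 0 j)) (LI_ucont (admissible_vel j adm)).
move=> e e0; have [d d0 hd] := uj e e0; exists d => // s t as_ st tb std.
have := hd s t as_ st tb std; rewrite -!xE//.
  by rewrite as_ (le_trans st).
by rewrite (le_trans as_).
Qed.

Lemma coord_dist_le {R : realType} {n : nat} (u v : 'rV[R]_n) j : `|u 0 j - v 0 j| <= enorm (u - v).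
Proof. by have := coord_le_enorm (u - v) j; rewrite !mxE. Qed.

Lemma lsubE {R : realType} {n : nat} (u : 'rV[R]_(n + 1)) j : lsubmx u 0 j = u 0 (lshift 1 j).
Proof. by rewrite mxE. Qed.

Lemma rsubE {R : realType} {n : nat} (u : 'rV[R]_(n + 1)) : rsubmx u 0 0 = u 0 (rshift n 0).
Proof. by rewrite mxE. Qed.

Lemma cvg_sum_seq {R : realType} (I : Type) (s : seq I) (u : nat -> I -> R) (l : I -> R) :
  (forall j, u i j @[i --> \oo] --> l j) ->
  \sum_(j <- s) u i j @[i --> \oo] --> \sum_(j <- s) l j.
Proof.
move=> ul; elim: s => [|j s IH].
  by rewrite big_nil; under eq_fun do rewrite big_nil; exact: cvg_cst.
by rewrite big_cons; under eq_fun do rewrite big_cons; exact: cvgD.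
Qed.

(** Two Hamiltonians bounded by B + D |p| differ by at most twice that; the product form is the one
    [epiE_near] takes. *)
Lemma linear_growth_arith {R : realFieldType} (B D q h h' ah ah' v r : R) : 0 <= B -> 0 <= D ->
  0 <= q -> - h' <= ah' -> h <= ah -> ah' <= B + D * q -> ah <= B + D * q -> v - h <= r ->
  v - r - h' <= 2 * (B + D) * (1 + q).
Proof. by move=> B0 D0 q0 *; have := mulr_ge0 B0 q0; nra. Qed.

(** Here hp, hq and h0 are the values of a convex function at p, lam p and 0: a violation at p,
    scaled by lam, is controlled by the violation at lam p and the value at 0. *)
Lemma convexity_arith {R : realFieldType} (lam d B v r hp hq h0 ar : R) :
  hq <= lam * hp + (1 - lam) * h0 -> 0 <= lam -> 0 <= 1 - lam -> r <= ar -> 0 <= ar -> 0 <= B ->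
  h0 <= B -> lam * v - r - hq <= d -> lam * (v - r - hp) <= d + B + ar.
Proof.
move=> h l0 l1 rar ar0 B0 hB hd.
have := mulr_ge0 l1 (_ : 0 <= ar - r); rewrite subr_ge0 => /(_ rar).
have := mulr_ge0 l1 (_ : 0 <= B - h0); rewrite subr_ge0 => /(_ hB).
have := mulr_ge0 l0 ar0; have := mulr_ge0 l0 B0; lra.
Qed.

(** * Approximation of an admissible pair *)

Section Recovery.
Context {R : realType} {n : nat}.
Local Notation mu := (@completed_lebesgue_measure R).
Local Notation LT := (LebT R).
Variables (T : R) (c : R -> R) (k : R -> R -> R) (m0 : R -> R)
  (H_ : nat -> R -> 'rV[R]_n -> 'rV[R]_n -> R) (H : R -> 'rV[R]_n -> 'rV[R]_n -> R).
Hypotheses (ci : Lintegrable `[0, T] c) (c0 : forall t, t \in `[0, T] -> 0 <= c t).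
Hypothesis ki : forall r : R, 0 < r ->
     Lintegrable `[0, T] (k r) /\ (forall t, t \in `[0, T] -> 0 <= k r t).
Hypothesis m0i : Lintegrable `[0, T] m0.
Hypotheses (hH_ : forall i, [/\ H1 T (H_ i), H2 T (H_ i), H3 T (H_ i), H4 T c (H_ i)
               & HLC T k (H_ i)]) (hm_ : forall i t, t \in `[0, T] -> `|H_ i t 0 0| <= m0 t).
Hypotheses (hH : [/\ H1 T H, H2 T H, H3 T H, H4 T c H & HLC T k H])
  (hm : forall t, t \in `[0, T] -> `|H t 0 0| <= m0 t).
Hypothesis cH : forall t, t \in `[0, T] ->
     forall K : set ('rV[R]_n * 'rV[R]_n), compact K ->
     forall eps : R, 0 < eps ->
       \forall i \near \oo, forall z, K z -> `|H_ i t z.1 z.2 - H t z.1 z.2| < eps.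

Let mD (p q : R) : measurable (`[p, q]%classic : set LT) := itv_Lmeasurable _.

(* Beyond the ball of radius rho the violation is controlled by convexity of
   H_i from its values at 0 and on the sphere. *)
Lemma sel_cvg t x a eta : t \in `[0, T] -> epiE H t x a -> 0 < eta ->
  \forall i \near \oo, enorm (sel (H_ i) t x a - a) <= eta.
Proof.
(* A violation d costs a factor 2 in [epiE_near] and another 2 in the selection. *)
move=> tT /epiEP Ea eta0; pose d := eta / 4.
have d0 : 0 < d by rewrite divr_gt0.
pose r := enorm x + 1; have r0 : 0 < r by rewrite ltr_wpDl// enorm_ge0.
have xr : enorm x <= r by rewrite lerDl.
pose B := m0 t + k r t * r.
have HB i : `|H_ i t x 0| <= B.
  by have [_ _ _ _ gl] := hH_ i; exact: HLC0 gl (hm_ i) r0 tT xr ((ki r0).2 t tT).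
have B0 : 0 <= B by apply: le_trans (HB 0%N).
(* Chosen so that d rho is the bound of [convexity_arith]; after division by lam = rho / |p| the
   violation at p is at most d |p|. *)
pose rho := (d + B + `|rsubmx a 0 0|) / d.
have rho0 : 0 < rho by rewrite divr_gt0// ltr_wpDr// ltr_wpDr.
have rhod : d * rho = d + B + `|rsubmx a 0 0| by rewrite mulrC divfK// gt_eqF.
pose box : set 'rV[R]_n := [set p | forall j, `[- rho, rho]%classic (p 0 j)].
have cbox : compact box by exact: (@rV_compact R n (fun=> `[- rho, rho]%classic) (fun=> @segment_compact R _ _)).
have := cH tT (compact_setX (@compact_set1 _ x) cbox) d0; apply: filterS => i hi.
have {}hi p : enorm p <= rho -> `|H_ i t x p - H t x p| < d.
  move=> pr; apply: (hi (x, p)); split; first by [].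
  by move=> j; rewrite /= in_itv/= -ler_norml; exact: le_trans (coord_le_enorm _ _) pr.
have [g1 g2 g3 g4 gl] := hH_ i.
pose viol p := dotr (lsubmx a) p - rsubmx a 0 0 - H_ i t x p.
have near_v p : enorm p <= rho -> viol p <= d.
  move=> /hi h; have := Ea p; rewrite distrC in h; have := ltW (le_lt_trans (ler_norm _) h).
  rewrite /viol; lra.
have violP p : viol p <= d * (1 + enorm p).
  have [pr|rp] := leP (enorm p) rho.
    apply: (le_trans (near_v p pr)); rewrite ler_peMr ?(ltW d0)// lerDl; exact: enorm_ge0.
  have p0 : 0 < enorm p by exact: lt_trans rho0 rp.
  pose lam := rho / enorm p.
  have lam0 : 0 < lam by rewrite divr_gt0.
  have lam1 : lam <= 1 by rewrite ler_pdivrMr// mul1r ltW.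
  have lp : enorm (lam *: p) = rho by rewrite enormZ gtr0_norm// divfK// gt_eqF.
  have nv := near_v (lam *: p); rewrite lp lexx in nv; have {}nv := nv isT.
  have := g3 t tT x p 0 lam; rewrite (ltW lam0) lam1 scaler0 addr0 => /(_ isT) cv.
  have hv : lam * viol p <= d * rho.
    rewrite rhod; apply: (convexity_arith cv (ltW lam0)) => //.
    - by rewrite subr_ge0.
    - exact: ler_norm.
    - exact: le_trans (ler_norm _) (HB i).
    - by move: nv; rewrite /viol dotrZr.
  have -> : d * (1 + enorm p) = d + d * enorm p by rewrite mulrDr mulr1.
  apply: ler_wpDl; first exact: ltW.
  have e1 : d * rho = lam * (d * enorm p) by rewrite [RHS]mulrCA /lam divfK// gt_eqF.
  by rewrite e1 ler_pM2l in hv.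
have [|||b Eb ba] := @epiE_near R n (H_ i) t x a d.
- by move=> p q lam; exact: g3.
- exact: ltW.
- exact: violP.
have [_ /(_ b Eb) h] := selP g3 g4 x a tT; apply: (le_trans h).
by move: ba; rewrite /d; lra.
Qed.

(** The dominating function for the convergence of the projections: the violation constant is twice
    the growth bound, and 8 is this 2 times the factors 2 of [epiE_near] and of the selection. *)
Lemma sel_dist r t x a i : 0 < r -> t \in `[0, T] -> enorm x <= r -> epiE H t x a ->
  enorm (sel (H_ i) t x a - a) <= 8 * (m0 t + k r t * r + c t * (1 + r)).
Proof.
move=> r0 tT xr /epiEP Ea; have [g1 g2 g3 g4 gl] := hH_ i; have [h1 h2 h3 h4 hl] := hH.
set B := m0 t + k r t * r; set D := c t * (1 + r).
have HB p : `|H t x p| <= B + D * enorm p by exact: (H_traj_bound c0 ki h4 hl hm p r0 tT xr).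
have HiB p : `|H_ i t x p| <= B + D * enorm p.
  exact: (H_traj_bound c0 ki g4 gl (hm_ i) p r0 tT xr).
have B0 : 0 <= B.
  by have := HB 0; rewrite enorm0 mulr0 addr0; apply: le_trans; exact: normr_ge0.
have D0 : 0 <= D by rewrite mulr_ge0 ?c0// addr_ge0// ltW.
have [|||b Eb ba] := @epiE_near R n (H_ i) t x a (2 * (B + D)).
- by move=> p q lam; exact: g3.
- by rewrite mulr_ge0// addr_ge0.
- move=> p; apply: (linear_growth_arith B0 D0 (enorm_ge0 p) _ (ler_norm _) (HiB p) (HB p) (Ea p)).
  by rewrite -normrN; exact: ler_norm.
have [_ /(_ b Eb) h] := selP g3 g4 x a tT; apply: (le_trans h).
by move: ba; lra.
Qed.

Variables (t0 : R) (x : R -> 'rV[R]_n) (a : R -> 'rV[R]_(n + 1)) (y_ : nat -> 'rV[R]_n).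
Hypotheses (t00 : 0 <= t0) (t0T : t0 <= T) (adm : admissible H t0 T x a).
Hypothesis cy : y_ @ \oo --> x T.

Lemma recovery eta : 0 < eta -> \forall i \near \oo, exists x' a',
  [/\ admissible (H_ i) t0 T x' a', x' T = y_ i, enorm (x' t0 - x t0) <= eta &
      cost t0 T a' <= cost t0 T a + eta].
Proof.
move=> eta0; have ux := admissible_ucont t0T adm; have [ai Ea xE] := adm.
have [M M0 hM] := ucont_enorm_bounded t0T ux; pose r := M + 1.
have r0 : 0 < r by rewrite addr_gt0.
have xr t : t0 <= t <= T -> enorm (x t) <= r.
  by move=> tt; apply: le_trans (hM t tt) _; rewrite lerDl.
have tin t : t0 <= t <= T -> t \in `[0, T] by exact: in0T.
pose s i t := sel (H_ i) t (x t) (a t).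
pose del t := 8 * (m0 t + k r t * r + c t * (1 + r)).
have deli : Lintegrable `[t0, T] del.
  apply: rintegrableZ; first exact: mD.
  rewrite (_ : EFin \o _ = EFin \o (fun t => m0 t + k r t * r + c t * (1 + r) * 1)); last first.
    by apply/funext => t /=; rewrite mulr1.
  exact: (H_bound_integrable ci ki m0i t00 1 r0).
have sa i t : t0 <= t <= T -> enorm (s i t - a t) <= del t.
  by move=> tt; exact: sel_dist r0 (tin t tt) (xr t tt) (Ea t tt).
have ms i j : measurable_fun (`[t0, T]%classic : set LT) (fun t => s i t 0 j).
  have [g1 g2 g3 g4 gl] := hH_ i; apply: (sel_measurable g1 g2 g3 g4 _ t00 t0T ux).
  by move=> j'; exact: Lintegrable_measurable (ai j').
pose dd i j t := `|s i t 0 j - a t 0 j|.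
have dd_del i j t : t0 <= t <= T -> dd i j t <= del t.
  by move=> tt; apply: le_trans (sa i t tt); exact: coord_dist_le.
have si i j : Lintegrable `[t0, T] (fun t => s i t 0 j).
  apply: (@Lintegrable_dom R _ _ (fun t => `|a t 0 j| + del t)); [exact: mD|exact: ms| |].
    by apply: rintegrableD; [exact: mD|exact: Rintegrable_norm|exact: deli].
  move=> t; rewrite /= in_itv/= => tt; rewrite (coord_sub (s i t) (a t)).
  apply: le_trans (ler_normD _ _) _; rewrite lerD2l.
  exact: le_trans (coord_le_enorm _ _) (sa i t tt).
have ddi i j : Lintegrable `[t0, T] (dd i j).
  by apply: Rintegrable_norm; apply: rintegrableB; [exact: mD|exact: si|exact: ai].
have mdd i j : measurable_fun (`[t0, T]%classic : set LT) (dd i j).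
  exact: Lintegrable_measurable (ddi i j).
have cdd j : LI `[t0, T] (dd i j) @[i --> \oo] --> (0 : R).
  rewrite -(LI0 `[t0, T]%classic).
  apply: (LI_dominated (mD t0 T) (fun i => mdd i j) _ deli _).2.
    move=> t; rewrite /= in_itv/= => tt; apply/cvgrPdist_le => e e0.
    apply: filterS (sel_cvg (tin t tt) (Ea t tt) e0) => i hi.
    rewrite sub0r normrN /dd normr_id; apply: le_trans hi.
    exact: coord_dist_le.
  by move=> i t; rewrite /= in_itv/= => tt; rewrite /dd normr_id; exact: dd_del.
pose D i := \sum_j LI `[t0, T] (dd i j).
have ddge0 i j : 0 <= LI `[t0, T] (dd i j) by apply: LI_ge0 => t _; exact: normr_ge0.
have ddD i j : LI `[t0, T] (dd i j) <= D i.
  by rewrite /D (bigD1 j)//= lerDl sumr_ge0.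
have cD : D i @[i --> \oo] --> (0 : R).
  have -> : (0 : R) = \sum_(j < n + 1) (0 : R) by rewrite big1.
  by apply: cvg_sum_seq => j; exact: cdd.
(* The distance to x of the curve integrated backward from [y_ i] with the projected control: the
   endpoint error plus the L^1 error of the projection, in each coordinate. *)
pose e i := n%:R * (enorm (y_ i - x T) + D i).
pose E := lipE (n:=n) T t0 k r.
pose K := 8 * E * LI `[t0, T] (fun t => `|k r t|).
have E0 : 0 <= E by exact: expR_ge0.
have K0 : 0 <= K by rewrite mulr_ge0 ?mulr_ge0//; apply: LI_ge0 => t _; exact: normr_ge0.
(* One quantity dominates everything required: 2 e E for the smallness condition of [filippov] and
   for the initial point, and e K + D for the cost. *)
have cq : e i * (2 * E + K) + D i @[i --> \oo] --> (0 : R).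
  have -> : (0 : R) = n%:R * (0 + 0) * (2 * E + K) + 0 by rewrite !addr0 mulr0 mul0r.
  apply: cvgD; last exact: cD.
  apply: cvgM; last exact: cvg_cst.
  apply: cvgM; first exact: cvg_cst.
  apply: cvgD; last exact: cD.
  apply/cvgrPdist_le => d d0.
  have := (cvg_enormP (@eventually_filter) _ _).1 cy d d0; apply: filterS => i.
  by rewrite sub0r normrN ger0_norm ?enorm_ge0.
have m10 : 0 < Num.min 1 eta by rewrite lt_min ltr01.
have /cvgrPdist_le/(_ _ m10) := cq; apply: filterS => i.
rewrite sub0r normrN => /(le_trans (ler_norm _)); rewrite le_min => /andP[q1 q2].
have D0 : 0 <= D i by apply: sumr_ge0 => j _; exact: ddge0.
have e0 : 0 <= e i by rewrite mulr_ge0// addr_ge0// enorm_ge0.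
have [g1 g2 g3 g4 gl] := hH_ i.
have sE t : t0 <= t <= T -> epiE (H_ i) t (x t) (s i t).
  by move=> tt; exact: (selP g3 g4 _ _ (tin t tt)).1.
have ebx t : t0 <= t <= T -> enorm (backward T t0 (y_ i) (s i) t - x t) <= e i.
  move=> /andP[t1 t2]; have tt : t0 <= t <= T by rewrite t1 t2.
  apply: le_trans (enorm_le_sum _) _.
  apply: (@le_trans _ _ (\sum_(j < n) (enorm (y_ i - x T) + D i))); last first.
    by rewrite sumr_const card_ord /e mulr_natl.
  apply: ler_sum => j _; rewrite !mxE (xE t j tt).
  have := xE T j; rewrite t0T lexx => /(_ isT) xTj.
  have vi := admissible_vel j adm.
  have svi : Lintegrable `[t0, T] (fun t => lsubmx (s i t) 0 j).
    rewrite (_ : (fun t => _) = fun t => s i t 0 (lshift 1 j)); first exact: si.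
    by apply/funext => q; rewrite lsubE.
  rewrite (@LI_cat R t0 t T _ tt svi); rewrite (@LI_cat R t0 t T _ tt vi) in xTj.
  have -> : y_ i 0 j - (LI `[t0, t] (fun t => lsubmx (s i t) 0 j) + LI `[t, T] (fun t => lsubmx (s i t) 0 j)) +
      LI `[t0, t] (fun t => lsubmx (s i t) 0 j) - (x t0 0 j + LI `[t0, t] (fun s => lsubmx (a s) 0 j)) =
      (y_ i 0 j - x T 0 j) - (LI `[t, T] (fun t => lsubmx (s i t) 0 j) - LI `[t, T] (fun s => lsubmx (a s) 0 j)).
    by rewrite xTj; ring.
  apply: le_trans (ler_normB _ _) _; apply: lerD; first exact: coord_dist_le.
  have sub f := @LintegrableS R t0 T t T f t1 (lexx T).
  rewrite -LIB; [|exact: mD|exact: sub|exact: sub].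
  apply: le_trans (LI_normr (mD t T) _) _.
    by apply: rintegrableB; [exact: mD|exact: sub|exact: sub].
  apply: le_trans (ddD i (lshift 1 j)); rewrite (@LI_cat R t0 t T _ tt (ddi i (lshift 1 j))).
  rewrite (_ : (fun q => `|_|) = dd i (lshift 1 j)); last by apply/funext => q; rewrite !lsubE.
  by rewrite lerDr; apply: LI_ge0 => q _; exact: normr_ge0.
have C1 : 2 * (e i * E) <= 1 by move: (mulr_ge0 e0 K0); lra.
have xr1 t : t0 <= t <= T -> enorm (x t) + 1 <= r by move=> tt; rewrite lerD2r hM.
have [x' [a' [adm' x'T x'x a'a]]] :=
  filippov g1 g2 g3 g4 gl ki t00 t0T r0 xr1 (si i) sE ebx C1.
exists x', a'; split => //.
  apply: le_trans (x'x t0 _) _; first by rewrite lexx.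
  by apply: le_trans q2; move: (mulr_ge0 e0 K0); rewrite -/E; lra.
have keyi : Lintegrable `[t0, T] (fun t => `|k r t|).
  by apply: Rintegrable_norm; exact: (LintegrableS t00 (lexx T) (ki r0).1).
have cki : Lintegrable `[t0, T] (fun t => (8 * (e i * E)) * `|k r t|).
  by apply: rintegrableZ; [exact: mD|exact: keyi].
have ci1 := admissible_cost adm; have ddl := ddi i (rshift n 0).
have ksum : Lintegrable `[t0, T] (fun t => (8 * (e i * E)) * `|k r t| + dd i (rshift n 0) t).
  by apply: rintegrableD; [exact: mD|exact: cki|exact: ddl].
(* The cost changes twice: by Filippov's correction from [s i] to a', and by the projection from a
   to [s i]. *)
apply: (@le_trans _ _ (LI `[t0, T] (fun t => rsubmx (a t) 0 0 + ((8 * (e i * E)) * `|k r t| + dd i (rshift n 0) t)))).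
  apply: LI_le; [exact: mD|exact: admissible_cost adm'| |].
    by apply: rintegrableD; [exact: mD|exact: ci1|exact: ksum].
  move=> t; rewrite /= in_itv/= => tt; rewrite !rsubE.
  have := coord_dist_le (a' t) (s i t) (rshift n 0); have := a'a t tt.
  have := ler_norm (a' t 0 (rshift n 0) - s i t 0 (rshift n 0)).
  have := ler_norm (s i t 0 (rshift n 0) - a t 0 (rshift n 0)).
  rewrite -/(dd i (rshift n 0) t) -/E; move: (dd _ _ _) (enorm _) (`|_ - _|) => A1 A2 A3; lra.
rewrite (LID (mD t0 T) ci1 ksum) (LID (mD t0 T) cki ddl) (LIZ _ (mD t0 T) keyi).
rewrite lerD2l; apply: le_trans q2; rewrite /K.
have := ddD i (rshift n 0); have := mulr_ge0 e0 E0.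
move: (LI _ (dd _ _)) (LI _ (fun t => `|k r t|)) => L1 L2; lra.
Qed.

End Recovery.

(** * Epi-convergence *)

Section EpiLimits.
Context {R : realType}.
Implicit Types (u : nat -> \bar R) (V : \bar R).

Lemma ereal_between (x y : \bar R) : (x < y)%E -> exists r : R, (x < r%:E < y)%E.
Proof.
case: x y => [x||] [y||] //= xy.
- exists ((x + y) / 2); rewrite !lte_fin in xy *; rewrite !midf_lt//.
- by exists (x + 1); rewrite lte_fin ltrDl ltr01 ltry.
- by exists (y - 1); rewrite lte_fin gtrBl ltr01 ltNyr.
- by exists 0; rewrite ltNyr ltry.
Qed.

Lemma limn_einf_lt u (b : \bar R) : (limn_einf u < b)%E ->
  forall N, exists2 i, (N <= i)%N & (u i < b)%E.
Proof.
rewrite limn_einf_lim (cvg_lim _ (@cvg_einfs_sup R u))// => h N.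
have : (einfs u N < b)%E.
  by apply: le_lt_trans h; apply: ereal_sup_ubound; exists N.
by move=> /ereal_inf_lt[_ [i /= Ni <-]]; exists i.
Qed.

Lemma limn_einf_gt u (b : \bar R) : (b < limn_einf u)%E -> \forall i \near \oo, (b < u i)%E.
Proof.
rewrite limn_einf_lim (cvg_lim _ (@cvg_einfs_sup R u))// => /ereal_sup_gt[_ [N _ <-] h].
exists N => // i /= Ni; apply: lt_le_trans h _.
by apply: ereal_inf_lbound; exists i.
Qed.

Lemma limn_esup_lt u (b : \bar R) : (limn_esup u < b)%E -> \forall i \near \oo, (u i < b)%E.
Proof.
rewrite limn_esup_lim (cvg_lim _ (@cvg_esups_inf R u))// => /ereal_inf_lt[_ [N _ <-] h].
exists N => // i /= Ni; apply: le_lt_trans h.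
by apply: ereal_sup_ubound; exists i.
Qed.

Lemma limn_esup_le u (b : \bar R) : (\forall i \near \oo, (u i <= b)%E) -> (limn_esup u <= b)%E.
Proof.
rewrite limn_esup_lim (cvg_lim _ (@cvg_esups_inf R u))// => -[N _ h].
apply: (@le_trans _ _ (esups u N)); first by apply: ereal_inf_lbound; exists N.
by apply: ge_ereal_sup => _ [i /= Ni <-]; exact: h.
Qed.

(** The epi-liminf inequality speaks of full sequences; endpoints known along a subsequence are
    completed by the constant l. *)
Lemma fill_in {X : topologicalType} (chi : nat -> nat) (y_ : nat -> X) (l : X) :
  (forall m, (chi m < chi m.+1)%N) -> y_ @ \oo --> l ->
  exists2 w_ : nat -> X, w_ @ \oo --> l & forall m, w_ (chi m) = y_ m.
Proof.
move=> chiS yl; have chim := strict_mono chiS.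
have /choice[w_ hw] : forall i, exists w, (forall m, chi m = i -> w = y_ m) /\
    ((forall m, chi m <> i) -> w = l).
  move=> i; have [[m mi]|ni] := pselect (exists m, chi m = i).
    exists (y_ m); split => [m'|/(_ m)//]; rewrite -mi => mm; congr y_.
    by apply/eqP; rewrite eqn_leq -(chim m m') -(chim m' m) mm leqnn.
  by exists l; split => // m mi; case: ni; exists m.
exists w_ => [A Al|m]; last exact: (hw _).1.
have [N _ hN] := yl A Al; exists (chi N) => // i /= Ni.
have [[m mi]|ni] := pselect (exists m, chi m = i).
  by rewrite /= ((hw i).1 m mi); apply: hN => /=; rewrite -chim mi.
rewrite /= (hw i).2; first exact: nbhs_singleton.
by move=> m mi; apply: ni; exists m.
Qed.

(** At stage i the accuracy is the largest m <= i whose threshold has been passed; it tends to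
    infinity with i. *)
Lemma diagonal_choice (P : nat -> nat -> Prop) : (forall m, \forall i \near \oo, P m i) ->
  exists mu : nat -> nat, (forall m, \forall i \near \oo, (m <= mu i)%N) /\
    \forall i \near \oo, P (mu i) i.
Proof.
move=> h; have /choice[N hN] : forall m, exists N, forall i, (N <= i)%N -> P m i.
  by move=> m; have [N _ hN] := h m; exists N => i Ni; exact: hN.
pose mu i := \max_(m < i.+1 | (N m <= i)%N) (m : nat).
exists mu; split.
  move=> m; exists (maxn m (N m)) => // i /=; rewrite geq_max => /andP[mi Nmi].
  exact: (@leq_bigmax_cond _ (fun m : 'I_i.+1 => (N m <= i)%N) (fun m => m : nat) (Ordinal (mi : (m < i.+1)%N))).
(* From N 0 on, m = 0 qualifies, so the maximum is attained and not the default value of an empty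
   one. *)
exists (N 0%N) => // i /= Ni.
have [|j jP jE] := @eq_bigmax_cond _ (fun m : 'I_i.+1 => (N m <= i)%N) (fun m => m : nat).
  by apply/card_gt0P; exists ord0.
by rewrite /mu jE; apply: hN.
Qed.

(** Real levels descending to V, in a form that also covers V = -oo. *)
Lemma real_approx V : V != +oo%E -> exists al : nat -> R, [/\ forall m, (V < (al m)%:E)%E,
  forall m m', (m <= m')%N -> al m' <= al m & forall b, (V < b)%E -> exists m, ((al m)%:E <= b)%E].
Proof.
case: V => [v||]// _.
- exists (fun m => v + m.+1%:R^-1); split.
  + by move=> m; rewrite lte_fin ltrDl invr_gt0.
  + by move=> m m' mm; rewrite lerD2l lef_pV2 ?posrE// ler_nat.
  + case=> [b||]; last by [].
      by rewrite lte_fin => /ltr_add_invr[m /ltW h]; exists m.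
    by exists 0%N; rewrite leey.
- exists (fun m => - m%:R); split.
  + by move=> m; rewrite ltNyr.
  + by move=> m m' mm; rewrite lerN2 ler_nat.
  + case=> [b||]; last by [].
      move=> _; exists (Num.bound `|b|); rewrite lee_fin lerNl.
      apply: le_trans (ltW (archi_boundP (normr_ge0 b))).
      by rewrite -normrN; exact: ler_norm.
    by exists 0%N; rewrite leey.
Qed.

End EpiLimits.

Section EpiConvergence.
Context {R : realType} {n : nat}.
Variables (T : R) (c : R -> R) (k : R -> R -> R) (m0 : R -> R)
  (H_ : nat -> R -> 'rV[R]_n -> 'rV[R]_n -> R) (H : R -> 'rV[R]_n -> 'rV[R]_n -> R)
  (g_ : nat -> 'rV[R]_n -> \bar R) (g : 'rV[R]_n -> \bar R)
  (mu : probability (@BorelRV R (n + 1)) R).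
Hypotheses (ci : Lintegrable `[0, T] c) (c0 : forall t, t \in `[0, T] -> 0 <= c t).
Hypothesis ki : forall r : R, 0 < r ->
     Lintegrable `[0, T] (k r) /\ (forall t, t \in `[0, T] -> 0 <= k r t).
Hypothesis m0i : Lintegrable `[0, T] m0.
Hypotheses (hH_ : forall i, [/\ H1 T (H_ i), H2 T (H_ i), H3 T (H_ i), H4 T c (H_ i)
               & HLC T k (H_ i)]) (hm_ : forall i t, t \in `[0, T] -> `|H_ i t 0 0| <= m0 t).
Hypotheses (hH : [/\ H1 T H, H2 T H, H3 T H, H4 T c H & HLC T k H])
  (hm : forall t, t \in `[0, T] -> `|H t 0 0| <= m0 t).
Hypotheses (g_N : forall i y, g_ i y != -oo%E) (gN : forall y, g y != -oo%E).
Hypothesis g_g : epi_converge [set: 'rV[R]_n] g_ g.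
Hypothesis muS : sphere_measure mu.
Hypothesis cH : forall t, t \in `[0, T] ->
     forall K : set ('rV[R]_n * 'rV[R]_n), compact K ->
     forall eps : R, 0 < eps ->
       \forall i \near \oo, forall z, K z -> `|H_ i t z.1 z.2 - H t z.1 z.2| < eps.
Variables (t0 : R) (x0 : 'rV[R]_n).
Hypotheses (t00 : 0 <= t0) (t0T : t0 <= T).

Let V_ i t x := valuef T (g_ i) (steinerF mu (H_ i)) (steinerL mu (H_ i)) t x.
Let V t x := valuef T g (steinerF mu H) (steinerL mu H) t x.

Lemma H_cvg t x p : t \in `[0, T] -> H_ i t x p @[i --> \oo] --> H t x p.
Proof.
move=> tT; apply/cvgrPdist_lt => e e0.
apply: filterS (cH tT (@compact_set1 _ (x, p)) e0) => i h.
by rewrite distrC; exact: (h (x, p)).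
Qed.

Lemma value_liminf (t_ : nat -> R) (x_ : nat -> 'rV[R]_n) : (forall i, 0 <= t_ i <= T) ->
  t_ @ \oo --> t0 -> x_ @ \oo --> x0 ->
  (V t0 x0 <= limn_einf (fun i => V_ i (t_ i) (x_ i)))%E.
Proof.
(* A level b strictly between the two sides gives infinitely many i with admissible pairs of total
   cost below b. *)
move=> t_T ct cx; rewrite leNgt; apply/negP => /ereal_between[b /andP[ub bV]].
have often := limn_einf_lt ub.
have /choice[f hf] : forall N, exists i, (N <= i)%N /\ (V_ i (t_ i) (x_ i) < b%:E)%E.
  by move=> N; have [i Ni h] := often N; exists i.
pose psi := fix psi m := if m is m'.+1 then f (psi m').+1 else f 0%N.
have psiS m : (psi m < psi m.+1)%N by exact: (hf _).1.
have psib m : (V_ (psi m) (t_ (psi m)) (x_ (psi m)) < b%:E)%E.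
  by case: m => [|m]; exact: (hf _).2.
have /choice[xa hxa] : forall m, exists xa : (R -> 'rV[R]_n) * (R -> 'rV[R]_(n + 1)),
    [/\ admissible (H_ (psi m)) (t_ (psi m)) T xa.1 xa.2, xa.1 (t_ (psi m)) = x_ (psi m) &
        (g_ (psi m) (xa.1 T) + (cost (t_ (psi m)) T xa.2)%:E < b%:E)%E].
  move=> m; have /andP[ti0 tiT] := t_T (psi m).
  have [f1 f2 f3 f4 fl] := hH_ (psi m).
  have [x [a [h1 h2 h3]]] := value_lt ci c0 ki f1 f2 f3 f4 fl m0i (hm_ (psi m)) ti0 tiT muS
    (g_N (psi m)) (psib m).
  by exists (x, a).
have cpsi := strict_cvg psiS.
have cpt : t_ (psi m) @[m --> \oo] --> t0 by exact: (cvg_comp _ _ cpsi ct).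
have cpx : (xa m).1 (t_ (psi m)) @[m --> \oo] --> x0.
  rewrite (_ : (fun m => _) = fun m => x_ (psi m)); first exact: (cvg_comp _ _ cpsi cx).
  by apply/funext => m; have [] := hxa m.
have t0t : 0 <= t0 <= T by rewrite t00 t0T.
have cHp t x p : t \in `[0, T] -> H_ (psi m) t x p @[m --> \oo] --> H t x p.
  by move=> tT; exact: (cvg_comp _ _ cpsi (@H_cvg t x p tT)).
have adm_ m : admissible (H_ (psi m)) (t_ (psi m)) T (xa m).1 (xa m).2 by have [] := hxa m.
have [phi [phiS [x [xt0 cxT [C hC] hK]]]] := lower_limit ci c0 ki m0i (fun m => hH_ (psi m))
  (fun m => hm_ (psi m)) hH hm cHp (fun m => t_T (psi m)) t0t cpt adm_ cpx.
have chiS m : (psi (phi m) < psi (phi m.+1))%N.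
  by rewrite (leqW_mono (strict_mono psiS)); exact: phiS.
have [w_ cw w_chi] := fill_in chiS cxT.
have [/(_ w_ (fun=> Logic.I) cw) gw _] := @g_g (x T) Logic.I.
have key s : (s%:E < g (x T))%E -> exists2 a, admissible H t0 T x a & cost t0 T a <= b - s.
  move=> sg; apply: hK; have near_g := limn_einf_gt (lt_le_trans sg gw).
  have : \forall m \near \oo, (s%:E < g_ (psi (phi m)) (w_ (psi (phi m))))%E.
    exact: (strict_cvg chiS near_g).
  apply: filterS => m; rewrite w_chi => sm; have [_ _ h] := hxa (phi m).
  have := lt_trans (lte_leD _ sm (lexx (cost (t_ (psi (phi m))) T (xa (phi m)).2)%:E)) h.
  by rewrite -EFinD lte_fin => /(_ isT); lra.
have Vle a : admissible H t0 T x a -> (V t0 x0 <= g (x T) + (cost t0 T a)%:E)%E.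
  by move=> adm; rewrite -xt0; exact: value_le.
move: key Vle bV; rewrite -/(V t0 x0) => key Vle bV.
case E : (g (x T)) key Vle => [r||] key Vle; last by move: (gN (x T)); rewrite E.
  suff : (V t0 x0 <= b%:E)%E by rewrite leNgt bV.
  apply/lee_addgt0Pr => e e0; have [|a adm ca] := key (r - e).
    by rewrite lte_fin gtrBl.
  apply: le_trans (Vle a adm) _; rewrite -!EFinD lee_fin; lra.
(* If g (x T) = +oo, every real s is allowed in [key]; this one yields a cost of at most C - 1,
   below the lower bound C. *)
have [|a adm ca] := key (b - C + 1); first exact: ltry.
have := hC a adm; lra.
Qed.

Lemma value_limsup : exists2 x_ : nat -> 'rV[R]_n, x_ @ \oo --> x0 &
  (limn_esup (fun i => V_ i t0 (x_ i)) <= V t0 x0)%E.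
Proof.
have [Vy|Vy] := eqVneq (V t0 x0) +oo%E.
  by exists (fun=> x0); [exact: cvg_cst|rewrite Vy leey].
have [al [Val alm al_le]] := real_approx Vy.
have near_al m : \forall i \near \oo, exists x : 'rV[R]_n,
    enorm (x - x0) <= m.+1%:R^-1 /\ (V_ i t0 x <= (al m)%:E)%E.
  have [h1 h2 h3 h4 hl] := hH.
  have [x [a [adm xt0 cal]]] := value_lt ci c0 ki h1 h2 h3 h4 hl m0i hm t00 t0T muS gN (Val m).
  have [_ [y_ [_ cy] gy]] := @g_g (x T) Logic.I.
  have [r gr] : exists r, g (x T) = r%:E.
    by move: cal (gN (x T)); case: (g (x T)) => [r||]//; exists r.
  rewrite gr -EFinD lte_fin in cal.
  (* Half of the gap below [al m] is spent on the terminal cost and half on the running cost; the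
     first term places the initial point within 1 / (m + 1) of x0. *)
  pose eta := Num.min (m.+1%:R^-1) ((al m - (r + cost t0 T a)) / 2).
  have eta0 : 0 < eta by rewrite lt_min invr_gt0 ltr0n divr_gt0// subr_gt0.
  have near_g : \forall i \near \oo, (g_ i (y_ i) < (r + eta)%:E)%E.
    by apply: limn_esup_lt; apply: le_lt_trans gy _; rewrite gr lte_fin ltrDl.
  apply: filterS2 near_g (recovery ci c0 ki m0i hH_ hm_ hH hm cH t00 t0T adm cy eta0).
  move=> i gi [x' [a' [adm' x'T x'x ca']]]; exists (x' t0); split.
    by rewrite -xt0; apply: le_trans x'x _; rewrite /eta ge_min lexx.
  apply: le_trans (@value_le R n mu muS (H_ i) (g_ i) t0 T x' a' t0T adm') _; rewrite x'T.
  apply: le_trans (leeD (ltW gi) (lexx _)) _; rewrite -EFinD lee_fin.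
  have : eta <= (al m - (r + cost t0 T a)) / 2 by rewrite /eta ge_min lexx orbT.
  lra.
have [nu [nu_ge near_nu]] := diagonal_choice near_al.
have /choice[x_ hx] : forall i, exists x : 'rV[R]_n, (exists x : 'rV[R]_n,
    enorm (x - x0) <= (nu i).+1%:R^-1 /\ (V_ i t0 x <= (al (nu i))%:E)%E) ->
    enorm (x - x0) <= (nu i).+1%:R^-1 /\ (V_ i t0 x <= (al (nu i))%:E)%E.
  move=> i; have [[x hx]|h] := pselect (exists x : 'rV[R]_n,
    enorm (x - x0) <= (nu i).+1%:R^-1 /\ (V_ i t0 x <= (al (nu i))%:E)%E); first by exists x.
  (* This placeholder occurs for finitely many i only, by [near_nu]. *)
  by exists x0 => h'; case: h.
exists x_.
  apply/(cvg_enormP (@eventually_filter)) => e e0.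
  have [m] := ltr_add_invr e0; rewrite add0r => me.
  apply: filterS2 (nu_ge m) near_nu => i mi hi.
  apply: le_trans (hx i hi).1 _; apply: le_trans (ltW me).
  by rewrite lef_pV2 ?posrE ?ltr0n// ler_nat.
rewrite leNgt; apply/negP => /ereal_between[b /andP[Vb]]; have [m mb] := al_le _ Vb.
apply/negP; rewrite -leNgt; apply: limn_esup_le.
apply: filterS2 (nu_ge m) near_nu => i mi hi; apply: le_trans (hx i hi).2 _.
by apply: le_trans mb; rewrite lee_fin; exact: alm.
Qed.

End EpiConvergence.

Theorem theorem4p13 (R : realType) (n : nat) (T : R)
  (H_ : nat -> R -> 'rV[R]_n -> 'rV[R]_n -> R)
  (H : R -> 'rV[R]_n -> 'rV[R]_n -> R)
  (c : R -> R) (k : R -> R -> R) (m0 : R -> R)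
  (g_ : nat -> 'rV[R]_n -> \bar R) (g : 'rV[R]_n -> \bar R)
  (mu : probability (BorelRV (n + 1)) R) :
  (* the common functions c and k_r (r > 0) are nonnegative and integrable *)
  Lintegrable `[0, T] c -> (forall t, t \in `[0, T] -> 0 <= c t) ->
  (forall r : R, 0 < r ->
     Lintegrable `[0, T] (k r) /\ (forall t, t \in `[0, T] -> 0 <= k r t)) ->
  (* (H1)-(H4), (HLC) for every H_i and for H, with the same c and k *)
  (forall i, [/\ H1 T (H_ i), H2 T (H_ i), H3 T (H_ i), H4 T c (H_ i)
               & HLC T k (H_ i)]) ->
  [/\ H1 T H, H2 T H, H3 T H, H4 T c H & HLC T k H] ->
  (* g_i, g proper, lsc, and g_i epi-converges to g *)
  (forall i, proper_fun (g_ i) /\ lower_semicontinuous (g_ i)) ->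
  proper_fun g -> lower_semicontinuous g ->
  epi_converge [set: 'rV[R]_n] g_ g ->
  (* max{|H_i(t,0,0)|, |H(t,0,0)|} <= mu(t), mu integrable *)
  Lintegrable `[0, T] m0 ->
  (forall i t, t \in `[0, T] -> Num.max `|H_ i t 0 0| `|H t 0 0| <= m0 t) ->
  (* mu is the normalized rotation-invariant measure on S^n, used in the
     Steiner representations *)
  sphere_measure mu ->
  (* H_i(t,.,.) -> H(t,.,.) uniformly on compact sets, for every t *)
  (forall t, t \in `[0, T] ->
     forall K : set ('rV[R]_n * 'rV[R]_n), compact K ->
     forall eps : R, 0 < eps ->
       \forall i \near \oo, forall z, K z -> `|H_ i t z.1 z.2 - H t z.1 z.2| < eps) ->
  (* conclusion: V_i epi-converge to V on [0,T] x R^n *)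
  epi_converge [set z : R * 'rV[R]_n | z.1 \in `[0, T]]
    (fun i z => valuef T (g_ i) (steinerF mu (H_ i)) (steinerL mu (H_ i)) z.1 z.2)
    (fun z => valuef T g (steinerF mu H) (steinerL mu H) z.1 z.2).
Proof.
move=> ci c0 ki hH_ hH hg_ hg _ g_g m0i hm muS cH [t0 x0] /=; rewrite in_itv/= => /andP[t00 t0T].
have hm_ i t : t \in `[0, T] -> `|H_ i t 0 0| <= m0 t.
  by move=> tT; apply: le_trans (hm i t tT); rewrite le_max lexx.
have hm0 t : t \in `[0, T] -> `|H t 0 0| <= m0 t.
  by move=> tT; apply: le_trans (hm 0%N t tT); rewrite le_max lexx orbT.
have g_N i : forall y, g_ i y != -oo%E by have [[]] := hg_ i.
have gN : forall y, g y != -oo%E by have [] := hg.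
split.
- move=> z_ z_T cz.
  apply: (value_liminf ci c0 ki m0i hH_ hm_ hH hm0 g_N gN g_g muS cH t00 t0T).
  + by move=> i; have := z_T i; rewrite in_itv.
  + exact: (cvg_comp _ _ cz (@cvg_fst _ _ _ _ _)).
  + exact: (cvg_comp _ _ cz (@cvg_snd _ _ _ _ _)).
- have [x_ cx V_le] := value_limsup ci c0 ki m0i hH_ hm_ hH hm0 gN g_g muS cH x0 t00 t0T.
  exists (fun i => (t0, x_ i)); last exact: V_le.
  split; first by move=> i; rewrite /= in_itv/= t00 t0T.
  exact: (cvg_pair (cvg_cst t0) cx).
Qed.
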